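(* Suppose that the proportional vanishing $L^1$-Sobolev inequality holds with constant $C$, that is, $$\int_{B}|w|\le C\,r(B)\int_{2B}|\nabla_A w|$$ for every control ball $B$ with $2B\subset\Omega$ and every Lipschitz function $w$ on $2B$ that vanishes on a subset $E$ of $B$ with $|E|\ge\frac12|B|$. Then there is a constant $C_1>0$, depending only on $C$, such that the following holds. Fix $x$ and $r>0$ with $B(x,2r)\subset\Omega$, and suppose that $w$ is a real-valued function on $B(x,2r)$ with $w_+\in W_A^{1,2}(B(x,2r))$ and $\int_{B(x,2r)}|\nabla_A w_+(y)|^2\,dy\le C_0$. Set $$\mathcal{A}\equiv\{y\in B(x,r):w(y)\le0\},\quad \mathcal{C}\equiv\{z\in B(x,r):w(z)\ge1\},\quad \mathcal{D}\equiv\{y\in B(x,2r):0<w(y)<1\}.$$ If $|\mathcal{A}|\ge\frac12|B(x,r)|$, then $$C_0|\mathcal{D}|\ge C_1\left(\frac{|\mathcal{A}|\,|\mathcal{C}|}{r\,|B(x,r)|}\right)^2.$$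
   Context: $n\ge2$, $\Omega\subset\mathbb{R}^n$ is a bounded domain, and $F=-\ln f$ is a geometry satisfying the structure conditions; $f=e^{-F}$ on $(0,\infty)$, $f(x_1)$ is understood as $f(|x_1|)$ with $f(0)=0$. The structure conditions on $F:(0,\infty)\to\mathbb{R}$ are, for some $R>0$, $C\ge1$, $\varepsilon>0$: (i) $\lim_{x\to0^+}F(x)=+\infty$; (ii) $F'(x)<0$ and $F''(x)>0$ for $x\in(0,R)$; (iii) $\frac1C|F'(r)|\le|F'(x)|\le C|F'(r)|$ for $\frac12 r<x<2r<R$; (iv) $\frac{1}{-xF'(x)}$ is increasing on $(0,R)$ and bounded by $\frac1\varepsilon$ there; (v) $\frac{F''(x)}{-F'(x)}\approx\frac1x$ on $(0,R)$. $M_F(x)=\begin{bmatrix}I_{n-1}&0\\0&f(x_1)^2\end{bmatrix}$. Control balls $B(x,r)$ are the balls of the control (subunit) metric of $M_F$: $d(x,y)$ is the infimum of $T>0$ such that there is a Lipschitz curve $\gamma:[0,T]\to\mathbb{R}^n$ from $x$ to $y$ with $(\gamma'(t)\cdot\xi)^2\le\xi^{T}M_F(\gamma(t))\xi$ for a.e. $t$ and all $\xi\in\mathbb{R}^n$. For $B=B(x,r)$, $r(B)=r$ and $2B=B(x,2r)$; $|\cdot|$ is Lebesgue measure. $A(x)=B(x)^{T}B(x)$ with $B(x)$ a Lipschitz $n\times n$ real matrix function, $A(x)$ comparable to $M_F(x)$ as quadratic forms (uniformly in $x$), and $\nabla_A=B(x)\nabla$. $W_A^{1,2}(U)$ is the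 space of $v\in L^2(U)$ with (weak) $\nabla_Av\in L^2(U)$, normed by $\left(\int_U(|v|^2+|\nabla_Av|^2)\right)^{1/2}$. $w_+=\max\{w,0\}$. *)

(* Defs.v *)
(* Points of R^n are row vectors 'rV[R]_n (x_1 is x 0 ord0 and x_n is
   x 0 ord_max), gradients are column vectors.  The library norm of 'rV[R]_n
   is the sup norm; it is only used for topology, boundedness and the
   Lipschitz property, which do not depend on the choice of a norm.
   Euclidean lengths are written enorm. *)
From HB Require Import structures.
From mathcomp Require Export all_boot all_order all_algebra.
From mathcomp Require Export all_classical all_reals all_analysis.
Set Implicit Arguments.
Unset Strict Implicit.
Unset Printing Implicit Defensive.
Export Order.TTheory GRing.Theory Num.Theory.
Export numFieldNormedType.Exports.

Local Open Scope classical_set_scope.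
Local Open Scope ring_scope.

Section image_measure.
Context d1 d2 (T1 : measurableType d1) (T2 : measurableType d2) (R : realType).
Variables (f : T1 -> T2) (mf : measurable_fun [set: T1] f).
Variable mu : {measure set T1 -> \bar R}.

(* [pushforward mu f], with the measurability of [f] recorded as an argument
   so that the measure structure can be inferred. *)
Definition image_measure of measurable_fun [set: T1] f := pushforward mu f.

Local Notation nu := (image_measure mf).

Let nu0 : nu set0 = 0%E.
Proof. exact: measure0. Qed.

Let nu_ge0 A : (0 <= nu A)%E.
Proof. exact: measure_ge0. Qed.

Let nu_sigma_additive : semi_sigma_additive nu.
Proof. exact: (@measure_semi_sigma_additive _ _ _ (pushforward mu f)). Qed.

HB.instance Definition _ :=
  isMeasure.Build _ _ _ nu nu0 nu_ge0 nu_sigma_additive.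

End image_measure.

Section lebesgue_rV.
Context {R : realType}.
Local Notation T := (measurableTypeR R).

Lemma measurable_tuple_cons n : measurable_fun [set: n.-tuple T * T]
  (fun p => [the n.+1.-tuple T of p.2 :: p.1]).
Proof. exact: measurable_cons. Qed.

Fixpoint lebesgue_tuple n : {measure set (n.-tuple T) -> \bar R} :=
  match n return {measure set (n.-tuple T) -> \bar R} with
  | 0 => dirac ([tuple] : 0.-tuple T)
  | m.+1 => image_measure (lebesgue_tuple m \x (@lebesgue_measure R))%E
              (@measurable_tuple_cons m)
  end.

Definition tuple_of_rV n (x : 'rV[R]_n) : n.-tuple T :=
  [tuple x 0 i | i < n].

Definition rV_of_tuple n (t : n.-tuple T) : 'rV[R]_n :=
  \row_(i < n) tnth t i.

(* 'rV[R]_n with the sigma-algebra generated by the coordinates. *)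
Definition borel_rV n : measurableType _ :=
  g_sigma_algebra_preimageType (@tuple_of_rV n).

Lemma measurable_rV_of_tuple n :
  measurable_fun [set: n.-tuple T] (@rV_of_tuple n : _ -> borel_rV n).
Proof.
move=> _ _ [B mB <-]; rewrite !setTI.
suff -> : @rV_of_tuple n @^-1` (@tuple_of_rV n @^-1` B) = B by [].
apply/seteqP; split=> t /=; rewrite (_ : tuple_of_rV _ = t)//;
  by apply: eq_from_tnth => i; rewrite tnth_mktuple mxE.
Qed.

Definition borel_lebesgue n : {measure set (borel_rV n) -> \bar R} :=
  image_measure (lebesgue_tuple n) (@measurable_rV_of_tuple n).

(* Lebesgue measure on R^n: the completion of the n-fold product of the
   one-dimensional one.  [leb_rV n] is 'rV[R]_n with the sigma-algebra of
   Lebesgue measurable sets. *)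
Definition leb_rV n : measurableType _ :=
  caratheodory_type (mu_ext (borel_lebesgue n)).

Definition lebesgue n : {measure set (leb_rV n) -> \bar R} :=
  @completed_measure_extension _ _ _ (borel_lebesgue n).

(* |A|; only applied to subsets of a bounded set, where it is not truncated. *)
Definition vol n (A : set 'rV[R]_n) : R := fine (lebesgue n A).

End lebesgue_rV.
Arguments leb_rV : clear implicits.
Arguments lebesgue R n : clear implicits.

Section geometry.
Context {R : realType}.
Implicit Types (F : R -> R).

(* F is only constrained on (0, +oo); "increasing" is read as nondecreasing,
   and the relation "comparable" of the last condition has its own constant. *)
Definition structure_conditions F : Prop :=
  exists R0 C eps : R, [/\ 0 < R0, 1 <= C, 0 < eps &
  [/\ F x @[x --> 0^'+] --> +oo,
      forall x, 0 < x < R0 ->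
        [/\ derivable F x 1, derivable (derive1 F) x 1,
            derive1 F x < 0 & 0 < derive1 (derive1 F) x],
      forall r x, 2^-1 * r < x < 2 * r -> 2 * r < R0 ->
        C^-1 * `|derive1 F r| <= `|derive1 F x| <= C * `|derive1 F r|,
      (forall x y, 0 < x -> x <= y -> y < R0 ->
         (- x * derive1 F x)^-1 <= (- y * derive1 F y)^-1) /\
      (forall x, 0 < x < R0 -> (- x * derive1 F x)^-1 <= eps^-1) &
      exists2 K : R, 0 < K & forall x, 0 < x < R0 ->
        K^-1 * x^-1 <= derive1 (derive1 F) x / - derive1 F x <= K * x^-1]].

(* t |-> f(|t|), with f = exp(-F) on (0, +oo) and f(0) = 0. *)
Definition geom F (t : R) : R := if t == 0 then 0 else expR (- F `|t|).

Definition M_F F n (x : 'rV[R]_n.+1) : 'M[R]_n.+1 :=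
  diag_mx (\row_j if j == ord_max then geom F (x 0 ord0) ^+ 2 else 1).

Definition dotv n (u v : 'rV[R]_n) : R := \sum_j u 0 j * v 0 j.

Definition qform n (M : 'M[R]_n) (xi : 'rV[R]_n) : R :=
  dotv (xi *m M) xi.

Definition enorm n (v : 'cV[R]_n) : R := Num.sqrt (\sum_i v i 0 ^+ 2).

Definition subunit_curve F n (T : R) (gamma : R -> 'rV[R]_n.+1) : Prop :=
  [lipschitz gamma t | t in `[0, T]] /\
  {ae lebesgue_measure, forall t : R, t \in `[0, T] ->
     derivable gamma t 1 /\
     forall xi : 'rV[R]_n.+1,
       dotv (derive1 gamma t) xi ^+ 2 <= qform (M_F F (gamma t)) xi}.

(* The infimum is +oo when no subunit curve joins x to y. *)
Definition cdist F n (x y : 'rV[R]_n.+1) : \bar R :=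
  ereal_inf [set T%:E | T in [set T : R | 0 < T /\
    exists gamma, [/\ subunit_curve F T gamma, gamma 0 = x & gamma T = y]]].

Definition cball F n (x : 'rV[R]_n.+1) (r : R) : set 'rV[R]_n.+1 :=
  [set y | (cdist F x y < r%:E)%E].

Definition bounded_domain n (Omega : set 'rV[R]_n) : Prop :=
  [/\ open Omega, connected Omega, Omega !=set0 & bounded_set Omega].

Definition comparable_on n (U : set 'rV[R]_n) (M N : 'rV[R]_n -> 'M[R]_n) :=
  exists2 K : R, 0 < K & forall x, U x -> forall xi,
    K^-1 * qform (N x) xi <= qform (M x) xi <= K * qform (N x) xi.

End geometry.

Section sobolev.
Context {R : realType} {n : nat}.
Implicit Types (U : set 'rV[R]_n) (B : 'rV[R]_n -> 'M[R]_n).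

Definition partial (j : 'I_n) (f : 'rV[R]_n -> R) (x : 'rV[R]_n) : R :=
  'D_(delta_mx 0 j) f x.

(* The pointwise A-gradient; it is defined a.e. for a Lipschitz [w]. *)
Definition nablaA B (w : 'rV[R]_n -> R) (x : 'rV[R]_n) : 'cV[R]_n :=
  B x *m (\col_j partial j w x).

Fixpoint Cn (k : nat) (f : 'rV[R]_n -> R) : Prop :=
  continuous f /\
  if k is k'.+1 then
    forall j, (forall x, derivable f x (delta_mx 0 j)) /\ Cn k' (partial j f)
  else True.

(* phi \in C_c^oo(U) *)
Definition test_function U (phi : 'rV[R]_n -> R) : Prop :=
  [/\ forall k, Cn k phi,
      compact (closure [set x | phi x != 0]) &
      closure [set x | phi x != 0] `<=` U].

Definition L2 U (v : 'rV[R]_n -> R) : Prop :=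
  measurable_fun (U : set (leb_rV R n)) v /\
  (lebesgue R n).-integrable U (fun x => (v x ^+ 2)%:E).

(* [g] is the A-gradient of [v] in the sense of distributions on [U].  The
   i-th component of nabla_A is the vector field sum_j B_ij d_j, whose formal
   adjoint is phi |-> - sum_j d_j (B_ij phi); as B is Lipschitz, B_ij phi is
   differentiable a.e. with bounded derivatives. *)
Definition weak_nablaA B U (v : 'rV[R]_n -> R) (g : 'rV[R]_n -> 'cV[R]_n) :=
  forall (i : 'I_n) phi, test_function U phi ->
    (\int[lebesgue R n]_(x in U) (g x i 0 * phi x)%:E =
     - \int[lebesgue R n]_(x in U)
         (v x * \sum_j partial j (fun z => B z i j * phi z) x)%:E)%E.

(* v \in W_A^{1,2}(U), with weak A-gradient [g] (unique up to a null set). *)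
Definition W12A B U (v : 'rV[R]_n -> R) (g : 'rV[R]_n -> 'cV[R]_n) : Prop :=
  [/\ L2 U v, forall i, L2 U (fun x => g x i 0) & weak_nablaA B U v g].

End sobolev.

Definition prop_vanishing_sobolev (R : realType) (n : nat) (F : R -> R)
    (Omega : set 'rV[R]_n.+1) (B : 'rV[R]_n.+1 -> 'M[R]_n.+1) (C : R) : Prop :=
  forall (x : 'rV[R]_n.+1) (r : R), 0 < r -> cball F x (2 * r) `<=` Omega ->
  forall (w : 'rV[R]_n.+1 -> R) (E : set 'rV[R]_n.+1),
    [lipschitz w y | y in cball F x (2 * r)] ->
    measurable (E : set (leb_rV R n.+1)) ->
    E `<=` cball F x r ->
    (forall y, E y -> w y = 0) ->
    2^-1 * vol (cball F x r) <= vol E ->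
    (\int[lebesgue R n.+1]_(y in cball F x r) `|w y|%:E <=
     (C * r)%:E *
       \int[lebesgue R n.+1]_(y in cball F x (2 * r))
         (enorm (nablaA B w y))%:E)%E.

(* Main.v *)
(* For w_+ smooth enough one would apply the Sobolev inequality to H(w_+), where
   H is a smooth step from 0 to 1: it vanishes on the set A and is 1 on the set
   C, so |C| is at most r times the integral over D of |nabla_A w_+|, up to a
   constant, and the Cauchy-Schwarz inequality concludes.

   As w_+ is only in W_A^{1,2}, it is mollified.  By Friedrichs' lemma (the
   commutator of a vector field with Lipschitz coefficients and a mollification
   tends to 0 in L^1), the mollifications phi converge to w_+ in L^1 together with
   their A-gradients, on the slightly smaller balls 2B' of radius 2r' < 2r, which
   are at a positive distance from the complement of 2B.  The set where phi is
   small may have slightly less than half of the measure of B'; so H(phi) is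
   multiplied by a cutoff vanishing on a small cube that meets C in a set of
   positive measure.  The integral of the gradient of the cutoff is of the order
   of the side of the cube to the power n - 1, hence small since n >= 2. *)

From HB Require Import structures.
Require Import Defs.
From mathcomp Require Import measurable_realfun ring lra.

Set Implicit Arguments.
Unset Strict Implicit.
Unset Printing Implicit Defensive.

Local Open Scope classical_set_scope.
Local Open Scope ring_scope.

(** Cauchy-Schwarz is used pointwise, as [4 * G <= 2 * t * G ^+ 2 + 2 / t] with a fixed [t > 0],
    where [G] is the length of the weak gradient. For fixed [t] every error enters linearly and can
    be sent to 0; only afterwards is [t] optimised, which produces the 16 of the final constant. The
    step is 0 below 1/4 and 1 above 3/4, so that a point which the mollification puts on the wrong
    side carries an error of at least 1/4 and is charged to the L^1 error. The chain rule is thus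
    needed for the mollification only, never for a Sobolev function. The parameters are chosen in a
    fixed order: the side of the small cube from the tolerance alone, then its centre, and only then
    the inner radius and the mollification error, which must be small compared with the measure of
    the part of C in the cube. The lower bound on the measure of A makes the Sobolev inequality
    applicable; the ratio of this measure to that of the ball, which appears in the conclusion, is
    simply bounded by 1. *)

Lemma ae_imply d (T : measurableType d) (R : realType)
  (mu : {measure set T -> \bar R}) (P Q : T -> Prop) :
  (forall x, P x -> Q x) -> {ae mu, forall x, P x} -> {ae mu, forall x, Q x}.
Proof. by move=> PQ; apply: filterS => //; exact: (ae_filter_ringOfSetsType mu). Qed.

(** * Integrable real functions and L^1 distances *)

Section real_integrals.
Context d (X : measurableType d) (R : realType) (mu : {measure set X -> \bar R}).
Local Notation meas f := (measurable_fun [set: X] f).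
Local Notation intg f := (mu.-integrable [set: X] (EFin \o f)).
Implicit Types (f g h v w : X -> R) (D Q : set X).

Lemma intg_meas f : intg f -> meas f.
Proof. by move=> iff; apply/measurable_EFinP; exact: measurable_int iff. Qed.

Lemma intg_le f g : meas f -> (forall y, `|f y| <= g y) -> intg g -> intg f.
Proof.
move=> mf fg; apply: le_integrable => //; first exact/measurable_EFinP.
by move=> y _ /=; rewrite lee_fin (le_trans (fg y))// ler_norm.
Qed.

Lemma intgD f g : intg f -> intg g -> intg (fun y => f y + g y).
Proof. by move=> If Ig; exact: (integrableD measurableT If Ig). Qed.

Lemma intgB f g : intg f -> intg g -> intg (fun y => f y - g y).
Proof. by move=> If Ig; exact: (integrableB measurableT If Ig). Qed.

Lemma intgZ (k : R) f : intg f -> intg (fun y => k * f y).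
Proof. by move=> If; exact: (integrableZl measurableT k If). Qed.

Lemma intg_sum (I : Type) (s : seq I) (P : pred I) (F : I -> X -> R) :
  (forall i, intg (F i)) -> intg (fun y => \sum_(i <- s | P i) F i y).
Proof.
move=> IF; rewrite (_ : EFin \o _ = fun y => (\sum_(i <- s | P i) (F i y)%:E)%E); last first.
  by apply/funext => y; rewrite /= sumEFin.
by apply: integrable_sum => // i _; exact: IF.
Qed.

Lemma Rintegral_sum (I : Type) (s : seq I) (P : pred I) (F : I -> X -> R) :
  (forall i, intg (F i)) ->
  \int[mu]_y (\sum_(i <- s | P i) F i y) = \sum_(i <- s | P i) \int[mu]_y F i y.
Proof.
move=> IF; elim: s => [|i s IH].
  by under eq_Rintegral do rewrite big_nil; rewrite Rintegral_cst// mul0r big_nil.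
rewrite big_cons -IH; case: ifP => Pi; last first.
  by apply: eq_Rintegral => y _; rewrite big_cons Pi.
by rewrite -RintegralD//; [apply: eq_Rintegral => y _; rewrite big_cons Pi|exact: intg_sum].
Qed.

Lemma intg_norm f : intg f -> intg (fun y => `|f y|).
Proof. exact: (@integrable_norm _ _ _ mu setT). Qed.

Lemma intgM_bounded v w (M : R) : intg v -> meas w -> (forall y, `|w y| <= M) ->
  intg (fun y => v y * w y).
Proof.
move=> iv mw wM; apply: (@intg_le _ (fun y => M * `|v y|)).
- by apply: measurable_funM => //; exact: intg_meas.
- by move=> y; rewrite normrM mulrC ler_wpM2r.
- exact: (integrableZl measurableT M (intg_norm iv)).
Qed.

Lemma intg_supported w (M : R) D : measurable D -> (mu D < +oo)%E -> meas w ->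
  (forall y, `|w y| <= M) -> (forall y, ~ D y -> w y = 0) -> intg w.
Proof.
move=> mD Doo mw wM w0.
rewrite (_ : EFin \o w = (EFin \o w) \_ D); last first.
  apply/funext => y; rewrite patchE; case: ifPn => // yD.
  by rewrite /= w0//; move: yD; rewrite notin_setE.
apply/(integrable_mkcond _ mD).
apply: measurable_bounded_integrable => //.
- exact: measurable_funTS.
- exists M; split; first exact: num_real.
  by move=> c Mc y _ /=; exact: le_trans (wM y) (ltW Mc).
Qed.

Lemma meas_absB Q f g : meas f -> meas g ->
  measurable_fun Q (fun y => `|f y - g y|%:E).
Proof.
move=> mf mg; apply: measurable_funTS; apply/measurable_EFinP.
by apply: measurableT_comp => //; exact: measurable_funB.
Qed.

(** Valued in [\bar R], so that estimates on it ask for measurability only. *)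
Definition L1dist Q f g : \bar R := (\int[mu]_(y in Q) `|f y - g y|%:E)%E.

Lemma L1distC Q f g : L1dist Q f g = L1dist Q g f.
Proof. by apply: eq_integral => y _; rewrite distrC. Qed.

(** The pointwise bound is integrated as it stands. With [k = k' = 1] it yields the triangle
    inequality; in general it handles Lipschitz functions of two arguments. *)
Lemma L1dist_le Q f g f' g' (k k' : R) h h' : measurable Q -> 0 <= k -> 0 <= k' ->
  meas f -> meas g -> meas f' -> meas g' -> meas h -> meas h' ->
  (forall y, Q y -> `|f y - g y| <= k * `|f' y - g' y| + k' * `|h y - h' y|) ->
  (L1dist Q f g <= k%:E * L1dist Q f' g' + k'%:E * L1dist Q h h')%E.
Proof.
move=> mQ k0 k0' mf mg mf' mg' mh mh' H.
rewrite /L1dist -!ge0_integralZl//; [|exact: meas_absB..].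
rewrite -ge0_integralD//; first last.
- by apply: emeasurable_funM => //; exact: meas_absB.
- by move=> y _; rewrite -EFinM lee_fin mulr_ge0.
- by apply: emeasurable_funM => //; exact: meas_absB.
- by move=> y _; rewrite -EFinM lee_fin mulr_ge0.
apply: ge0_le_integral => //.
- exact: meas_absB.
- by apply: emeasurable_funD; apply: emeasurable_funM => //; exact: meas_absB.
Qed.

Lemma L1dist_indic Q (A B : set X) : measurable Q -> measurable A -> measurable B ->
  A `<=` B -> L1dist Q (\1_B) (\1_A) = mu ((B `\` A) `&` Q).
Proof.
move=> mQ mA mB AB; rewrite -integral_indic//; last exact: measurableD.
apply: eq_integral => y _; congr EFin; rewrite !indicE in_setD.
have [yB|yB] := boolP (y \in B); have [yA|yA] := boolP (y \in A) => //=.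
- by rewrite subrr normr0.
- by rewrite subr0 normr1.
- by move: yA yB; rewrite inE notin_setE => /AB.
- by rewrite subr0 normr0.
Qed.

Lemma meas_lincomb (s : seq R) (F : R -> X -> R) : (forall q, meas (F q)) ->
  meas (fun y => \sum_(q <- s) q * F q y).
Proof. by move=> mF; apply: measurable_sum => q; exact: measurable_funM. Qed.

Lemma integral_const_indic (c : R) (A : set X) : 0 <= c -> measurable A ->
  (\int[mu]_x (c%:E * (\1_A x)%:E) = c%:E * mu A)%E.
Proof.
move=> c0 mA; rewrite ge0_integralZl// ?integral_indic ?setIT//.
by apply/measurable_EFinP; exact: measurable_indic.
Qed.

End real_integrals.

(** * Lebesgue measure on R^n *)

(* Unfolding [lebesgue] to an outer measure makes simplification diverge. *)
#[global] Arguments lebesgue : simpl never.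

Section translation.
Context {R : realType}.
Local Notation T := (measurableTypeR R).

Lemma measurable_addr (h : R) : measurable_fun [set: T] (fun t : T => t + h : T).
Proof. exact: measurable_funD. Qed.

(** Lebesgue measure is determined by its values on half-open intervals, and a translate of such an
    interval has the same length. *)
Lemma lebesgue_measure_addr (h : R) (A : set T) : measurable A ->
  lebesgue_measure ((fun t : T => t + h) @^-1` A) = lebesgue_measure A.
Proof.
move=> mA; apply/esym.
rewrite -[RHS]/(image_measure lebesgue_measure (measurable_addr h) A).
apply: lebesgue_measure_unique => //.
move=> X /ocitvP[->|[[a b] /= ab ->]]; first by rewrite !measure0.
rewrite /image_measure /pushforward.
rewrite (_ : _ @^-1` _ = `]a - h, b - h]%classic); last first.
  by apply/seteqP; split => x /=; rewrite !in_itv/= ltrBlDr lerBrDr.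
rewrite !lebesgue_measure_itv/= !lte_fin ltrD2r ab.
by rewrite ?EFinB -?EFinB; congr EFin; ring.
Qed.

Definition tuple_shift n (h : 'I_n -> R) (t : n.-tuple T) : n.-tuple T :=
  [tuple tnth t i + h i | i < n].

Lemma measurable_tuple_shift n (h : 'I_n -> R) :
  measurable_fun [set: n.-tuple T] (tuple_shift h).
Proof.
apply/measurable_fun_tnthP => i.
rewrite (_ : _ \o _ = fun t : n.-tuple T => tnth t i + h i); last first.
  by apply/funext => t /=; rewrite tnth_mktuple.
by apply: measurable_funD => //; exact: measurable_tnth.
Qed.

(** Induction on [n], slicing along the head coordinate: a slice of the preimage is a
    one-dimensional translate of the slice of [A] over the shifted tail. The translation is absorbed
    by the case of the line, the shift of the tail by the induction hypothesis and a change of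
    variables. *)
Lemma lebesgue_tuple_shift n (h : 'I_n -> R) (A : set (n.-tuple T)) :
  measurable A -> lebesgue_tuple n (tuple_shift h @^-1` A) = lebesgue_tuple n A.
Proof.
elim: n h A => [|n IH] h A mA.
  by congr (lebesgue_tuple _ _); apply/seteqP; split => t /=; rewrite (tuple0 (tuple_shift _ _)) (tuple0 t).
rewrite /= /image_measure /pushforward.
pose c := (fun p : n.-tuple T * T => [the n.+1.-tuple T of p.2 :: p.1]).
have mc : measurable (c @^-1` A) by rewrite -[X in measurable X]setTI; exact: measurable_tuple_cons.
have mcs : measurable (c @^-1` (tuple_shift h @^-1` A)).
  rewrite -[X in measurable X]setTI; apply: measurable_tuple_cons => //.
  by rewrite -[X in measurable X]setTI; apply: measurable_tuple_shift.
pose h' : 'I_n -> R := fun i => h (lift ord0 i).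
have E x : xsection (c @^-1` (tuple_shift h @^-1` A)) x =
   (fun t => t + h ord0) @^-1` xsection (c @^-1` A) (tuple_shift h' x).
  apply/seteqP; split => y; rewrite /xsection /= !inE /c /=.
    move=> H; rewrite (_ : cons_tuple _ _ = tuple_shift h (cons_tuple y x))//.
    apply: eq_from_tnth => i; rewrite tnth_mktuple.
    by case: (unliftP ord0 i) => [j|] ->; rewrite ?tnthS ?tnth0 // tnth_mktuple.
  move=> H; rewrite (_ : tuple_shift h (cons_tuple y x) = (cons_tuple (y + h ord0) (tuple_shift h' x)))//.
  apply: eq_from_tnth => i; rewrite tnth_mktuple.
  by case: (unliftP ord0 i) => [j|] ->; rewrite ?tnthS ?tnth0 // tnth_mktuple.
rewrite /product_measure1/=.
transitivity (\int[lebesgue_tuple n]_x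
    ((lebesgue_measure \o xsection (c @^-1` A)) \o tuple_shift h') x)%E.
  apply: eq_integral => x _; rewrite [xsection _ _]E lebesgue_measure_addr//.
  exact: measurable_xsection.
have mx : measurable_fun setT (lebesgue_measure \o xsection (c @^-1` A)).
  exact: measurable_fun_xsection.
rewrite -(@ge0_integral_pushforward _ _ _ _ _ _ (measurable_tuple_shift h') (lebesgue_tuple n) setT)//.
apply: eq_measure_integral => [|mh B mB _]; first exact: measurable_tuple_shift.
exact: (IH h' B mB).
Qed.

Lemma lebesgue_tuple_box n (I : 'I_n -> set T) (l : 'I_n -> R) :
  (forall i, measurable (I i)) ->
  (forall i, lebesgue_measure (I i) = (l i)%:E) ->
  lebesgue_tuple n [set t | forall i, I i (tnth t i)] = (\prod_i l i)%:E.
Proof.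
elim: n I l => [|n IH] I l mI Il.
  rewrite big_ord0 /=.
  by rewrite diracE mem_set// => -[].
rewrite /= /image_measure /pushforward.
rewrite (_ : _ @^-1` _ =
  [set t : n.-tuple T | forall i, I (lift ord0 i) (tnth t i)] `*` I ord0); last first.
  apply/seteqP; split => -[t y] /=.
    move=> H; split; last by have := H ord0; rewrite tnth0.
    by move=> i; have := H (lift ord0 i); rewrite tnthS.
  move=> [H1 H2] i; case: (unliftP ord0 i) => [j|] ->; rewrite ?tnthS ?tnth0 //.
rewrite product_measure1E//; last first.
  rewrite (_ : [set _ | _] = \bigcap_(i in [set: 'I_n]) ((@tnth n T)^~ i @^-1` I (lift ord0 i))); last first.
    by apply/seteqP; split => t /= H i; [move=> _; exact: H|exact: H].
  apply: fin_bigcap_measurable => // i _.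
  by rewrite -[X in measurable X]setTI; apply: measurable_tnth.
rewrite [X in (X * _)%E](IH (fun i => I (lift ord0 i)) (fun i => l (lift ord0 i)))//.
by rewrite [X in (_ * X)%E]Il -EFinM big_ord_recl mulrC.
Qed.

End translation.

Section lebesgue_translation.
Context {R : realType} {n : nat}.
Local Notation T := (measurableTypeR R).
Local Notation V := 'rV[R]_n.
Local Notation X := (leb_rV R n).
Local Notation mu := (lebesgue R n).

Lemma borel_leb_measurable (A : set V) :
  measurable (A : set (@borel_rV R n)) -> measurable (A : set X).
Proof.
move=> mA; apply: sub_caratheodory; exact: sub_sigma_algebra.
Qed.

Lemma lebesgueE (A : set V) :
  measurable (A : set (@borel_rV R n)) -> mu A = @borel_lebesgue R n A.
Proof. exact: measurable_mu_extE. Qed.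

Lemma lebesgue_complete : measure_is_complete mu.
Proof. exact: measure_is_complete_caratheodory. Qed.

Lemma borel_coord (i : 'I_n) :
  measurable_fun [set: @borel_rV R n] (fun x : @borel_rV R n => (x : V) 0 i : T).
Proof.
rewrite (_ : (fun _ => _) = (@tnth n T)^~ i \o @tuple_of_rV R n); last first.
  by apply/funext => x /=; rewrite tnth_mktuple.
apply: measurableT_comp; first exact: measurable_tnth.
move=> _ B mB; rewrite setTI; exists B => //; exact: setTI.
Qed.

Definition box (I : 'I_n -> set R) : set V := [set x | forall i, I i (x 0 i)].

Lemma borel_box (I : 'I_n -> set R) : (forall i, measurable (I i : set T)) ->
  measurable (box I : set (@borel_rV R n)).
Proof.
move=> mI.
rewrite (_ : box I = \bigcap_(i in [set: 'I_n])
   ((fun x : @borel_rV R n => (x : V) 0 i : T) @^-1` I i)); last first.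
  by apply/seteqP; split => t /= H i; [move=> _; exact: H|exact: H].
apply: fin_bigcap_measurable => // i _.
by rewrite -[X in measurable X]setTI; apply: borel_coord.
Qed.

Lemma lebesgue_box (I : 'I_n -> set R) (l : 'I_n -> R) :
  (forall i, measurable (I i : set T)) ->
  (forall i, lebesgue_measure (I i : set T) = (l i)%:E) ->
  mu (box I) = (\prod_i l i)%:E.
Proof.
move=> mI Il; rewrite lebesgueE; last exact: borel_box.
rewrite /borel_lebesgue /image_measure /pushforward -(lebesgue_tuple_box mI Il).
congr (lebesgue_tuple _ _); apply/seteqP; split => t /= H i; have := H i; by rewrite mxE.
Qed.

Lemma borel_shift (h : V) :
  measurable_fun [set: @borel_rV R n] (fun x : @borel_rV R n => (x : V) + h : @borel_rV R n).
Proof.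
move=> _ _ [B mB <-]; rewrite !setTI.
exists (tuple_shift (fun i => h 0 i) @^-1` B).
  by rewrite -[X in measurable X]setTI; exact: (measurable_tuple_shift _ measurableT mB).
rewrite setTI.
have E x : tuple_of_rV (x + h) = tuple_shift (fun i => h 0 i) (tuple_of_rV x).
  by apply: eq_from_tnth => i; rewrite !tnth_mktuple mxE.
by apply/seteqP; split => x /=; rewrite E.
Qed.

Lemma lebesgue_shift (h : V) (A : set V) : measurable (A : set (@borel_rV R n)) ->
  mu ((fun x => x + h) @^-1` A) = mu A.
Proof.
move=> mA.
have mA' : measurable ((fun x => x + h) @^-1` A : set (@borel_rV R n)).
  by rewrite -[X in measurable X]setTI; exact: (borel_shift h measurableT mA).
rewrite !lebesgueE// /borel_lebesgue /image_measure /pushforward.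
have mt : measurable (@rV_of_tuple R n @^-1` A : set (n.-tuple T)).
  by rewrite -[X in measurable X]setTI; exact: (measurable_rV_of_tuple measurableT mA).
transitivity (lebesgue_tuple n (tuple_shift (fun i => h 0 i) @^-1` (@rV_of_tuple R n @^-1` A))); last exact: lebesgue_tuple_shift.
congr (lebesgue_tuple _ _); apply/seteqP; split => t /=;
 by rewrite (_ : rV_of_tuple (tuple_shift _ _) = rV_of_tuple t + h)//;
  apply/rowP => i; rewrite !mxE tnth_mktuple.
Qed.

End lebesgue_translation.

Section borel_lebesgue.
Context {R : realType} {n : nat}.
Local Notation T := (measurableTypeR R).
Local Notation V := 'rV[R]_n.
Local Notation X := (leb_rV R n).
Local Notation BX := (@borel_rV R n).
Local Notation mu := (lebesgue R n).

(** The norm is the sup norm, so balls are cubes; their measure is then a product of lengths. *)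
Lemma ball_rVE (x : V) e : 0 < e -> ball x e = box (fun i => ball (x 0 i) e).
Proof.
move=> e0; apply/seteqP; split => y /=.
  by move=> [_ H] i; exact: H.
by move=> H; split => // i j; rewrite (ord1 i); exact: H.
Qed.

Lemma lt_ball_rV (x : V) e y : 0 < e ->
  ball x e y <-> forall i, `|x 0 i - y 0 i| < e.
Proof. by move=> e0; rewrite ball_rVE. Qed.

Lemma coord_le_norm (x : V) i : `|x 0 i| <= `|x|.
Proof.
rewrite [leRHS]/Num.norm/= mx_normrE.
by apply/bigmax_geP; right; exists (0, i).
Qed.

Lemma borel_ball (x : V) e : measurable (ball x e : set BX).
Proof.
have [e0|e0] := ltP 0 e.
  by rewrite ball_rVE//; apply: borel_box => i; exact: measurable_ball.
rewrite (_ : ball x e = set0)//; apply/seteqP; split => // y [].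
by rewrite ltNge e0.
Qed.

Lemma lebesgue_ball (x : V) e : 0 < e -> mu (ball x e) = ((e *+ 2) ^+ n)%:E.
Proof.
move=> e0; rewrite ball_rVE// (@lebesgue_box _ _ _ (fun=> e *+ 2)).
- by rewrite prodr_const card_ord.
- by move=> i; exact: measurable_ball.
- by move=> i; rewrite lebesgue_measure_ball// ltW.
Qed.

(** Second countability: the open set is the union of the cubes with rational centre and radius
    [k.+1%:R^-1] that it contains, enumerated by [unpickle]. *)
Lemma borel_open (O : set V) : open O -> measurable (O : set BX).
Proof.
move=> oO.
pose F (m : nat) : set V := if @unpickle ('rV[rat]_n * nat)%type m is Some qk
  then let b := ball (map_mx ratr qk.1 : V) qk.2.+1%:R^-1 in
    if `[< b `<=` O >] then b else set0 else set0.
have -> : O = \bigcup_m F m.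
  apply/seteqP; split => x; last first.
    rewrite /F => -[m _]; case: unpickle => // qk /=.
    by case: asboolP => [H Hx|//]; exact: H.
  move=> Ox.
  have /nbhs_ballP[e /= e0 xeO] : nbhs x O by apply: open_nbhs_nbhs.
  (* Half of [e]: a cube of radius [k.+1%:R^-1] whose centre is that close to [x] stays within
     distance [e] of [x]. *)
  have [k ke] : exists k, k.+1%:R^-1 < e / 2.
    have e20 : 0 < e / 2 by rewrite divr_gt0.
    by have [k _ Hk] := near_infty_natSinv_lt (PosNum e20); exists k; apply: Hk => /=.
  pose r : R := k.+1%:R^-1.
  have r0 : 0 < r by rewrite invr_gt0.
  have /choice[q Hq] : forall i, exists q : rat, `|x 0 i - ratr q| < r.
    move=> i; have /rat_in_itvoo[q /[!in_itv]/= /andP[q1 q2]] : x 0 i < x 0 i + r by rewrite ltrDl.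
    by exists q; rewrite distrC ger0_norm ?subr_ge0; [rewrite ltrBlDl|exact: ltW].
  exists (pickle ((\row_i q i : 'rV[rat]_n), k)) => //.
  rewrite /F pickleK /= -/r.
  case: asboolP => [_|[]].
    by apply/lt_ball_rV => // i; rewrite !mxE distrC.
  move=> y /lt_ball_rV - /(_ r0) H; apply: xeO; apply/lt_ball_rV => // i.
  have := H i; rewrite !mxE => H2; have H1 := Hq i.
  apply: le_lt_trans (ler_distD (ratr (q i)) _ _) _.
  rewrite -/r in ke; lra.
apply: bigcupT_measurable => m; rewrite /F; case: unpickle => //= qk.
by case: asboolP => _ //; exact: borel_ball.
Qed.

Lemma borel_continuous (f : V -> R) : continuous f ->
  measurable_fun [set: BX] (f : BX -> T).
Proof.
move=> cf; apply: (measurability _ (RGenOInfty.measurableE R)) => // _ [_ [x ->] <-].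
rewrite setTI; apply: borel_open; apply: open_comp; last exact: interval_open.
by move=> y _; exact: cf.
Qed.

Lemma leb_borel_fun d (Y : measurableType d) (f : V -> Y) :
  measurable_fun [set: BX] (f : BX -> Y) -> measurable_fun [set: X] (f : X -> Y).
Proof.
move=> mf _ B mB; rewrite setTI; apply: borel_leb_measurable.
by rewrite -[X in measurable X]setTI; exact: (mf measurableT B mB).
Qed.

Lemma leb_continuous (f : V -> R) : continuous f ->
  measurable_fun [set: X] (f : X -> T).
Proof. by move=> /borel_continuous/leb_borel_fun. Qed.

Lemma leb_open (O : set V) : open O -> measurable (O : set X).
Proof. by move/borel_open/borel_leb_measurable. Qed.

Lemma leb_ball (x : V) e : measurable (ball x e : set X).
Proof. exact/borel_leb_measurable/borel_ball. Qed.

Lemma leb_coord i : measurable_fun [set: X] (fun x : X => (x : V) 0 i : T).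
Proof. by apply: leb_borel_fun; exact: borel_coord. Qed.

Lemma lebesgue_sigma_finite : sigma_finite [set: X] mu.
Proof.
exists (fun k => ball (0 : V) k.+1%:R).
  apply/seteqP; split => // x _; have [N Nx] : exists N, `|x| < N.+1%:R.
    exists (Num.trunc `|x|).
    by have /andP[_] := truncn_itv (normr_ge0 x).
  exists N => //=; apply/lt_ball_rV => // i; rewrite mxE sub0r normrN.
  exact: le_lt_trans (coord_le_norm _ _) Nx.
move=> k; split; first exact: leb_ball.
by rewrite lebesgue_ball// ltry.
Qed.

(** The same measure with its sigma-finiteness attached, as Tonelli's theorem demands. *)
Definition lebesgue_sf : {sigma_finite_measure set X -> \bar R} :=
  HB.pack (@completed_measure_extension _ _ _ (@borel_lebesgue R n))
    (Measure_isSigmaFinite.Build _ _ _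
      (@completed_measure_extension _ _ _ (@borel_lebesgue R n)) lebesgue_sigma_finite).

Lemma lebesgue_bounded (A : set V) : bounded_set A -> measurable (A : set X) ->
  (mu A < +oo)%E.
Proof.
move=> [M [_ /(_ (`|M| + 1))]]; rewrite (le_lt_trans (ler_norm M))// ?ltrDl// => /(_ isT) MA mA.
have e0 : 0 < `|M| + 2 by rewrite ltr_wpDl.
apply: (@le_lt_trans _ _ (mu (ball (0 : V) (`|M| + 2)))); last first.
  by rewrite lebesgue_ball// ltry.
apply: le_measure; rewrite ?inE//; first exact: leb_ball.
move=> x /MA xM; apply/lt_ball_rV => // i; rewrite mxE sub0r normrN.
apply: le_lt_trans (coord_le_norm _ _) _.
by apply: le_lt_trans xM _; rewrite ltrD2l ltr1n.
Qed.

(** Translations preserve the Borel sigma-algebra and the measure of Borel sets. So [f] is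
    integrated against the restriction of [mu] to Borel sets, written as the image of [mu] under the
    identity map from [X] to [BX]. *)
Lemma ge0_integral_shift (h : V) (f : V -> \bar R) :
  measurable_fun [set: BX] (f : BX -> \bar R) -> (forall y, 0 <= f y)%E ->
  (\int[mu]_y f ((y : V) + h)%R = \int[mu]_y f y)%E.
Proof.
move=> mf f0.
have mid : measurable_fun [set: X] (fun x : X => (x : BX)).
  by apply: leb_borel_fun; exact: measurable_id.
have E g : measurable_fun [set: BX] (g : BX -> \bar R) -> (forall y, 0 <= g y)%E ->
    (\int[mu]_y g y = \int[pushforward mu (fun x : X => (x : BX))]_y g y)%E.
  by move=> mg g0; rewrite ge0_integral_pushforward.
have mh := @borel_shift R n h.
rewrite (E f)// (E (fun y => f (y + h))); last 2 first.
- exact: (measurableT_comp mf mh).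
- by move=> y; exact: f0.
pose nu : {measure set BX -> \bar R} := image_measure mu mid.
transitivity (\int[nu]_y (f \o ((fun y : BX => (y : V) + h : BX)%R)) y)%E => //.
transitivity (\int[nu]_y f y)%E => //.
rewrite -[LHS](@ge0_integral_pushforward _ _ _ _ _ _ mh nu setT f)//.
apply: eq_measure_integral => B mB _.
exact: lebesgue_shift.
Qed.

Lemma integral_shift (h : V) (f : V -> R) :
  measurable_fun [set: BX] (f : BX -> T) ->
  (\int[mu]_y (f ((y : V) + h)%R)%:E = \int[mu]_y (f y)%:E)%E.
Proof.
move=> mf; rewrite integralE [RHS]integralE.
have mf' : measurable_fun [set: BX] ((EFin \o f) : BX -> \bar R) by apply/measurable_EFinP.
congr (_ - _)%E; (etransitivity; last first).
- by apply: (@ge0_integral_shift h (EFin \o f)^\+%E) => //; exact: measurable_funepos.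
- by apply: eq_integral => y _; rewrite !funeposE.
- by apply: (@ge0_integral_shift h (EFin \o f)^\-%E) => //; exact: measurable_funeneg.
- by apply: eq_integral => y _; rewrite !funenegE.
Qed.

End borel_lebesgue.

(** * Almost everywhere derivability of Lipschitz functions *)

Section monotone_lipschitz.
Context {R : realType}.
Local Notation T := (measurableTypeR R).
Local Notation lam := (@lebesgue_measure R).

Lemma lipschitz_bound_continuous (V W : normedModType R) (f : V -> W) (K : R) :
  (forall x y, `|f x - f y| <= K * `|x - y|) -> continuous f.
Proof.
move=> fK x; apply/cvgrPdist_le => e e0; near=> y.
have K0 : 0 < `|K| + 1 by rewrite ltr_wpDl.
apply: le_trans (fK _ _) _; apply: (@le_trans _ _ ((`|K| + 1) * `|x - y|)).
  by rewrite ler_wpM2r// (le_trans (ler_norm K))// lerDl.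
rewrite mulrC -ler_pdivlMr//.
by near: y; apply: cvgr_dist_le => //; rewrite divr_gt0.
Unshelve. all: by end_near. Qed.

(** A null set is covered by half-open intervals of total length below [e / K]; the increments of
    [g] over them are at most [K] times the lengths, hence sum to at most [e]. *)
Lemma stieltjes_dominates (g : cumulative R R) (K : R) : 0 < K ->
  (forall x y, x <= y -> g y - g x <= K * (y - x)) ->
  forall A : set T, lam A = 0%E -> lebesgue_stieltjes_measure g A = 0%E.
Proof.
move=> K0 gK A A0; apply/eqP; rewrite eq_le; apply/andP; split; last exact: mu_ext_ge0.
apply/lee_addgt0Pr => e e0; rewrite add0e.
have : (lam A < (e / K)%:E)%E by rewrite A0 lte_fin divr_gt0.
move=> /ereal_inf_lt[_ [F [mF AF] <-] Fe].
apply: (@le_trans _ _ (\sum_(k <oo) wlength g (F k))%E).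
  by apply: ereal_inf_lbound; exists F.
apply: (@le_trans _ _ (K%:E * \sum_(k <oo) wlength idfun (F k))%E).
  rewrite -nneseriesZl//; apply: lee_nneseries => // k _.
  have := mF k => /ocitvP[->|[[a b]/= ab ->]]; first by rewrite !wlength0 mule0.
  by rewrite !wlength_itv_bnd ?(ltW ab)//= -EFinM lee_fin gK// ltW.
by rewrite muleC -lee_pdivlMr// ltW.
Qed.

(* The Stieltjes measure of [g] is absolutely continuous; its Radon-Nikodym
   density is the derivative of [g] by the fundamental theorem of calculus. *)
Lemma monotone_lipschitz_ae_derivable (g : R -> R) (K : R) : 0 < K ->
  {homo g : x y / x <= y} ->
  (forall x y, x <= y -> g y - g x <= K * (y - x)) ->
  {ae lam, forall x, derivable g x 1}.
Proof.
move=> K0 ndg gK.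
have gL x y : `|g x - g y| <= K * `|x - y|.
  wlog xy : x y / y <= x => [H|].
    have [|/ltW] := leP y x; first exact: H.
    by rewrite distrC (distrC x); exact: H.
  by rewrite !ger0_norm ?subr_ge0 ?ndg ?gK.
have cg := lipschitz_bound_continuous gL.
pose c : cumulative R R := HB.pack g
  (isCumulative.Build R _ R g ndg (right_continuousW cg)).
(* Radon-Nikodym is applied to a finite measure, hence on a bounded interval; every real lies in one
   of these intervals. *)
suff H (N : nat) : {ae lam, forall x, - N.+1%:R < x -> x < N.+1%:R -> derivable g x 1}.
  have /ae_foralln := H; apply: filterS => x /= Hx.
  have [N xN] : exists N, `|x| < N.+1%:R.
    by exists (Num.trunc `|x|); have /andP[] := truncn_itv (normr_ge0 x).
  by move: xN; rewrite ltr_norml => /andP[]; exact: Hx.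
pose I : set T := `]- N.+1%:R, N.+1%:R]%classic.
have mI : measurable I by exact: measurable_itv.
have nuI (a b : R) : a <= b -> lebesgue_stieltjes_measure c `]a, b]%classic = (g b - g a)%:E.
  move=> ab; rewrite /lebesgue_stieltjes_measure /measure_extension measurable_mu_extE/=; last exact: is_ocitv.
  by rewrite wlength_itv_bnd.
have N0 : - N.+1%:R <= N.+1%:R :> R by rewrite ge0_cp.
have nuoo : (lebesgue_stieltjes_measure c I < +oo)%E by rewrite nuI// ltry.
pose nu : {finite_measure set T -> \bar R} := mfrestr mI nuoo.
have nulam : nu `<< lam.
  apply/null_content_dominatesP => A mA A0.
  rewrite /nu/= /mfrestr /mrestr.
  apply: (@stieltjes_dominates c K K0 gK).
  by apply: (subset_measure0 _ mA) => //; exact: measurableI.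
have [h [h0 hfin inth hE]] := radon_nikodym_sigma_finite nulam.
have hfine : h = EFin \o (fine \o h) by apply/funext => x /=; rewrite fineK.
have mh : measurable_fun setT (fine \o h).
  by apply/measurable_EFinP; rewrite -hfine; exact: measurable_int inth.
have loch : locally_integrable [set: R] (fine \o h).
  apply: open_integrable_locally; first exact: openT.
  by rewrite -hfine.
have inth' y : lam.-integrable [set` Interval (BRight (- N.+1%:R)) (BRight y)] (EFin \o (fine \o h)).
  by rewrite -hfine; apply: integrableS inth.
have := FTC1 inth' loch.
apply: filterS; first exact: (ae_filter_ringOfSetsType lam).
move=> x /= Hx Nx xN.
have [] := Hx; first by [].
set F := (F in derivable F).
move=> dF _.
(* Near [x], the primitive of the density [h] is [g] up to the constant [g (- N.+1%:R)]. *)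
have E : {near x, F =1 fun y => g y - g (- N.+1%:R)}.
  near=> y.
  have Ny : - N.+1%:R < y by near: y; exact: lt_nbhsr.
  have yN : y < N.+1%:R by near: y; exact: lt_nbhsl.
  rewrite /F /Rintegral.
  transitivity (fine (\int[lam]_(t in `]- N.+1%:R, y]) h t)); first by rewrite [in RHS]hfine.
  rewrite -hE// /nu/= /mfrestr /mrestr.
  rewrite setIidl ?nuI//; first exact: ltW.
  move=> z /=; rewrite !in_itv/= => /andP[z1 zy]; apply/andP; split => //; exact: le_trans zy (ltW yN).
have : derivable (fun y => F y + g (- N.+1%:R)) x 1 by apply: derivableD.
apply: near_eq_derivable; apply: filterS E => y ->; by rewrite subrK.
Unshelve. all: by end_near. Qed.

End monotone_lipschitz.

Section lipschitz_derivable.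
Context {R : realType}.
Local Notation T := (measurableTypeR R).
Local Notation lam := (@lebesgue_measure R).

(** Adding [L * x] makes [f] nondecreasing, keeps it Lipschitz with constant [L * 2], and does not
    affect derivability. *)
Lemma lipschitz_ae_derivable (f : R -> R) (K : R) :
  (forall x y, `|f x - f y| <= K * `|x - y|) -> {ae lam, forall x, derivable f x 1}.
Proof.
move=> fK; pose L := `|K| + 1.
have L0 : 0 < L by rewrite ltr_wpDl.
have fL x y : x <= y -> `|f y - f x| <= L * (y - x).
  move=> xy; apply: le_trans (fK _ _) _; rewrite ger0_norm ?subr_ge0//.
  by rewrite ler_wpM2r ?subr_ge0// (le_trans (ler_norm K))// lerDl.
have := @monotone_lipschitz_ae_derivable R (fun x => f x + L * x) (L * 2).
rewrite mulr_gt0// => /(_ isT) H.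
have : {ae lam, forall x, derivable (fun x => f x + L * x) x 1}.
  apply: H => x y xy; have := fL _ _ xy; rewrite ler_norml; nra.
apply: filterS; first exact: (ae_filter_ringOfSetsType lam).
move=> x /= dx.
rewrite (_ : f = (fun x => f x + L * x) - (fun x => L * x)); last first.
  by apply/funext => y /=; rewrite /GRing.add/= /GRing.opp/= addrK.
by apply: derivableB => //; exact: derivableM.
Qed.

Context {n : nat}.
Local Notation V := 'rV[R]_n.
Local Notation X := (leb_rV R n).
Local Notation BX := (@borel_rV R n).
Local Notation mu := (lebesgue R n).

(** Joint measurability in the parameter and the base point, for Tonelli's theorem along the lines
    of direction [h]. *)
Lemma measurable_line (h : V) : measurable_fun [set: T * X]
  (fun z : T * X => ((z.2 : V) + (z.1 : R) *: h : BX)).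
Proof.
move=> _ _ [B mB <-]; rewrite !setTI.
have : measurable_fun [set: T * X] (fun z : T * X => @tuple_of_rV R n ((z.2 : V) + (z.1 : R) *: h)).
  apply/measurable_fun_tnthP => i.
  rewrite (_ : _ \o _ = fun z : T * X => (z.2 : V) 0 i + (z.1 : R) * h 0 i); last first.
    by apply/funext => z /=; rewrite tnth_mktuple !mxE.
  apply: measurable_funD.
    exact: (measurableT_comp (@leb_coord R n i)).
  by apply: measurable_funM.
by move/(_ measurableT _ mB); rewrite setTI.
Qed.

Section direction.
Variables (phi : V -> R) (K : R) (h : V).
Hypothesis phiK : forall x y, `|phi x - phi y| <= K * `|x - y|.

Let q (y : V) (t : R) := t^-1 * (phi (t *: h + y) - phi y).

Let cphi : continuous phi := lipschitz_bound_continuous phiK.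

Let cq1 (t : R) : continuous (q ^~ t).
Proof.
apply: (@lipschitz_bound_continuous _ _ _ _ (`|t^-1| * (K + K))) => x y.
rewrite /q -mulrBr normrM -mulrA ler_wpM2l// mulrDl.
have -> : phi (t *: h + x) - phi x - (phi (t *: h + y) - phi y) =
  (phi (t *: h + x) - phi (t *: h + y)) - (phi x - phi y) by ring.
apply: le_trans (ler_normB _ _) _; apply: lerD (phiK _ _).
apply: le_trans (phiK _ _) _.
by rewrite opprD addrACA subrr add0r.
Qed.

Let cq2 (y : V) (t : R) : t != 0 -> {for t, continuous (q y)}.
Proof.
move=> t0; apply: cvgM; first by apply: cvgV => //; exact: cvg_id.
apply: cvgB; last exact: cvg_cst.
apply: (@lipschitz_bound_continuous _ _ _ _ (K * `|h|)) => a b.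
apply: le_trans (phiK _ _) _.
by rewrite opprD addrACA subrr addr0 -scalerBl normrZ mulrA mulrAC.
Qed.

Let close (s t : rat) (k m : nat) : set V :=
  [set y | s != 0 -> t != 0 -> `|ratr s : R| < m.+1%:R^-1 -> `|ratr t : R| < m.+1%:R^-1 ->
    `|q y (ratr s) - q y (ratr t)| <= k.+1%:R^-1].

Let rt (i : nat) : rat := odflt 0 (unpickle i).
Let rtK r : rt (pickle r) = r. Proof. by rewrite /rt pickleK. Qed.

(* The set where the difference quotient [q y] is Cauchy at 0 along the
   rationals: a Borel form of derivability. *)
Let G : set V := \bigcap_k \bigcup_m \bigcap_i \bigcap_j close (rt i) (rt j) k m.

Let derivableE y : derivable phi y h <-> G y.
Proof.
split.
  move=> /cvg_ex[/= l ql] k _.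
  have k0 : 0 < k.+1%:R^-1 / 2 :> R by rewrite divr_gt0.
  have := ql; move/cvgrPdist_lt/(_ _ k0) => [d /= d0 Hd].
  have [m _ /(_ m (leqnn m)) md] := near_infty_natSinv_lt (PosNum d0).
  exists m => // i _ j _; move: (rt i) (rt j) => s t s0 t0 sm tm.
  have Hs (r : rat) : r != 0 -> `|ratr r : R| < m.+1%:R^-1 -> `|l - q y (ratr r)| < k.+1%:R^-1 / 2.
    move=> r0 rm; apply: Hd; last by rewrite fmorph_eq0.
    by rewrite /= sub0r normrN; exact: lt_trans rm md.
  have := ler_distD l (q y (ratr s)) (q y (ratr t)); rewrite (distrC _ l).
  have := Hs _ s0 sm; have := Hs _ t0 tm; move: (k.+1%:R^-1 : R) => c; lra.
move=> Gy.
have H k : exists m, forall (s : rat) (t : R), s != 0 -> t != 0 ->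
    `|ratr s : R| < m.+1%:R^-1 -> `|t : R| < m.+1%:R^-1 ->
    `|q y (ratr s) - q y t| <= k.+1%:R^-1.
  (* Membership in [G] compares rational steps only; as [q y] is continuous away from 0, a violation
     at a real [t] would persist at a nearby rational. *)
  have [m _ Hm] := Gy k Logic.I; exists m => s t s0 t0 sm tm.
  rewrite leNgt; apply/negP => kq.
  pose d := `|q y (ratr s) - q y t| - k.+1%:R^-1.
  have d0 : 0 < d by rewrite subr_gt0.
  have := @cq2 y t t0; move=> /cvgrPdist_lt/(_ _ d0) qd.
  have tm' : \forall u \near t, `|u : R| < m.+1%:R^-1.
    have : `|u : R| @[u --> t] --> `|t| by apply: cvg_norm; exact: cvg_id.
    by move/cvgr_lt; apply.
  have t0' : \forall u \near t, u != 0 by exact: (cvgr_neq0 _ (@cvg_id _ (nbhs t)) t0).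
  have /nbhs_ballP[e /= e0 He] : nbhs t (fun u => [/\ u != 0, `|u : R| < m.+1%:R^-1 & `|q y t - q y u| < d]).
    near=> u; split; near: u; [exact: t0'|exact: tm'|exact: qd].
  have /rat_in_itvoo[r /[!in_itv]/= /andP[r1 r2]] : t < t + e by rewrite ltrDl.
  have [|r0 rm rd] := He (ratr r).
    by rewrite /ball/= distrC ger0_norm ?subr_ge0 ?ltW// ltrBlDl.
  rewrite fmorph_eq0 in r0.
  have := Hm (pickle s) Logic.I (pickle r) Logic.I; rewrite !rtK => /(_ s0 r0 sm rm).
  have := ler_distD (q y (ratr r)) (q y (ratr s)) (q y t).
  rewrite (distrC (q y (ratr r)) (q y t)); move: rd; rewrite /d; move: (k.+1%:R^-1 : R) => c; lra.
apply: cauchy_cvg; apply: cauchy_exP => e e0.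
have [k _ /(_ k (leqnn k)) ke] := near_infty_natSinv_lt (PosNum e0).
have [m Hm] := H k.
pose t0 : rat := (m.+2%:R)^-1.
exists (q y (ratr t0)).
exists (m.+1%:R^-1) => /=; first by rewrite invr_gt0.
move=> t /= tm tn0.
apply: le_lt_trans ke; apply: Hm => //.
- by rewrite /t0 invr_eq0 pnatr_eq0.
- by rewrite /t0 fmorphV/= ratr_nat ger0_norm ?invr_ge0// ltf_pV2 ?posrE// ltr_nat.
- by move: tm; rewrite sub0r normrN.
Unshelve. all: by end_near. Qed.

Let mG : measurable (G : set BX).
Proof.
apply: bigcapT_measurable => k; apply: bigcupT_measurable => m.
apply: bigcapT_measurable => i; apply: bigcapT_measurable => j.
rewrite /close.
have [s0|] := boolP ((rt i != 0) && (rt j != 0) && (`|ratr (rt i) : R| < m.+1%:R^-1) && (`|ratr (rt j) : R| < m.+1%:R^-1)); last first.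
  move=> H; rewrite (_ : mkset _ = setT); first exact: measurableT.
  by apply/seteqP; split => // y _ /= *; exfalso; move: H; apply/negP; rewrite negbK; do !(apply/andP; split).
move: s0 => /andP[/andP[/andP[s0 t0] sm] tm].
rewrite (_ : mkset _ = (fun y : BX => `|q y (ratr (rt i)) - q y (ratr (rt j))|) @^-1` `]-oo, k.+1%:R^-1]%classic); last first.
  by apply/seteqP; split => y /=; rewrite in_itv/= => H //; exact: H.
have cc : continuous (fun y : V => `|q y (ratr (rt i)) - q y (ratr (rt j))|).
  by move=> y; exact: (cvg_norm (cvgB (@cq1 _ y) (@cq1 _ y))).
by have := borel_continuous cc measurableT (measurable_itv `]-oo, k.+1%:R^-1]); rewrite setTI.
Qed.

(* The average over [t] in [0, 1] of the measure of the translate of [~` G] by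
   [- t h] is the measure of [~` G]; by Tonelli it is also the integral over
   [y] of the measure of the bad [t] on the line [y + t h], which vanishes. *)
Lemma lipschitz_ae_derivable_dir : {ae mu, forall y, derivable phi y h}.
Proof.
have mGC : measurable (~` G : set BX) by exact: measurableC.
exists (~` G); split; [exact: borel_leb_measurable| |by apply: subsetC => y /derivableE].
pose f (z : T * X) : \bar R := (\1_(`[0, 1]%classic : set R) z.1 * \1_(~` G) ((z.2 : V) + z.1 *: h))%:E.
have mf : measurable_fun [set: T * X] f.
  apply/measurable_EFinP; apply: measurable_funM.
    by apply: measurableT_comp => //.
  have := measurableT_comp (f := (\1_(~` G) : BX -> R)) _ (measurable_line h).
  by apply; exact: measurable_indic.
have f0 z : (0 <= f z)%E by rewrite lee_fin mulr_ge0.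
have : (\int[lam]_x \int[mu]_y f (x, y) = \int[mu]_y \int[lam]_x f (x, y))%E.
  exact: (@fubini_tonelli _ _ _ _ R lam lebesgue_sf f mf f0).
rewrite (_ : (\int[lam]_x _)%E = mu (~` G)); last first.
  transitivity (\int[lam]_x ((\1_(`[0, 1]%classic : set R) x)%:E * mu (~` G)))%E.
    apply: eq_integral => t _.
    transitivity (\int[mu]_y ((\1_(`[0, 1]%classic : set R) t)%:E * (\1_((fun y : V => y + t *: h) @^-1` (~` G)) y)%:E))%E.
      by apply: eq_integral => y _; rewrite /f EFinM.
    have mGs : measurable ((fun y : V => y + t *: h) @^-1` (~` G) : set X).
      apply: borel_leb_measurable.
      by have := borel_shift (t *: h) measurableT mGC; rewrite setTI.
    by rewrite integral_const_indic ?lebesgue_shift.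
  rewrite ge0_integralZr//; last by apply/measurable_EFinP; exact: measurable_indic.
  have l1 : lam `[0, 1]%classic = 1%E.
    by rewrite lebesgue_measure_itv/= lte_fin ltr01 oppr0 adde0.
  by rewrite integral_indic// setIT [X in (X * _)%E]l1 mul1e.
move=> ->; apply: integral0_eq => y _.
apply/eqP; rewrite eq_le integral_ge0 ?andbT//.
have [N [mN N0 Nd]] : {ae lam, forall t : R, derivable (fun t : R => phi ((y : V) + t *: h)) t 1}.
  apply: (@lipschitz_ae_derivable _ (K * `|h|)) => a b.
  apply: le_trans (phiK _ _) _.
  by rewrite opprD addrACA subrr add0r -scalerBl normrZ mulrA mulrAC.
apply: (@le_trans _ _ (\int[lam]_t (\1_N t)%:E)%E); last first.
  by rewrite integral_indic// setIT; move: N0 => /= ->.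
apply: ge0_le_integral => //.
- apply: measurableT_comp => //; exact: measurable_pair2.
- by apply/measurable_EFinP; exact: measurable_indic.
move=> t _; rewrite /f lee_fin /= [X in _ * X]indicE.
have [tN|tN] := boolP (t \in N).
  have -> : \1_N t = 1 :> R by rewrite indicE tN.
  by rewrite mulr_ile1// ?indicE; case: (_ \in _).
rewrite memNset ?mulr0 ?indicE//.
apply; apply/derivableE.
have : derivable (fun t : R => phi ((y : V) + t *: h)) t 1.
  have [//|nd] := pselect (derivable (fun t : R => phi ((y : V) + t *: h)) t 1).
  by move: tN; rewrite notin_setE => -[]; exact: Nd.
rewrite /derivable; set F1 := (X in cvg (X @ _) -> _); set F2 := (X in _ -> cvg (X @ _)).
suff -> : F1 = F2 by [].
apply/funext => s; rewrite /F1 /F2 /= [s *: (1 : R)]mulr1 scalerDl.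
by rewrite addrCA.
Qed.

End direction.

End lipschitz_derivable.

(** * Integrals against the derivative of a Lipschitz kernel *)

Section derivative_kernel.
Context {R : realType} {n : nat}.
Local Notation V := 'rV[R]_n.
Local Notation X := (leb_rV R n).
Local Notation mu := (lebesgue R n).
Local Notation intg f := (mu.-integrable [set: X] (EFin \o (f : X -> R))).

(** This is completeness of the measure. It makes measurable the derivatives whose existence is
    known only almost everywhere. *)
Lemma leb_ae_measurable (f g : V -> R) : measurable_fun [set: X] (f : X -> R) ->
  {ae mu, forall y, f y = g y} -> measurable_fun [set: X] (g : X -> R).
Proof.
move=> mf fg; apply/measurable_EFinP.
apply: (@ae_measurable_fun _ _ _ mu lebesgue_complete setT (EFin \o f)).
  by apply: ae_imply fg => y /= -> _.
exact/measurable_EFinP.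
Qed.

Lemma ball_bounded (x : V) e : bounded_set (ball x e).
Proof.
exists (`|x| + `|e|); split; first exact: num_real.
move=> M xM y; rewrite -ball_normE /= => xy.
apply: le_trans (ltW xM); rewrite -(subrK x y) addrC.
apply: le_trans (ler_normD _ _) _; rewrite lerD2l distrC ltW//.
exact: lt_le_trans xy (ler_norm _).
Qed.

Section kernel.
Variables (psi v : V -> R) (K M e : R) (h x : V).
Hypothesis K0 : 0 <= K.
Hypothesis e0 : 0 < e.
Hypothesis h1 : `|h| <= 1.
Hypothesis psiK : forall a b, `|psi a - psi b| <= K * `|a - b|.
Hypothesis psi0 : forall y, ~ ball x e y -> psi y = 0.
Hypothesis psiM : forall y, `|psi y| <= M.
Hypothesis iv : intg v.

Let t (m : nat) : R := e * m.+1%:R^-1.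
Let D (m : nat) (y : V) : R := (t m)^-1 * (psi (t m *: h + y) - psi y).

Let t_gt0 m : 0 < t m. Proof. by rewrite mulr_gt0. Qed.

Let t_le m : t m <= e.
Proof. by rewrite /t ler_piMr ?(ltW e0)// invf_le1// ler1n. Qed.

Let th m : `|t m *: h| <= e.
Proof.
rewrite normrZ gtr0_norm//; apply: le_trans (t_le m).
by rewrite ler_piMr// ltW.
Qed.

Let DK m y : `|D m y| <= K.
Proof.
rewrite /D normrM gtr0_norm ?invr_gt0// mulrC ler_pdivrMr//.
apply: le_trans (psiK _ _) _; rewrite addrK ler_wpM2l// normrZ gtr0_norm//.
by rewrite ler_piMr// ltW.
Qed.

(** The steps [t m] are at most [e], so a difference quotient can be nonzero only on the doubled
    ball: the origin of the radius [e + e] in later estimates. *)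
Let D0 m y : ~ ball x (e + e) y -> D m y = 0.
Proof.
rewrite -ball_normE /= => xy; rewrite /D !psi0 ?subrr ?mulr0//.
  rewrite -ball_normE /= => H; apply: xy; apply: lt_le_trans H _.
  by rewrite lerDl ltW.
rewrite -ball_normE /= => H; apply: xy.
rewrite (_ : x - y = x - (t m *: h + y) + t m *: h); last first.
  by rewrite opprD addrA addrAC subrK.
apply: le_lt_trans (ler_normD _ _) _.
by rewrite ltr_leD.
Qed.

Let cpsi : continuous psi := lipschitz_bound_continuous psiK.

Let cD m : continuous (D m).
Proof.
apply: (@lipschitz_bound_continuous _ _ _ _ (`|(t m)^-1| * (K + K))) => a b.
rewrite /D -mulrBr normrM -mulrA ler_wpM2l// mulrDl.
have -> : psi (t m *: h + a) - psi a - (psi (t m *: h + b) - psi b) =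
  (psi (t m *: h + a) - psi (t m *: h + b)) - (psi a - psi b) by ring.
apply: le_trans (ler_normB _ _) _; apply: lerD (psiK _ _).
apply: le_trans (psiK _ _) _.
by rewrite opprD addrACA subrr add0r.
Qed.

Let mD m : measurable_fun [set: X] (D m : X -> R).
Proof. exact: leb_continuous. Qed.

Let iD m : intg (D m).
Proof.
apply: (@intg_supported _ _ _ mu (D m) K (ball x (e + e)) (leb_ball _ _) _ (mD m) (DK m)).
- by apply: lebesgue_bounded; [exact: ball_bounded|exact: leb_ball].
- exact: D0.
Qed.

Let ID m : \int[mu]_y D m y = 0.
Proof.
have ipsi : intg psi.
  apply: (@intg_supported _ _ _ mu psi M (ball x e) (leb_ball _ _) _ _ psiM psi0).
  - by apply: lebesgue_bounded; [exact: ball_bounded|exact: leb_ball].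
  - exact: leb_continuous.
have Es : \int[mu]_y psi (t m *: h + (y : V)) = \int[mu]_y psi y.
  rewrite /Rintegral -(@integral_shift R n (t m *: h) psi); last exact: borel_continuous.
  by congr fine; apply: eq_integral => y _; rewrite addrC.
have ipsih : intg (fun y => psi (t m *: h + y)).
  rewrite (_ : (fun _ => _) = (fun y => t m * D m y + psi y)); last first.
    by apply/funext => y; rewrite /D mulVKf ?subrK// gt_eqF.
  by apply: intgD => //; exact: intgZ.
by rewrite /D RintegralZl// ?RintegralB// ?Es ?subrr ?mulr0//; exact: intgB.
Qed.

(* ['D_h psi] has integral 0, as the limit of difference quotients, whose
   integrals vanish by translation invariance; so [v] may be replaced by
   [v - v x]. *)
Lemma kernel_bound :
  intg (fun y => v y * 'D_h psi y) /\
  `|\int[mu]_y (v y * 'D_h psi y)| <= K * \int[mu]_(y in ball x (e + e)) `|v y - v x|.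
Proof.
have mv : measurable_fun [set: X] (v : X -> R).
  by apply/measurable_EFinP; exact: measurable_int iv.
have aeD : {ae mu, forall y, D ^~ y @ \oo --> 'D_h psi y}.
  have := lipschitz_ae_derivable_dir h psiK.
  apply: ae_imply => y /= dy.
  have /cvgr_dnbhsP := dy.
  apply; split; first by move=> m; rewrite gt_eqF.
  rewrite -[X in _ --> X](mulr0 e); apply: cvgMr; exact: cvg_harmonic.
have mDp : measurable_fun [set: X] (('D_h psi) : X -> R).
  (* The upper limit of the quotients [D m] is measurable and agrees almost everywhere with the
     derivative. *)
  apply: (@leb_ae_measurable (fun y => limn_sup (D ^~ y))).
    apply: measurable_fun_limn_sup => //.
    - move=> y _; exists K => _ [m _ <-]; exact: le_trans (ler_norm _) (DK m y).
    - move=> y _; exists (- K) => _ [m _ <-]; by have := DK m y; rewrite ler_norml => /andP[].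
  apply: ae_imply aeD => y /= /cvg_sups.
  by move/cvg_lim => <-.
have [] := @dominated_convergence _ _ _ mu _ measurableT
   (fun m y => (v y * D m y)%:E) (fun y => (v y * 'D_h psi y)%:E) (fun y => (K * `|v y|)%:E).
- by move=> m; apply/measurable_EFinP; exact: measurable_funM.
- by apply/measurable_EFinP; exact: measurable_funM.
- apply: ae_imply aeD => y /= yD _; apply: cvg_EFin; first exact: nearW.
  by apply: cvgMr.
- exact: (integrableZl measurableT K (intg_norm iv)).
- apply/aeW => y m _; rewrite /= lee_fin normrM mulrC ler_wpM2r//.
move=> iDp _ cvD; split => //.
have {}cvD : (\int[mu]_y (v y * D m y)) @[m --> \oo] --> \int[mu]_y (v y * 'D_h psi y).
  by apply: fine_cvg; rewrite fineK //; exact: integrable_fin_num.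
set C := K * _.
(* The bound is proved for each [D m]; being a closed condition on the integral, it passes to the
   limit. *)
have cA : closed [set z : R | `|z| <= C].
  apply: (@closed_comp _ _ (fun z : R => `|z|) [set z | z <= C]); last exact: closed_le.
  by move=> z _; exact: norm_continuous.
apply: (closed_cvg _ cA _ _ cvD); apply: nearW => m /=.
have ivD : intg (fun y => v y * D m y) by exact: (intgM_bounded iv (mD m) (DK m)).
have ivxD : intg (fun y => v x * D m y) by exact: intgZ.
have -> : \int[mu]_y (v y * D m y) = \int[mu]_y (v y * D m y - v x * D m y).
  by rewrite RintegralB// RintegralZl// ID mulr0 subr0.
apply: le_trans (le_normr_Rintegral _ _) _ => //; first exact: intgB.
have mB : measurable (ball x (e + e) : set X) by exact: leb_ball.
have ivv : mu.-integrable (ball x (e + e) : set X) (EFin \o (fun y : X => `|v y - v x|)).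
  apply: integrable_norm.
  apply: (@integrableB _ _ _ mu _ mB (EFin \o v) (EFin \o cst (v x))).
    exact: integrableS iv.
  by apply: measurable_bounded_integrable => //; [exact/lebesgue_bounded/mB/ball_bounded|exact: bounded_cst].
rewrite /C -RintegralZl//.
rewrite [leRHS]Rintegral_mkcond.
apply: le_Rintegral => //.
- exact/intg_norm/intgB.
- rewrite -restrict_EFin; apply/(integrable_mkcond _ mB).
  exact: (integrableZl mB K ivv).
- move=> y _; rewrite patchE -mulrBl normrM; case: ifPn => yB.
    by rewrite mulrC ler_wpM2r.
  by rewrite D0 ?normr0 ?mulr0//; move: yB; rewrite notin_setE.
Qed.

End kernel.
End derivative_kernel.

(** * Continuity of translations in L^1 *)

Section density.
Context {R : realType} {n : nat}.
Local Notation T := (measurableTypeR R).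
Local Notation V := 'rV[R]_n.
Local Notation X := (leb_rV R n).
Local Notation BX := (@borel_rV R n).
Local Notation mu := (lebesgue R n).
Local Notation intg f := (mu.-integrable [set: X] (EFin \o (f : X -> R))).
Variable Q : set V.
Hypothesis mQ : measurable (Q : set X).
Hypothesis Qoo : (mu Q < +oo)%E.

Local Notation meas f := (measurable_fun [set: X] (f : X -> R)).
Let dist (f g : V -> R) : \bar R := L1dist mu Q (f : X -> R) g.
Let lip (f : V -> R) := exists L, forall a b, `|f a - f b| <= L * `|a - b|.
Let appr (f : V -> R) := forall d : R, 0 < d -> exists2 phi, lip phi & (dist f phi <= d%:E)%E.

Let lip_meas f : lip f -> meas f.
Proof. by move=> [L fL]; apply: leb_continuous; exact: lipschitz_bound_continuous fL. Qed.

Let appr_lim f : meas f ->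
  (forall d : R, 0 < d -> exists g, [/\ meas g, appr g & (dist f g <= d%:E)%E]) -> appr f.
Proof.
move=> mf H d d0; have d20 : 0 < d / 2 by rewrite divr_gt0.
have [g [mg ag fg]] := H _ d20; have [phi lphi gphi] := ag _ d20.
exists phi => //.
have mphi := lip_meas lphi.
have := @L1dist_le _ _ _ mu Q f phi f g 1 1 g phi mQ ler01 ler01 mf mphi mf mg mg mphi.
rewrite !mul1e => /(_ _)/le_trans; apply.
  by move=> y _; rewrite !mul1r; exact: ler_distD.
by rewrite [in leRHS](splitr d) EFinD; exact: leeD.
Qed.

(** A Lipschitz [F] carries approximations of its arguments to one of the result. The instances are
    [a - b] for complements, [Num.max a b] for unions and [r * a + b] for simple functions. *)
Let appr_comb f g h (k k' : R) (F : R -> R -> R) : 0 <= k -> 0 <= k' ->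
  meas f -> meas g -> meas h ->
  (forall y, Q y -> h y = F (f y) (g y)) ->
  (forall a b a' b', `|F a b - F a' b'| <= k * `|a - a'| + k' * `|b - b'|) ->
  appr f -> appr g -> appr h.
Proof.
move=> k0 k0' mf mg mh hF FL af ag d d0.
have d20 : 0 < d / (k + k' + 1) by rewrite divr_gt0// ltr_wpDl ?addr_ge0.
have [phi lphi fphi] := af _ d20; have [psi lpsi gpsi] := ag _ d20.
have lF : lip (fun y => F (phi y) (psi y)).
  have [L HL] := lphi; have [L' HL'] := lpsi.
  exists (k * L + k' * L') => a b; apply: le_trans (FL _ _ _ _) _.
  by rewrite mulrDl -!mulrA; apply: lerD; rewrite ler_wpM2l.
exists (fun y => F (phi y) (psi y)) => //.
apply: (le_trans (@L1dist_le _ _ _ mu Q h _ f phi k k' g psi mQ k0 k0' mh (lip_meas lF) mf (lip_meas lphi) mg (lip_meas lpsi) _)).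
  by move=> y Qy; rewrite hF.
apply: (@le_trans _ _ ((k * (d / (k + k' + 1)) + k' * (d / (k + k' + 1)))%:E)).
  by rewrite EFinD !EFinM; apply: leeD; rewrite -EFinM EFinM lee_wpmul2l.
rewrite lee_fin -mulrDl mulrCA ler_piMr ?(ltW d0)//.
by rewrite ler_pdivrMr ?mul1r ?lerDl// ltr_wpDl ?addr_ge0.
Qed.

Let appr_lip f : lip f -> appr f.
Proof.
move=> lf d d0; exists f => //; rewrite /dist /L1dist.
under eq_integral do rewrite subrr normr0.
by rewrite integral0 lee_fin ltW.
Qed.

Let appr_cst (c : R) : appr (fun=> c).
Proof. by apply: appr_lip; exists 0 => a b; rewrite subrr normr0 mul0r. Qed.

Let mind (A : set V) : measurable (A : set X) -> meas (\1_A : V -> R).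
Proof. by move=> mA; exact: measurable_indic. Qed.

(** These sets are stable under complements and countable unions and include the half-spaces, hence
    all Borel sets; the other Lebesgue measurable sets are then reached by outer approximation. *)
Let S (A : set V) := measurable (A : set X) /\ appr (\1_A).

Let S_setC A : S A -> S (~` A).
Proof.
move=> [mA aA]; split; first exact: measurableC.
apply: (@appr_comb _ _ _ 1 1 (fun a b => a - b) ler01 ler01 _ _ _ _ _ (appr_cst 1) aA).
- exact: measurable_cst.
- exact: mind.
- apply: mind; exact: measurableC.
- by move=> y _; rewrite !indicE in_setC; case: (_ \in _); rewrite ?subrr ?subr0.
- move=> a b a' b'; rewrite !mul1r.
  rewrite (_ : a - b - (a' - b') = (a - a') - (b - b')); last ring.
  exact: ler_normB.
Qed.

Let S_setU A B : S A -> S B -> S (A `|` B).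
Proof.
move=> [mA aA] [mB aB]; split; first exact: measurableU.
apply: (@appr_comb _ _ _ 1 1 (fun a b => Num.max a b) ler01 ler01 _ _ _ _ _ aA aB).
- exact: mind.
- exact: mind.
- apply: mind; exact: measurableU.
- move=> y _; rewrite !indicE in_setU; case: (_ \in A); case: (_ \in B) => //=.
  + by rewrite maxxx.
  + by rewrite max_l.
  + by rewrite max_r.
  + by rewrite maxxx.
- move=> a b a' b'; rewrite !mul1r.
  have [ha1 ha2] : a - a' <= `|a - a'| /\ a' - a <= `|a - a'| by rewrite (distrC a) ler_norm distrC ler_norm.
  have [hb1 hb2] : b - b' <= `|b - b'| /\ b' - b <= `|b - b'| by rewrite (distrC b) ler_norm distrC ler_norm.
  rewrite ler_norml !maxEle; move: (normr_ge0 (a - a')) (normr_ge0 (b - b')).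
  by case: ifPn; case: ifPn; rewrite -?ltNge => h1 h2 h3 h4; lra.
Qed.

(** Inside [Q], of finite measure, what the partial unions [G m] leave out decreases to the empty
    set, so its measure tends to 0. *)
Let S_bigcup (F : (set V)^nat) : (forall i, S (F i)) -> S (\bigcup_i F i).
Proof.
move=> SF; pose G m := \big[setU/set0]_(i < m) F i.
have SG m : S (G m).
  rewrite /G; elim: m => [|m IH]; last by rewrite big_ord_recr; exact: S_setU.
  rewrite big_ord0; split => //; rewrite indic0; exact: appr_cst.
have mU : measurable (\bigcup_i F i : set X) by apply: bigcupT_measurable => i; have [] := SF i.
split => //; apply: appr_lim; first exact: mind.
move=> d d0.
have GF m : G m `<=` \bigcup_i F i by exact: bigsetU_bigcup.
have : mu \o (fun m => (\bigcup_i F i `\` G m) `&` Q) @ \oo --> mu (\bigcap_m ((\bigcup_i F i `\` G m) `&` Q)).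
  apply: nonincreasing_cvg_mu.
  - rewrite (le_lt_trans _ Qoo)//; apply: le_measure; rewrite ?inE//.
    by apply: measurableI => //; apply: measurableD => //; have [] := SG 0%N.
  - move=> m; apply: measurableI => //; apply: measurableD => //; by have [] := SG m.
  - apply: bigcapT_measurable => m; apply: measurableI => //; apply: measurableD => //; by have [] := SG m.
  - move=> a b ab; apply/subsetPset; apply: setSI; apply: setDS.
    exact: subset_bigsetU.
rewrite (_ : \bigcap_m _ = set0) ?measure0; last first.
  apply/seteqP; split => // y H.
  have [[[i _ Fi] _] _] := H 0%N Logic.I.
  have [[_ +] _] := H i.+1 Logic.I; apply.
  by rewrite /G big_ord_recr /=; right.
move=> /fine_cvgP[fG] /cvgrPdist_le/(_ _ d0) cG.
near \oo => m.
exists (\1_(G m)); split.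
- by apply: mind; have [] := SG m.
- by have [] := SG m.
rewrite [dist _ _]L1dist_indic//; last by have [] := SG m.
have fm : mu ((\bigcup_i F i `\` G m) `&` Q) \is a fin_num by near: m.
rewrite -(fineK fm) lee_fin.
have : `|0 - fine (mu ((\bigcup_i F i `\` G m) `&` Q))| <= d by near: m.
by rewrite sub0r normrN; apply: le_trans; exact: ler_norm.
Unshelve. all: by end_near. Qed.

Let S_half (i : 'I_n) (a : R) : S [set y | y 0 i \in `]a, +oo[].
Proof.
have mA : measurable ([set y : V | y 0 i \in `]a, +oo[] : set X).
  rewrite -[X in measurable X]setTI.
  exact: (@leb_coord R n i measurableT _ (measurable_itv `]a, +oo[)).
split => //; apply: appr_lim; first exact: mind.
(* Ramps of slope [m] starting at [a]: they stay between 0 and 1 and converge pointwise to the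
   indicator, so dominated convergence applies on [Q]. *)
pose phi (m : nat) (y : V) : R := Num.min 1 (Num.max 0 (m%:R * (y 0 i - a))).
have lphi m : lip (phi m).
  exists m%:R => b c; rewrite /phi.
  apply: (@le_trans _ _ (m%:R * `|b 0 i - c 0 i|)); last first.
    by rewrite ler_wpM2l//; have := coord_le_norm (b - c) i; rewrite !mxE.
  have -> : m%:R * `|b 0 i - c 0 i| = `|m%:R * b 0 i - m%:R * c 0 i|.
    by rewrite -mulrBr normrM ger0_norm.
  rewrite !mulrBr; move: (m%:R * b 0 i) (m%:R * c 0 i) (m%:R * a) => u v w.
  have H (x y : R) : [/\ x - y <= `|x - y|, y - x <= `|x - y| & 0 <= `|x - y|].
    by rewrite {2}distrC !ler_norm normr_ge0.
  have Hmin (x y : R) : `|Num.min 1 x - Num.min 1 y| <= `|x - y|.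
    have [? ? ?] := H x y; rewrite ler_norml !minEle.
    by case: ifPn; case: ifPn; rewrite -?ltNge => ? ?; lra.
  have Hmax (x y : R) : `|Num.max 0 x - Num.max 0 y| <= `|x - y|.
    have [? ? ?] := H x y; rewrite ler_norml !maxEle.
    by case: ifPn; case: ifPn; rewrite -?ltNge => ? ?; lra.
  rewrite (le_trans (Hmin _ _))// (le_trans (Hmax _ _))//.
  by rewrite opprB addrA subrK.
pose A : set V := [set y : V | y 0 i \in `]a, +oo[].
pose f_ m (y : V) : \bar R := `|\1_A y - phi m y|%:E.
have phi01 m y : 0 <= phi m y <= 1.
  by rewrite /phi le_min ler01 ge_min lexx le_max lexx.
have f_cvg y : f_ ^~ y @ \oo --> 0%E.
  apply: cvg_near_cst.
  rewrite /f_ indicE; have [|] := boolP (y \in A); rewrite ?inE ?notin_setE /A/= in_itv/= andbT => ya.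
    have [N yN] : exists N, (y 0 i - a)^-1 < N.+1%:R.
      exists (Num.trunc (y 0 i - a)^-1).
      have y0 : 0 <= (y 0 i - a)^-1 by rewrite invr_ge0 subr_ge0 ltW.
      by have /andP[_] := truncn_itv y0.
    exists N.+1 => // m /= Nm.
    have : 1 <= m%:R * (y 0 i - a).
      rewrite -ler_pdivrMr ?subr_gt0// mul1r; apply: (le_trans (ltW yN)).
      by rewrite ler_nat.
    by move=> H; rewrite /phi max_r ?(le_trans _ H)// min_l// subrr normr0.
  move/negP : ya; rewrite -leNgt => ya.
  apply: nearW => m; rewrite /phi max_l ?min_r ?subrr ?normr0//.
  by rewrite mulr_ge0_le0// subr_le0.
have mf_ m : measurable_fun (Q : set X) (f_ m).
  by apply: meas_absB; [exact: mind|exact: lip_meas].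
have [] := @dominated_convergence _ _ _ mu _ mQ f_ (cst 0%E) (cst 1%E) mf_.
- exact: measurable_cst.
- by apply: aeW => y _; exact: f_cvg.
- apply: (@measurable_bounded_integrable _ _ _ mu (cst 1) _ mQ) => //; exact: bounded_cst.
- apply: aeW => y m _; rewrite /f_ /= lee_fin normr_id.
  have := phi01 m y; rewrite indicE; case: (_ \in _) => /=; case: ler0P; lra.
move=> _ _; rewrite integral0 => /fine_cvgP[fG] /cvgrPdist_le cG d d0.
have {}cG := cG _ d0.
near \oo => m.
exists (phi m); split; [exact: lip_meas|exact: appr_lip|].
have fm : dist \1_A (phi m) \is a fin_num by near: m.
rewrite -[leLHS](fineK fm) lee_fin.
have : `|0 - fine (dist \1_A (phi m))| <= d by near: m.
by rewrite sub0r normrN; apply: le_trans; exact: ler_norm.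
Unshelve. all: by end_near. Qed.

Let S_set0 : S set0.
Proof. by split => //; rewrite indic0; exact: appr_cst. Qed.

Let S_coord (i : 'I_n) (C : set T) : measurable C -> S [set y | C (y 0 i)].
Proof.
move=> mC; have {mC} : (@RGenOInfty.G R).-sigma.-measurable C by rewrite -RGenOInfty.measurableE.
move: C; apply: (@smallest_sub _ (sigma_algebra setT) (@RGenOInfty.G R) (fun C => S [set y | C (y 0 i)])); last first.
  by move=> _ [a ->]; exact: S_half.
split; first exact: S_set0.
- by move=> A SA; rewrite setTD; exact: S_setC.
- move=> F SF; rewrite (_ : mkset _ = \bigcup_k [set y | F k (y 0 i)]); last by [].
  exact: S_bigcup.
Qed.

Let S_borel (A : set V) : measurable (A : set BX) -> S A.
Proof.
move=> [B mB <-]; rewrite setTI.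
move: B mB; apply: (@smallest_sub _ (sigma_algebra setT) _ (fun B => S (@tuple_of_rV R n @^-1` B))) => [|B].
  split; first exact: S_set0.
  - by move=> B SB; rewrite setTD; exact: S_setC.
  - by move=> F SF; apply: (S_bigcup SF).
rewrite -bigcup_seq /= => -[i _ [C mC <-{B}]]; rewrite setTI.
have E : @tuple_of_rV R n @^-1` ((@tnth n T)^~ i @^-1` C) = [set y | C (y 0 i)].
  by apply/seteqP; split => y /=; rewrite tnth_mktuple.
by rewrite /= E; exact: S_coord.
Qed.

(** By definition of the outer measure, [A]&[Q] lies in a countable union of Borel sets whose
    measure exceeds its own by less than [d]. *)
Let S_leb (A : set V) : measurable (A : set X) -> S A.
Proof.
move=> mA; split => //; apply: appr_lim; first exact: mind.
move=> d d0.
have mAQ : measurable (A `&` Q : set X) by exact: measurableI.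
have AQfin : mu (A `&` Q) \is a fin_num.
  rewrite ge0_fin_numE//; apply: le_lt_trans Qoo; apply: le_measure; rewrite ?inE//.
have : (mu (A `&` Q) < mu (A `&` Q) + d%:E)%E by rewrite lteDl// lte_fin.
move=> /ereal_inf_lt[_ [F [mF AF] <-] Fe].
have mU : measurable (\bigcup_k F k : set BX) by exact: bigcupT_measurable.
have mUX := borel_leb_measurable mU.
have UF : (mu (\bigcup_k F k) <= \sum_(k <oo) @borel_lebesgue R n (F k))%E.
  apply: ereal_inf_lbound; exists F => //; split => //.
exists (\1_(\bigcup_k F k)); split; [exact: mind|by have [] := S_borel mU|].
rewrite (_ : dist _ _ = dist \1_(\bigcup_k F k) \1_(A `&` Q)); last first.
  rewrite [dist _ _]L1distC; apply: eq_integral => y /set_mem Qy; congr (`|_ - _|%:E).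
  by rewrite !indicE in_setI (mem_set Qy) andbT.
rewrite [dist _ _]L1dist_indic//.
apply: (@le_trans _ _ (mu (\bigcup_k F k `\` (A `&` Q)))).
  by apply: le_measure; rewrite ?inE//; [apply: measurableI => //|]; exact: measurableD.
have H : (mu (\bigcup_k F k) = mu (\bigcup_k F k `\` (A `&` Q)) + mu (A `&` Q))%E.
  by rewrite [LHS](measureDI mu mUX mAQ) (setIidr AF).
have := le_lt_trans UF Fe; rewrite H addeC lteD2lE//.
exact: ltW.
Qed.

Import HBSimple.

(** Simple functions are dense, and each is a finite linear combination of indicators of sets in
    [S]. *)
Lemma lipschitz_dense_L1 (v : V -> R) : intg v -> forall d : R, 0 < d ->
  exists2 phi : V -> R, (exists L, forall a b, `|phi a - phi b| <= L * `|a - b|) &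
    (\int[mu]_(y in Q) `|v y - phi y|%:E <= d%:E)%E.
Proof.
move=> iv.
have mv : meas v by apply/measurable_EFinP; exact: measurable_int iv.
suff : appr v by [].
apply: appr_lim => // d d0.
have [g [ig _ /fine_cvgP[fG] /cvgrPdist_le/(_ _ d0) cG]] :=
  approximation_sfun_integrable mQ (integrableS measurableT mQ (@subsetT _ _) iv).
near \oo => m.
exists (g m); split.
- exact: measurable_funP.
- rewrite (_ : (g m : V -> R) = fun y => \sum_(r <- finmap.enum_fset (fset_set (range (g m)))) r * \1_(g m @^-1` [set r]) y); last first.
    by apply/funext => y; rewrite [LHS]fimfunE fsbig_finite.
  elim: (finmap.enum_fset _) => [|r s IH].
    by under eq_fun do rewrite big_nil; exact: appr_cst.
  have mgr q : measurable (g m @^-1` [set q] : set X) by [].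
  have mF q : meas (\1_(g m @^-1` [set q]) : V -> R) := mind (mgr q).
  apply: (@appr_comb \1_(g m @^-1` [set r]) (fun y => \sum_(q <- s) q * \1_(g m @^-1` [set q]) y) _ `|r| 1 (fun a b => r * a + b) (normr_ge0 r) ler01 (mF r) (meas_lincomb s mF) (meas_lincomb (r :: s) mF) _ _ _ IH).
  + by move=> y _; rewrite big_cons.
  + by move=> a b a' b'; rewrite opprD addrACA -mulrBr mul1r -normrM; exact: ler_normD.
  + by have [] := S_leb (mgr r).
have fm : dist v (g m) \is a fin_num by near: m.
rewrite -[leLHS](fineK fm) lee_fin.
have : `|0 - fine (dist v (g m))| <= d by near: m.
by rewrite sub0r normrN; apply: le_trans; exact: ler_norm.
Unshelve. all: by end_near. Qed.

End density.

(** * The averaged L^1 modulus of continuity *)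

Section modulus.
Context d (X : measurableType d) (R : realType) (mu : {sigma_finite_measure set X -> \bar R}).
Variables (E : set (X * X)) (K Q : set X) (v phi : X -> R) (c lam : R).
Hypothesis mE : measurable E.
Hypothesis mK : measurable K.
Hypothesis mQ : measurable Q.
Hypothesis mv : measurable_fun setT v.
Hypothesis mphi : measurable_fun setT phi.
Hypothesis c0 : 0 <= c.
Hypothesis lam0 : 0 <= lam.
Hypothesis Ex : forall x, (mu [set y | E (x, y)] <= c%:E)%E.
Hypothesis Ey : forall y, (mu [set x | E (x, y)] <= c%:E)%E.
Hypothesis KQ : K `<=` Q.
Hypothesis EKQ : forall x y, K x -> E (x, y) -> Q y.
Hypothesis Ephi : forall x y, E (x, y) -> `|phi x - phi y| <= lam.

Let mEx x : measurable [set y | E (x, y)].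
Proof.
by have := measurable_xsection x mE; rewrite /xsection; congr measurable; apply/seteqP; split => y /=; rewrite inE.
Qed.

Let mEy y : measurable [set x | E (x, y)].
Proof.
by have := measurable_ysection y mE; rewrite /ysection; congr measurable; apply/seteqP; split => x /=; rewrite inE.
Qed.

Let indEx x y : \1_[set y | E (x, y)] y = \1_E (x, y) :> R.
Proof. by rewrite !indicE /in_mem/= /in_set /=; congr ((_ : bool)%:R); apply/idP/idP => /asboolP H; apply/asboolP. Qed.

Let indEy x y : \1_[set x | E (x, y)] x = \1_E (x, y) :> R.
Proof. by rewrite !indicE /in_mem/= /in_set /=; congr ((_ : bool)%:R); apply/idP/idP => /asboolP H; apply/asboolP. Qed.

Let a (y : X) : R := `|v y - phi y|.
Let ma : measurable_fun setT a.
Proof. by apply: measurableT_comp => //; exact: measurable_funB. Qed.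

Let aQ (y : X) : R := (a \_ Q) y.
Let maQ : measurable_fun setT aQ.
Proof. by apply/(measurable_restrictT _ mQ); exact: measurable_funTS. Qed.
Let aQ0 y : 0 <= aQ y.
Proof. by rewrite /aQ patchE; case: ifP => // _; exact: normr_ge0. Qed.

Let m1E : measurable_fun [set: X * X] (\1_E : X * X -> R).
Proof. exact: measurable_indic. Qed.

(** For fixed [y], the points [x] that [E] pairs with it have measure at most [c]; exchanging the
    integrals brings this out. *)
Let tonelli_aQ : (\int[mu]_x \int[mu]_y (\1_E (x, y) * aQ y)%:E <= c%:E * L1dist mu Q v phi)%E.
Proof.
have mf : measurable_fun [set: X * X] (fun z : X * X => (\1_E z * aQ z.2)%:E).
  by apply/measurable_EFinP; apply: measurable_funM => //; exact: measurableT_comp.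
rewrite (fubini_tonelli (fun z : X * X => (\1_E z * aQ z.2)%:E) mf)/=; last first.
  by move=> z; rewrite lee_fin mulr_ge0.
have -> : L1dist mu Q v phi = (\int[mu]_y (aQ y)%:E)%E.
  rewrite /L1dist integral_mkcond; apply: eq_integral => y _.
  by rewrite /aQ /a !patchE; case: ifP.
rewrite -ge0_integralZl//; last 2 first.
- exact/measurable_EFinP.
- by move=> y _; rewrite lee_fin.
apply: ge0_le_integral => //.
- by move=> y _; apply: integral_ge0 => x _; rewrite lee_fin mulr_ge0.
- have f0 z : (0 <= (\1_E z * aQ z.2)%:E)%E by rewrite lee_fin mulr_ge0.
  exact: (measurable_fun_fubini_tonelli_G (m1 := mu) _ mf f0).
- by apply/measurable_EFinP; exact: measurable_funM.
- move=> y _.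
  rewrite (_ : (\int[mu]_x _)%E = (\int[mu]_x ((aQ y)%:E * (\1_[set x | E (x, y)] x)%:E))%E); last first.
    by apply: eq_integral => x _; rewrite -EFinM mulrC indEy.
  by rewrite integral_const_indic// muleC lee_wpmul2r ?lee_fin ?aQ0 ?Ey.
Qed.

(** [v y - v x] is split at [phi y] and [phi x]: the first gap stays under the integral, the two
    others are at most [lam] and [a x] on a section of measure at most [c]. *)
Let inner x : K x ->
  (\int[mu]_y (\1_E (x, y) * `|v y - v x|)%:E <=
   \int[mu]_y (\1_E (x, y) * aQ y)%:E + (c * a x + lam * c)%:E)%E.
Proof.
move=> Kx.
have m1 : measurable_fun setT (fun y => \1_E (x, y) : R).
  by apply: (measurableT_comp m1E); exact: measurable_pair1.
have m2 : measurable_fun setT (fun y => (\1_E (x, y) * aQ y)%:E).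
  by apply/measurable_EFinP; exact: measurable_funM.
apply: (@le_trans _ _ (\int[mu]_y ((\1_E (x, y) * aQ y)%:E + (a x + lam)%:E * (\1_[set y | E (x, y)] y)%:E))%E).
  apply: ge0_le_integral => //.
  - apply/measurable_EFinP; apply: measurable_funM => //.
    by apply: measurableT_comp => //; exact: measurable_funB.
  - apply: emeasurable_funD => //; apply: emeasurable_funM => //.
    by apply/measurable_EFinP; exact: measurable_indic.
  - move=> y _; rewrite -EFinM -EFinD lee_fin.
    rewrite indEx (mulrC (a x + lam)) -mulrDr indicE.
    have [|] := boolP ((x, y) \in E); last by rewrite !mul0r.
    rewrite inE => Exy; rewrite !mul1r.
    rewrite /aQ patchE mem_set; last exact: EKQ Exy.
    rewrite /a addrA.
    have := Ephi Exy.
    have := ler_distD (phi y) (v y) (v x).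
    have := ler_distD (phi x) (phi y) (v x).
    rewrite (distrC (phi y) (phi x)) (distrC (phi x) (v x)); lra.
have m3 : measurable_fun setT (fun y => (a x + lam)%:E * (\1_[set y | E (x, y)] y)%:E)%E.
  by apply: emeasurable_funM => //; apply/measurable_EFinP; exact: measurable_indic.
have m20 y : setT y -> (0 <= (\1_E (x, y) * aQ y)%:E)%E by rewrite lee_fin mulr_ge0.
have m30 y : setT y -> (0 <= (a x + lam)%:E * (\1_[set y | E (x, y)] y)%:E)%E.
  by rewrite -EFinM lee_fin mulr_ge0// addr_ge0// normr_ge0.
rewrite (ge0_integralD mu measurableT m20 m2 m30 m3).
apply: leeD => //; rewrite integral_const_indic ?addr_ge0 ?normr_ge0//.
rewrite (_ : c * a x + lam * c = (a x + lam) * c); last ring.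
by rewrite EFinM lee_wpmul2l ?lee_fin ?addr_ge0 ?normr_ge0 ?Ex.
Qed.

(** Each of the two gaps between [v] and [phi], at [x] and at [y], costs [c] times the L^1 distance;
    the variation of [phi] across [E] costs [lam * c] per point of [K]. *)
Lemma modulus_bound :
  (\int[mu]_(x in K) \int[mu]_y (\1_E (x, y) * `|v y - v x|)%:E <=
   (2 * c)%:E * L1dist mu Q v phi + (lam * c)%:E * mu K)%E.
Proof.
have mf1 : measurable_fun [set: X * X] (fun z : X * X => (\1_E z * `|v z.2 - v z.1|)%:E).
  apply/measurable_EFinP; apply: measurable_funM => //.
  by apply: measurableT_comp => //; apply: measurable_funB; exact: measurableT_comp.
have mf2 : measurable_fun [set: X * X] (fun z : X * X => (\1_E z * aQ z.2)%:E).
  by apply/measurable_EFinP; apply: measurable_funM => //; exact: measurableT_comp.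
have mF1 : measurable_fun setT (fun x => \int[mu]_y (\1_E (x, y) * `|v y - v x|)%:E)%E.
  have f0 z : (0 <= (\1_E z * `|v z.2 - v z.1|)%:E)%E by rewrite lee_fin mulr_ge0.
  exact: (measurable_fun_fubini_tonelli_F (m2 := mu) _ mf1 f0).
have mF2 : measurable_fun setT (fun x => \int[mu]_y (\1_E (x, y) * aQ y)%:E)%E.
  have f0 z : (0 <= (\1_E z * aQ z.2)%:E)%E by rewrite lee_fin mulr_ge0.
  exact: (measurable_fun_fubini_tonelli_F (m2 := mu) _ mf2 f0).
have mca : measurable_fun setT (fun x => (c * a x + lam * c)%:E).
  by apply/measurable_EFinP; apply: measurable_funD => //; exact: measurable_funM.
have F20 x : (0 <= \int[mu]_y (\1_E (x, y) * aQ y)%:E)%E.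
  by apply: integral_ge0 => y _; rewrite lee_fin mulr_ge0.
have ca0 x : 0 <= c * a x + lam * c by rewrite addr_ge0// mulr_ge0// normr_ge0.
apply: (@le_trans _ _ (\int[mu]_(x in K) (\int[mu]_y (\1_E (x, y) * aQ y)%:E + (c * a x + lam * c)%:E))%E).
  apply: ge0_le_integral => //.
  - by move=> x _; apply: integral_ge0 => y _; rewrite lee_fin mulr_ge0.
  - exact: measurable_funTS.
  - by apply: measurable_funTS; exact: emeasurable_funD.
have caK0 x : K x -> (0 <= (c * a x + lam * c)%:E)%E by rewrite lee_fin.
rewrite (ge0_integralD mu mK (fun x _ => F20 x) (measurable_funTS mF2) caK0 (measurable_funTS mca)).
rewrite (_ : 2 * c = c + c); last ring.
rewrite EFinD ge0_muleDl// ?lee_fin// -[leRHS]addeA; apply: leeD.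
  apply: le_trans tonelli_aQ; apply: ge0_subset_integral => //.
apply: (@le_trans _ _ (\int[mu]_(x in K) (c%:E * (a x)%:E + (lam * c)%:E))%E).
  by apply: ge0_le_integral => //; [exact: measurable_funTS|apply: measurable_funTS; apply: emeasurable_funD => //; apply: emeasurable_funM => //; exact/measurable_EFinP].
have mKa : measurable_fun K (fun x => (a x)%:E) by apply: measurable_funTS; exact/measurable_EFinP.
have caK x : K x -> (0 <= c%:E * (a x)%:E)%E.
  by move=> _; rewrite -EFinM lee_fin mulr_ge0// normr_ge0.
have lcK x : K x -> (0 <= (lam * c)%:E)%E by rewrite lee_fin mulr_ge0.
have mcK : measurable_fun K (fun x => c%:E * (a x)%:E)%E by apply: emeasurable_funM.
rewrite (ge0_integralD mu mK caK mcK lcK (measurable_cst _)).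
apply: leeD; last by rewrite integral_cst.
rewrite ge0_integralZl//; last first.
  by move=> x _; rewrite lee_fin normr_ge0.
rewrite lee_wpmul2l ?lee_fin//.
apply: ge0_subset_integral => //.
  by apply: meas_absB.
by move=> x _; rewrite lee_fin normr_ge0.
Qed.

End modulus.

Section modulus_rV.
Context {R : realType} {n : nat}.
Local Notation V := 'rV[R]_n.
Local Notation X := (leb_rV R n).
Local Notation mu := (lebesgue R n).
Local Notation intg f := (mu.-integrable [set: X] (EFin \o (f : X -> R))).

Lemma measurable_near_diag (e : R) : 0 < e ->
  measurable ([set z | ball (z.1 : V) e (z.2 : V)] : set (X * X)).
Proof.
move=> e0.
have cm (i : 'I_n) : measurable_fun [set: X * X] (fun z : X * X => (z.1 : V) 0 i - (z.2 : V) 0 i).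
  apply: measurable_funB.
    exact: (measurableT_comp (@leb_coord R n i) (@measurable_fst _ _ X X)).
  exact: (measurableT_comp (@leb_coord R n i) (@measurable_snd _ _ X X)).
rewrite (_ : mkset _ = \bigcap_(i in [set: 'I_n])
   ((fun z : X * X => (z.1 : V) 0 i - (z.2 : V) 0 i) @^-1` ball (0 : R) e)); last first.
  apply/seteqP; split => z /=.
    by move=> /(lt_ball_rV _ _ e0) H i _; rewrite /ball/= sub0r normrN; exact: H.
  by move=> H; apply/(lt_ball_rV _ _ e0) => i; have := H i Logic.I; rewrite /ball/= sub0r normrN.
apply: fin_bigcap_measurable => // i _.
have := cm i measurableT _ (@measurable_ball R 0 e).
by rewrite setTI.
Qed.

(** Approximate [v] by a Lipschitz function and let [E] be the pairs at distance less than [e]. The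
    factor [e ^+ n] is the order of the mass of a mollifier, so that dividing by this mass later
    leaves an arbitrarily small bound. *)
Lemma L1_modulus (v : V -> R) (K : set V) : intg v -> bounded_set K -> measurable (K : set X) ->
  forall d : R, 0 < d -> exists2 e0 : R, 0 < e0 & forall e : R, 0 < e -> e < e0 ->
  (\int[mu]_(x in K) \int[mu]_(y in ball (x : V) e) `|v y - v x|%:E <= (d * e ^+ n)%:E)%E.
Proof.
move=> iv [M [_ KM]] mK d d0.
have {KM}KM x : K x -> `|x| <= `|M| + 1.
  by apply: KM; rewrite (le_lt_trans (ler_norm M))// ltrDl.
(* [K] has norms at most [r - 2], its 1-neighbourhood at most [r - 1]; the last unit makes the
   inequality strict. *)
pose r := `|M| + 3; have r0 : 0 < r by rewrite ltr_wpDl.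
pose Q : set V := ball (0 : V) r.
have mQ : measurable (Q : set X) by exact: leb_ball.
have Qoo : (mu Q < +oo)%E by rewrite lebesgue_ball// ltry.
have bK (x : V) : `|x| <= `|M| + 2 -> Q x.
  move=> xM; rewrite /Q -ball_normE /= sub0r normrN; apply: le_lt_trans xM _.
  by rewrite ltrD2l ltr_nat.
have KQ : K `<=` Q.
  by move=> x /KM xM; apply: bK; apply: le_trans xM _; rewrite lerD2l ler1n.
have p0 : 0 < 2 ^+ n :> R by rewrite exprn_gt0.
have d10 : 0 < d / (4 * 2 ^+ n) by rewrite divr_gt0// mulr_gt0.
have [phi [L phiL] vphi] := @lipschitz_dense_L1 R n Q mQ Qoo v iv _ d10.
pose L' := `|L| + 1; have L'0 : 0 < L' by rewrite ltr_wpDl.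
have Kfin : mu K \is a fin_num.
  by rewrite ge0_fin_numE//; apply: le_lt_trans Qoo; apply: le_measure; rewrite ?inE.
pose k := fine (mu K); have k0 : 0 <= k by exact: fine_ge0.
(* [phi], hence [L'], is fixed before [e]. The L^1 gap between [v] and [phi] has used half of [d];
   the variation [L' * e] of [phi] over [K] uses the other half. The [k + 1] avoids a division by
   0. *)
exists (Num.min 1 (d / (2 * 2 ^+ n * L' * (k + 1)))).
  by rewrite lt_min ltr01 divr_gt0// !mulr_gt0// ltr_wpDl.
move=> e e0; rewrite lt_min => /andP[e1 ed].
have := @modulus_bound _ X R lebesgue_sf [set z | ball (z.1 : V) e (z.2 : V)] K Q v phi ((e *+ 2) ^+ n) (L' * e)
  (measurable_near_diag e0) mK mQ (intg_meas iv).
move=> /(_ _ _ _ _ _ KQ) H.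
have {}H := H (leb_continuous (lipschitz_bound_continuous phiL)).
have c0 : 0 <= (e *+ 2) ^+ n by rewrite exprn_ge0// mulrn_wge0// ltW.
have {}H := H c0.
have Le0 : 0 <= L' * e by rewrite mulr_ge0// ltW.
have {}H := H Le0.
have Ex (x : X) : (mu [set y : X | ball (x : V) e (y : V)] <= ((e *+ 2) ^+ n)%:E)%E.
  by rewrite (_ : mkset _ = ball (x : V) e)// lebesgue_ball.
have Ey (y : X) : (mu [set x : X | ball (x : V) e (y : V)] <= ((e *+ 2) ^+ n)%:E)%E.
  rewrite (_ : mkset _ = ball (y : V) e) ?lebesgue_ball//.
  by apply/seteqP; split => x /ball_sym.
have {}H := H Ex Ey.
have EKQ (x y : X) : K x -> ball (x : V) e (y : V) -> Q y.
  move=> /KM xM; rewrite -ball_normE /= => xy; apply: bK.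
  rewrite -(subrK x (y : V)) addrC; apply: le_trans (ler_normD _ _) _.
  rewrite (_ : 2 = 1 + 1)// addrA; apply: lerD => //.
  by rewrite distrC ltW// (lt_trans xy).
have Ephi (x y : X) : ball (x : V) e (y : V) -> `|phi x - phi y| <= L' * e.
  rewrite -ball_normE /= => xy; apply: le_trans (phiL _ _) _.
  apply: (@le_trans _ _ (L' * `|(x : V) - y|)).
    by rewrite ler_wpM2r// (le_trans (ler_norm L))// lerDl.
  by rewrite ler_pM2l// ltW.
have {}H := H EKQ Ephi.
apply: le_trans (le_trans H _).
  rewrite le_eqVlt; apply/orP; left; apply/eqP; apply: eq_integral => x _.
  rewrite integral_mkcond; apply: eq_integral => y _.
  rewrite patchE indicE.
  have -> : ((x, y) \in [set z : X * X | ball (z.1 : V) e (z.2 : V)]) = ((y : V) \in (ball (x : V) e : set V)).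
    by apply/idP/idP => /set_mem yy; exact/mem_set.
  by case: ifP => _; rewrite ?mul1r ?mul0r.
apply: (@le_trans _ _ ((2 * (e *+ 2) ^+ n)%:E * (d / (4 * 2 ^+ n))%:E + (L' * e * (e *+ 2) ^+ n)%:E * k%:E)%E).
  apply: leeD; last by rewrite /k fineK.
  by rewrite lee_wpmul2l// lee_fin mulr_ge0.
rewrite -!EFinM -EFinD lee_fin -[e *+ 2]mulr_natl exprMn.
have en : 0 <= e ^+ n by rewrite exprn_ge0// ltW.
have H1 : L' * e * (2 ^+ n * k) <= d / 2.
  move: ed; rewrite ltr_pdivlMr ?mulr_gt0// ?ltr_wpDl// => ed.
  have : L' * e * 2 ^+ n * 1 >= 0 by rewrite !mulr_ge0// ltW.
  move: ed; move: (2 ^+ n) => p; lra.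
have -> : 2 * (2 ^+ n * e ^+ n) * (d / (4 * 2 ^+ n)) = d / 2 * e ^+ n.
  by field; rewrite gt_eqF.
have -> : L' * e * (2 ^+ n * e ^+ n) * k = L' * e * (2 ^+ n * k) * e ^+ n by ring.
rewrite -mulrDl ler_wpM2r//; lra.
Qed.

End modulus_rV.

(** * Mollifiers *)

Section smooth1.
Context {R : realType}.
Implicit Types f g : R -> R.

Fixpoint smooth1 (k : nat) f : Prop :=
  continuous f /\
  if k is k'.+1 then (forall x, derivable f x 1) /\ smooth1 k' (derive1 f) else True.

Lemma smooth1_cont k f : smooth1 k f -> continuous f.
Proof. by case: k => [|k] []. Qed.

Lemma smooth1S k f : smooth1 k.+1 f -> smooth1 k f.
Proof.
elim: k f => [|k IH] f; first by case.
by move=> [cf [df sf]]; split => //; split => //; exact: IH.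
Qed.

Lemma smooth1D k f g : smooth1 k f -> smooth1 k g -> smooth1 k (fun x => f x + g x).
Proof.
elim: k f g => [|k IH] f g /= [cf sf] [cg sg].
  by split => // x; apply: cvgD; [exact: cf|exact: cg].
move: sf sg => [df sf] [dg sg].
split; first by move=> x; apply: cvgD; [exact: cf|exact: cg].
split; first by move=> x; exact: derivableD.
rewrite (_ : derive1 _ = fun x => derive1 f x + derive1 g x); first exact: IH.
by apply/funext => x; rewrite !derive1E deriveD.
Qed.

Lemma smooth1M k f g : smooth1 k f -> smooth1 k g -> smooth1 k (fun x => f x * g x).
Proof.
elim: k f g => [|k IH] f g sf sg.
  by split => // x; apply: cvgM; [exact: (smooth1_cont sf)|exact: (smooth1_cont sg)].
split; first by move=> x; apply: cvgM; [exact: (smooth1_cont sf)|exact: (smooth1_cont sg)].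
have sf' := smooth1S sf; have sg' := smooth1S sg.
move: sf sg => [cf [df sf]] [cg [dg sg]].
split; first by move=> x; exact: derivableM.
rewrite (_ : derive1 _ = fun x => f x * derive1 g x + g x * derive1 f x).
  by apply: smooth1D; exact: IH.
by apply/funext => x; rewrite !derive1E deriveM.
Qed.

Lemma smooth1_cst k (c : R) : smooth1 k (fun=> c).
Proof.
elim: k c => [|k IH] c; (split; first by move=> x; exact: cvg_cst) => //.
split; first by move=> x; exact: derivable_cst.
rewrite (_ : derive1 _ = fun=> 0); first exact: IH.
by apply/funext => x; rewrite derive1E derive_cst.
Qed.

Lemma is_derive_affine f (a b x : R) : derivable f (a * x + b) 1 ->
  is_derive x 1 (fun t => f (a * t + b)) (a * derive1 f (a * x + b)).
Proof.
move=> df.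
have ha : is_derive x (1 : R) (fun t : R => a * t + b) a.
  have := @is_deriveD _ _ _ _ _ x (1 : R) _ _ (@is_deriveZ _ _ _ _ a x 1 _ (is_derive_id x (1 : R))) (is_derive_cst b x (1 : R)).
  by rewrite addr0 [_ *: _]mulr1.
have hf : is_derive (a * x + b) (1 : R) f (derive1 f (a * x + b)).
  by rewrite derive1E; exact: DeriveDef.
by have := @is_derive1_comp _ f (fun t : R => a * t + b) x _ _ hf ha; rewrite mulrC.
Qed.

Lemma smooth1_affine k f (a b : R) : smooth1 k f -> smooth1 k (fun t => f (a * t + b)).
Proof.
elim: k f => [|k IH] f.
  move=> [cf _]; split => // x.
  apply: (@cvg_comp _ _ _ (fun t => a * t + b) f _ (nbhs (a * x + b))); last exact: cf.
  by apply: cvgD; [apply: cvgM; [exact: cvg_cst|exact: cvg_id]|exact: cvg_cst].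
move=> [cf [df sf]]; split.
  move=> x.
  apply: (@cvg_comp _ _ _ (fun t => a * t + b) f _ (nbhs (a * x + b))); last exact: cf.
  by apply: cvgD; [apply: cvgM; [exact: cvg_cst|exact: cvg_id]|exact: cvg_cst].
split; first by move=> x; exact: (@ex_derive _ _ _ _ _ _ _ (is_derive_affine (df _))).
rewrite (_ : derive1 _ = fun t => a * derive1 f (a * t + b)).
  by apply: smooth1M; [exact: smooth1_cst|exact: IH].
by apply/funext => x; rewrite derive1E (@derive_val _ _ _ _ _ _ _ (is_derive_affine (df _))).
Qed.

(* [t^-m exp (-1/t)] for [t > 0]; this family is closed under derivation up to
   linear combinations. *)
Definition flat (m : nat) (t : R) : R := if 0 < t then t^-1 ^+ m * expR (- t^-1) else 0.

(** For positive [m], [expR s] is the [m]-th power of [expR (s / m%:R)], which is at least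
    [s / m%:R]. *)
Lemma pow_expN (m : nat) (s : R) : 0 <= s -> s ^+ m * expR (- s) <= m%:R ^+ m.
Proof.
case: m => [|m] s0; first by rewrite !expr0 mul1r -expR0 ler_expR oppr_le0.
rewrite expRN ler_pdivrMr ?expR_gt0//.
have m0 : (m.+1%:R : R) != 0 by rewrite pnatr_eq0.
have -> : expR s = expR (s / m.+1%:R) ^+ m.+1.
  by rewrite -expRM_natl -mulr_natl mulrC divfK.
rewrite -exprMn ler_pXn2r ?nnegrE ?mulr_ge0 ?expR_ge0//.
have := expR_ge1Dx (s / m.+1%:R).
rewrite -ler_pdivrMl ?ltr0Sn// (mulrC _ s); apply: le_trans.
by rewrite lerDr ler01.
Qed.

Lemma flat_ge0 m t : 0 <= flat m t.
Proof.
rewrite /flat; case: ifP => // t0; rewrite mulr_ge0 ?expR_ge0//.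
by rewrite exprn_ge0// invr_ge0 ltW.
Qed.

Lemma flat_le m t : flat m t <= m%:R ^+ m.
Proof.
rewrite /flat; case: ifPn => t0; first by apply: pow_expN; rewrite invr_ge0 ltW.
by rewrite exprn_ge0.
Qed.

Lemma flat_le0 m t : t <= 0 -> flat m t = 0.
Proof. by rewrite /flat ltNge => ->. Qed.

Lemma flatS m t : 0 < t -> flat m t = t * flat m.+1 t.
Proof. by move=> t0; rewrite /flat t0 exprS !mulrA divff ?mul1r// gt_eqF. Qed.

Lemma is_derive_flat m t : is_derive t (1 : R) (flat m) (flat m.+2 t - m%:R * flat m.+1 t).
Proof.
have [t0|t0|->] := ltgtP t 0.
- rewrite !flat_le0 ?ltW// mulr0 subr0.
  apply: near_eq_is_derive (is_derive_cst (0 : R) t (1 : R)).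
  by near=> s; rewrite flat_le0// ltW//; near: s; exact: lt_nbhsl.
- have E : \near t, t^-1 ^+ m * expR (- t^-1) = flat m t.
    by near=> s; rewrite /flat ifT//; near: s; exact: lt_nbhsr.
  apply: (near_eq_is_derive E).
  have tn0 : t != 0 by rewrite gt_eqF.
  have hi : is_derive t (1 : R) (fun s : R => s^-1) (- t^-1 ^+ 2).
    have dI : derivable (@id R) t (1 : R) by exact: derivable_id.
    apply: DeriveDef; first exact: (derivableV tn0 dI).
    by rewrite (deriveV tn0 dI) derive_id [_ *: _]mulr1 exprVn.
  have hX := is_deriveX m hi.
  have hN := is_deriveN hi.
  have he := @is_derive1_comp _ expR (- (fun s : R => s^-1)) t _ _ (is_derive_expR _) hN.
  have := is_deriveM hX he.
  congr is_derive => //.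
    by apply/funext => s; rewrite mulrfctE exprfctE.
  rewrite /flat t0 exprfctE /= /GRing.scale/= opprK.
  case: (m) => [|m'] /=; first by rewrite !mul0r !mulr0 expr0 !mul1r subr0 addr0 mulrC.
  by rewrite !exprS; ring.
- rewrite !flat_le0// mulr0 subr0.
  (* At 0, two uses of [flatS] give [flat m h = h ^+ 2 * flat m.+2 h] for [h > 0]; as [flat m.+2] is
     bounded, the difference quotient is of order [h]. *)
  suff H : (fun h : R => h^-1 *: ((flat m \o shift 0) (h *: 1) - flat m 0)) @ 0^' --> (0 : R).
    by apply: DeriveDef; [apply/cvg_ex; exists 0|exact/cvg_lim].
  apply/cvgrPdist_le => e e0.
  pose M : R := m.+2%:R ^+ m.+2 + 1.
  have M0 : 0 < M by rewrite ltr_wpDl// exprn_ge0.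
  near=> h.
  rewrite sub0r normrN /= addr0 [h *: _]mulr1 (flat_le0 m (lexx 0)) subr0.
  have [h0|h0] := leP h 0; first by rewrite flat_le0// scaler0 normr0 ltW.
  rewrite flatS// flatS// [_ *: _]mulrA mulVf ?gt_eqF// mul1r.
  have fh : 0 <= h * flat m.+2 h by rewrite mulr_ge0 ?flat_ge0// ltW.
  rewrite (ger0_norm fh).
  apply: (@le_trans _ _ (h * M)).
    by rewrite ler_wpM2l ?(ltW h0)// (le_trans (flat_le _ _))// lerDl.
  rewrite -ler_pdivlMr//; apply: le_trans (ler_norm _) _.
  near: h; apply: dnbhs0_le; exact: divr_gt0.
Unshelve. all: by end_near. Qed.

Lemma smooth1_flat k m : smooth1 k (flat m).
Proof.
have cf j : continuous (flat j).
  move=> t; apply: differentiable_continuous; apply/derivable1_diffP.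
  exact: (@ex_derive _ _ _ _ _ _ _ (is_derive_flat j t)).
elim: k m => [|k IH] m; first by split.
split => //; split; first by move=> t; exact: (@ex_derive _ _ _ _ _ _ _ (is_derive_flat m t)).
rewrite (_ : derive1 _ = fun t => flat m.+2 t + (- m%:R) * flat m.+1 t).
  apply: smooth1D; first exact: IH.
  by apply: smooth1M; [exact: smooth1_cst|exact: IH].
by apply/funext => t; rewrite derive1E (@derive_val _ _ _ _ _ _ _ (is_derive_flat m t)) mulNr.
Qed.

Lemma flat0_le1 t : flat 0 t <= 1.
Proof. by have := flat_le 0 t; rewrite expr0. Qed.

Lemma bounded_derive_lipschitz (f df : R -> R) (K : R) :
  (forall x : R, is_derive x (1 : R) f (df x)) -> (forall x, `|df x| <= K) ->
  forall x y, `|f x - f y| <= K * `|x - y|.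
Proof.
move=> fdf dfK x y.
wlog xy : x y / x < y => [H|].
  have [/H//|yx|->] := ltgtP x y; last by rewrite !subrr !normr0 mulr0.
  by rewrite distrC (distrC x); exact: H.
have [|c _] := @MVT R f df x y xy (fun z _ => fdf z).
  apply: continuous_subspaceT => z; apply: differentiable_continuous; apply/derivable1_diffP.
  exact: (@ex_derive _ _ _ _ _ _ _ (fdf z)).
by rewrite distrC => ->; rewrite normrM (distrC y) ler_wpM2r.
Qed.

(** The constant 4 is the bound [2 ^+ 2] of [flat 2], the derivative of [flat 0]. *)
Lemma flat0_lipschitz x y : `|flat 0 x - flat 0 y| <= 4 * `|x - y|.
Proof.
apply: (@bounded_derive_lipschitz _ (flat 2)).
  by move=> z; have := is_derive_flat 0 z; rewrite mul0r subr0.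
move=> z; rewrite ger0_norm ?flat_ge0//; apply: le_trans (flat_le _ _) _.
by rewrite expr2; lra.
Qed.

(** On (-1, 1) this is exp(- 2 / (1 - t^2)), the usual smooth bump, and it is 0 elsewhere. *)
Definition bump (t : R) : R := flat 0 (1 - t) * flat 0 (1 + t).

Lemma bump_ge0 t : 0 <= bump t. Proof. by rewrite mulr_ge0 ?flat_ge0. Qed.

Lemma bump_le1 t : bump t <= 1.
Proof. by rewrite mulr_ile1 ?flat_ge0 ?flat0_le1. Qed.

Lemma bump0 t : 1 <= `|t| -> bump t = 0.
Proof.
rewrite ler_normr /bump => /orP[t1|t1].
  by rewrite flat_le0 ?mul0r// subr_le0.
by rewrite [flat 0 (1 + t)]flat_le0 ?mulr0//; lra.
Qed.

Lemma bump_even t : bump (- t) = bump t.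
Proof. by rewrite /bump opprK mulrC. Qed.

Lemma bump_lipschitz x y : `|bump x - bump y| <= 8 * `|x - y|.
Proof.
rewrite /bump.
set a := flat 0 (1 - x); set b := flat 0 (1 + x); set c := flat 0 (1 - y); set d := flat 0 (1 + y).
rewrite (_ : a * b - c * d = (a - c) * b + c * (b - d)); last ring.
apply: le_trans (ler_normD _ _) _.
have H1 : `|a - c| <= 4 * `|x - y|.
  apply: le_trans (flat0_lipschitz _ _) _.
  by rewrite (_ : 1 - x - (1 - y) = - (x - y)) ?normrN//; ring.
have H2 : `|b - d| <= 4 * `|x - y|.
  apply: le_trans (flat0_lipschitz _ _) _.
  by rewrite (_ : 1 + x - (1 + y) = x - y) //; ring.
rewrite !normrM (ger0_norm (flat_ge0 _ _)) (ger0_norm (flat_ge0 0 (1 - y))).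
have b1 : b <= 1 := flat0_le1 _.
have c1 : c <= 1 := flat0_le1 _.
apply: le_trans (lerD (ler_piMr (normr_ge0 _) b1) (ler_piMl (normr_ge0 _) c1)) _; lra.
Qed.

Lemma smooth1_bump k : smooth1 k bump.
Proof.
apply: smooth1M.
  rewrite (_ : (fun t => _) = fun t => flat 0 (-1 * t + 1)).
    exact/smooth1_affine/smooth1_flat.
  by apply/funext => t; rewrite mulN1r addrC.
rewrite (_ : (fun t => _) = fun t => flat 0 (1 * t + 1)).
  exact/smooth1_affine/smooth1_flat.
by apply/funext => t; rewrite mul1r addrC.
Qed.

(** A lower bound of [bump] on [-1/2, 1/2], not its value at 1/2: there both factors have an
    argument at least 1/2, hence are at least exp(-2). *)
Definition bump_half : R := expR (- 2) * expR (- 2).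

Lemma bump_half_gt0 : 0 < bump_half. Proof. by rewrite mulr_gt0 ?expR_gt0. Qed.

Lemma bump_half_le t : `|t| <= 2^-1 -> bump_half <= bump t.
Proof.
move=> t2; have H (s : R) : 2^-1 <= s -> expR (- 2) <= flat 0 s.
  move=> s2; have s0 : 0 < s by lra.
  rewrite /flat s0 expr0 mul1r ler_expR lerN2.
  by rewrite -[leRHS]invrK lef_pV2 ?posrE.
by move: t2; rewrite ler_norml => /andP[t1 t2]; apply: ler_pM; rewrite ?expR_ge0// H//; lra.
Qed.

End smooth1.

Section prodf.
Context {R : realType} {n : nat}.
Local Notation V := 'rV[R]_n.
Implicit Types (beta : 'I_n -> R -> R) (x y : V).

Definition prodf beta (y : V) : R := \prod_i beta i (y 0 i).

Lemma prodf_continuous beta : (forall i, continuous (beta i)) -> continuous (prodf beta).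
Proof.
move=> cb; rewrite /prodf; elim: (index_enum _) => [|i s IH].
  rewrite (_ : (fun _ => _) = cst 1); first exact: cst_continuous.
  by apply/funext => y; rewrite big_nil.
rewrite (_ : (fun _ => _) = fun y : V => beta i (y 0 i) * \prod_(i <- s) beta i (y 0 i)); last first.
  by apply/funext => y; rewrite big_cons.
move=> y.
have H : {for y, continuous (fun z : V => beta i (z 0 i))}.
  by apply: (@continuous_comp _ _ _ (fun z : V => z 0 i) (beta i)); [exact: coord_continuous|exact: cb].
exact: (cvgM H (IH y)).
Qed.

Lemma is_derive_prodf beta (db : R) (j : 'I_n) y : is_derive (y 0 j) 1 (beta j) db ->
  is_derive y (delta_mx 0 j) (prodf beta) (db * \prod_(i | i != j) beta i (y 0 i)).
Proof.
move=> bj; set c := \prod_(i | i != j) _.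
have E (t : R) : t^-1 *: ((prodf beta \o shift y) (t *: delta_mx 0 j) - prodf beta y) =
    c * (t^-1 *: ((beta j \o shift (y 0 j)) (t *: (1 : R)) - beta j (y 0 j))).
  have P1 z : prodf beta z = beta j (z 0 j) * \prod_(i | i != j) beta i (z 0 i).
    by rewrite /prodf (bigD1 j).
  have P2 : \prod_(i | i != j) beta i ((t *: delta_mx 0 j + y) 0 i) = c.
    by apply: eq_bigr => i ij; rewrite !mxE (negPf ij) andbF mulr0 add0r.
  rewrite /= !P1 P2 -/c !mxE !eqxx -mulrBl /GRing.scale/=; ring.
have H : (t : R)^-1 *: ((prodf beta \o shift y) (t *: delta_mx 0 j) - prodf beta y) @[t --> 0^'] --> c * db.
  under eq_fun do rewrite E.
  apply: cvgMr; have [/cvg_ex[l bl] <-] := bj.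
  by rewrite /derive (cvg_lim _ bl).
apply: DeriveDef; first by apply/cvg_ex; exists (c * db).
by rewrite mulrC; exact/cvg_lim.
Qed.

Lemma Cn_prodf beta : (forall i k, smooth1 k (beta i)) -> forall k, Cn k (prodf beta).
Proof.
move=> sb k; elim: k beta sb => [|k IH] beta sb.
  by split => //; apply: prodf_continuous => i; have [] := sb i 0%N.
split; first by apply: prodf_continuous => i; have [] := sb i 0%N.
move=> j.
have D y : is_derive y (delta_mx 0 j) (prodf beta)
    (derive1 (beta j) (y 0 j) * \prod_(i | i != j) beta i (y 0 i)).
  apply: is_derive_prodf; rewrite derive1E; apply: DeriveDef => //.
  by have [_ []] := sb j 1%N.
split; first by move=> y; exact: (@ex_derive _ _ _ _ _ _ _ (D y)).
rewrite (_ : partial j _ = prodf (fun i => if i == j then derive1 (beta i) else beta i)); last first.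
  apply/funext => y; rewrite /partial (@derive_val _ _ _ _ _ _ _ (D y)).
  rewrite /prodf [RHS](bigD1 j)//= eqxx; congr (_ * _).
  by apply: eq_bigr => i /negPf ->.
apply: IH => i m; case: eqP => _ //.
by have [_ []] := sb i m.+1.
Qed.

Lemma prod01 (I : Type) (s : seq I) (a : I -> R) :
  (forall i, 0 <= a i <= 1) -> 0 <= \prod_(i <- s) a i <= 1.
Proof.
move=> a1; elim/big_ind : _ => //; first by rewrite ler01 lexx.
by move=> b c /andP[b0 b1] /andP[c0 c1]; rewrite mulr_ge0//= mulr_ile1.
Qed.

Lemma prod_lipschitz (I : Type) (s : seq I) (a b : I -> R) :
  (forall i, 0 <= a i <= 1) -> (forall i, 0 <= b i <= 1) ->
  `|\prod_(i <- s) a i - \prod_(i <- s) b i| <= \sum_(i <- s) `|a i - b i|.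
Proof.
move=> a1 b1; elim: s => [|i s IH]; first by rewrite !big_nil subrr normr0.
rewrite !big_cons.
move: IH; set P := \prod_(i <- s) a i; set Q := \prod_(i <- s) b i => IH.
have -> : a i * P - b i * Q = (a i - b i) * P + b i * (P - Q) by ring.
apply: le_trans (ler_normD _ _) _; rewrite !normrM; apply: lerD.
  by have /andP[P0 P1] := prod01 s a1; rewrite ler_piMr// ger0_norm.
apply: le_trans IH; rewrite ler_piMl//.
by have /andP[b0 bb] := b1 i; rewrite ger0_norm.
Qed.

End prodf.

Section mollifier.
Context {R : realType} {n : nat}.
Local Notation V := 'rV[R]_n.
Local Notation mu := (lebesgue R n).
Local Notation X := (leb_rV R n).
Implicit Types (x y : V) (e : R).

(** A tensor product of bumps, fitted to the cubes that are the balls of the sup norm. It is not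
    normalised; its integral is [mass]. *)
Definition molli e x y : R := \prod_i bump ((x 0 i - y 0 i) / e).

Lemma molliE e x : molli e x = prodf (fun i t => bump (- e^-1 * t + x 0 i / e)).
Proof. by apply/funext => y; apply: eq_bigr => i _; congr bump; ring. Qed.

Lemma molliC e x y : molli e x y = molli e y x.
Proof.
apply: eq_bigr => i _; rewrite -bump_even; congr bump; ring.
Qed.

Lemma Cn_molli e x k : Cn k (molli e x).
Proof.
rewrite molliE; apply: Cn_prodf => i m.
apply: smooth1_affine; exact: smooth1_bump.
Qed.

Lemma molli_ge0 e x y : 0 <= molli e x y.
Proof. by apply: prodr_ge0 => i _; exact: bump_ge0. Qed.

Lemma molli_le1 e x y : molli e x y <= 1.
Proof.
have H i : 0 <= bump ((x 0 i - y 0 i) / e) <= 1 by rewrite bump_ge0 bump_le1.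
by have /andP[] := prod01 (index_enum _) H.
Qed.

Lemma molli0 e x y : 0 < e -> ~ ball x e y -> molli e x y = 0.
Proof.
move=> e0 H; have [i xyi] : exists i, e <= `|x 0 i - y 0 i|.
  apply/not_existsP => nH; apply: H; apply/lt_ball_rV => // i.
  by rewrite ltNge; apply/negP; exact: nH.
rewrite /molli (bigD1 i)//= bump0 ?mul0r//.
by rewrite normrM normfV (gtr0_norm e0) ler_pdivlMr// mul1r.
Qed.

Lemma molli_lipschitz e x y z : 0 < e ->
  `|molli e x y - molli e x z| <= n%:R * 8 / e * `|y - z|.
Proof.
move=> e0; apply: le_trans (prod_lipschitz _ _ _) _.
- by move=> i; rewrite bump_ge0 bump_le1.
- by move=> i; rewrite bump_ge0 bump_le1.
apply: (@le_trans _ _ (\sum_(i < n) (8 / e * `|y - z|))).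
  apply: ler_sum => i _; apply: le_trans (bump_lipschitz _ _) _.
  rewrite -mulrA ler_wpM2l// -mulrBl normrM normfV (gtr0_norm e0) mulrC ler_wpM2l ?invr_ge0 ?(ltW e0)//.
  rewrite (_ : _ - _ - _ = - (y - z) 0 i); first by rewrite normrN; exact: coord_le_norm.
  by rewrite !mxE; ring.
by rewrite sumr_const card_ord -[_ *+ n]mulr_natl !mulrA.
Qed.

Lemma molli_half e x y : 0 < e -> ball x (e / 2) y -> bump_half ^+ n <= molli e x y.
Proof.
move=> e0 xy; rewrite -[X in _ ^+ X]card_ord -prodr_const.
apply: ler_prod => i _; rewrite (ltW bump_half_gt0)/=.
apply: bump_half_le.
have e20 : 0 < e / 2 by rewrite divr_gt0.
move: xy => /(lt_ball_rV _ _ e20)/(_ i)/ltW H.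
by rewrite normrM normfV (gtr0_norm e0) ler_pdivrMr// mulrC.
Qed.

Lemma derive_lipschitz_bound (f : V -> R) (K : R) (h x : V) :
  (forall a b, `|f a - f b| <= K * `|a - b|) -> derivable f x h -> `|'D_h f x| <= K * `|h|.
Proof.
move=> fK df.
have cA : closed [set z : R | `|z| <= K * `|h|].
  apply: (@closed_comp _ _ (fun z : R => `|z|) [set z | z <= K * `|h|]); last exact: closed_le.
  by move=> z _; exact: norm_continuous.
apply: (closed_cvg _ cA _ _ df).
near=> t => /=.
have t0 : t != 0 by near: t; exact: nbhs_dnbhs_neq.
rewrite normrM normfV mulrC ler_pdivrMr ?normr_gt0//.
apply: le_trans (fK _ _) _.
by rewrite /= addrK normrZ mulrA mulrAC.
Unshelve. all: by end_near. Qed.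

Definition dmolli e (j : 'I_n) x y : R :=
  (- e^-1 * derive1 bump ((x 0 j - y 0 j) / e)) * \prod_(i | i != j) bump ((x 0 i - y 0 i) / e).

Lemma is_derive_molli e j x y : is_derive y (delta_mx 0 j) (molli e x) (dmolli e j x y).
Proof.
rewrite molliE.
have db t : derivable (@bump R) t 1 by have [_ []] := @smooth1_bump R 1.
have H := @is_derive_prodf R n (fun i t => bump (- e^-1 * t + x 0 i / e)) _ j y (is_derive_affine (db _)).
rewrite (_ : dmolli e j x y = - e^-1 * derive1 bump (- e^-1 * y 0 j + x 0 j / e) *
  \prod_(i | i != j) bump (- e^-1 * y 0 i + x 0 i / e)); first exact: H.
have E i : (x 0 i - y 0 i) / e = - e^-1 * y 0 i + x 0 i / e by ring.
by rewrite /dmolli E; congr (_ * _); apply: eq_bigr => i _; rewrite E.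
Qed.

(** [molli] depends on [x - y] only, so its derivatives in the centre and in the variable are
    opposite. The sign comes out of the symmetry [molliC] and the oddness of the derivative of
    [bump]. *)
Lemma is_derive_molli_center e j x y :
  is_derive x (delta_mx 0 j) (molli e ^~ y) (- dmolli e j x y).
Proof.
rewrite (_ : molli e ^~ y = molli e y); last by apply/funext => z; exact: molliC.
have H := is_derive_molli e j y x.
rewrite (_ : - dmolli e j x y = dmolli e j y x); first exact: H.
have db t : derivable (@bump R) t 1 by have [_ []] := @smooth1_bump R 1.
have odd t : derive1 (@bump R) (- t) = - derive1 (@bump R) t.
  have := @is_derive_affine R bump (-1) 0 t (db _).
  rewrite addr0 (_ : (fun _ => _) = bump); last first.
    by apply/funext => s; rewrite addr0 mulN1r bump_even.
  by move/@derive_val => H'; rewrite [in RHS]derive1E H' !mulN1r opprK.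
rewrite /dmolli -mulNr; congr (_ * _).
  by rewrite -mulrN -odd; congr (_ * derive1 bump _); ring.
by apply: eq_bigr => i _; rewrite -bump_even; congr bump; ring.
Qed.

End mollifier.

(** * Friedrichs' lemma *)

Lemma ae_eq_Rintegral d (X : measurableType d) (R : realType) (mu : {measure set X -> \bar R})
    (f g : X -> R) : measurable_fun setT f -> measurable_fun setT g ->
  {ae mu, forall y, f y = g y} -> \int[mu]_y f y = \int[mu]_y g y.
Proof.
move=> mf mg fg; congr fine; apply: ae_eq_integral => //.
- exact/measurable_EFinP.
- exact/measurable_EFinP.
- by apply: ae_imply fg => y -> _.
Qed.

Section friedrichs.
Context {R : realType} {n : nat}.
Local Notation V := 'rV[R]_n.
Local Notation X := (leb_rV R n).
Local Notation mu := (lebesgue R n).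
Local Notation intg f := (mu.-integrable [set: X] (EFin \o (f : X -> R))).
Local Notation meas f := (measurable_fun [set: X] (f : X -> R)).
Local Notation delta j := (delta_mx 0 j : V).
Implicit Types (v g w : V -> R) (x y : V).

Lemma norm_le_coord x (M : R) : 0 <= M -> (forall i, `|x 0 i| <= M) -> `|x| <= M.
Proof.
move=> M0 xM; rewrite [leLHS]/Num.norm/= mx_normrE.
by apply: bigmax_le => // -[i k] _; rewrite /= ord1.
Qed.

Definition osc v x e : R := \int[mu]_(y in ball x e) `|v y - v x|.

Lemma intg_osc v x e : intg v ->
  mu.-integrable (ball x e : set X) (EFin \o (fun y : X => `|v y - v x|)).
Proof.
move=> iv; have mB : measurable (ball x e : set X) by exact: leb_ball.
apply: integrable_norm.
apply: (@integrableB _ _ _ mu _ mB (EFin \o v) (EFin \o cst (v x))).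
  exact: (integrableS measurableT mB (@subsetT _ _) iv).
by apply: measurable_bounded_integrable => //; [exact/lebesgue_bounded/mB/ball_bounded|exact: bounded_cst].
Qed.

Lemma osc_ge0 v x e : 0 <= osc v x e.
Proof. by apply: Rintegral_ge0. Qed.

Lemma oscE v x e : intg v -> (osc v x e)%:E = (\int[mu]_(y in ball x e) `|v y - v x|%:E)%E.
Proof.
move=> iv; rewrite /osc /Rintegral fineK//.
by apply: integrable_fin_num; [exact: leb_ball|exact: intg_osc].
Qed.

(** The difference on the left is the integral of [(v y - v x) * w y], and [w] lives on the ball. *)
Lemma average_bound v w x e (M : R) : intg v -> meas w -> (forall y, `|w y| <= M) ->
  (forall y, ~ ball x e y -> w y = 0) ->
  `|\int[mu]_y (v y * w y) - v x * \int[mu]_y w y| <= M * osc v x e.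
Proof.
move=> iv mw wM w0.
have M0 : 0 <= M := le_trans (normr_ge0 _) (wM x).
have mB : measurable (ball x e : set X) by exact: leb_ball.
have iw : intg w.
  apply: (@intg_supported _ _ _ mu w M (ball x e) mB _ mw wM w0).
  by apply: lebesgue_bounded; [exact: ball_bounded|exact: leb_ball].
have ivw : intg (fun y => v y * w y) by exact: (intgM_bounded iv mw wM).
have ivxw : intg (fun y => v x * w y) by exact: intgZ.
rewrite -(RintegralZl _ measurableT iw) -(RintegralB measurableT ivw ivxw).
apply: le_trans (le_normr_Rintegral measurableT (intgB ivw ivxw)) _.
rewrite /osc -(RintegralZl _ mB (intg_osc x e iv)) [leRHS]Rintegral_mkcond.
apply: (le_Rintegral measurableT (intg_norm (intgB ivw ivxw))).
  rewrite -restrict_EFin; apply/(integrable_mkcond _ mB).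
  exact: (integrableZl mB M (intg_osc x e iv)).
move=> y _; rewrite patchE -mulrBl normrM; case: ifPn => yB.
  by rewrite mulrC ler_wpM2r.
by rewrite w0 ?normr0 ?mulr0//; move: yB; rewrite notin_setE.
Qed.

Section fixed_radius.
Variable e : R.
Hypothesis e0 : 0 < e.

Let K8 := n%:R * 8 / e : R.
Let K80 : 0 <= K8. Proof. by rewrite divr_ge0// ?mulr_ge0// ltW. Qed.

Lemma molli_continuous x : continuous (@molli R n e x).
Proof. exact: (lipschitz_bound_continuous (fun y z => molli_lipschitz x y z e0)). Qed.

Lemma meas_molli x : meas (molli e x).
Proof. exact: leb_continuous (@molli_continuous x). Qed.

Lemma norm_molli x y : `|@molli R n e x y| <= 1.
Proof. by rewrite ger0_norm ?molli_ge0// molli_le1. Qed.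

Lemma intg_molli x : intg (molli e x).
Proof.
apply: (@intg_supported _ _ _ mu _ 1 (ball x e) (leb_ball _ _) _ (meas_molli x) (norm_molli x)).
  by apply: lebesgue_bounded; [exact: ball_bounded|exact: leb_ball].
by move=> y; exact: molli0.
Qed.

Definition mass : R := \int[mu]_y molli e 0 y.

Lemma massE x : \int[mu]_y molli e x y = mass.
Proof.
rewrite /mass /Rintegral -(@integral_shift R n (- x) (molli e 0)); last first.
  exact: borel_continuous (@molli_continuous 0).
congr fine; apply: eq_integral => y _; congr EFin; apply: eq_bigr => i _.
by congr bump; rewrite !mxE; congr (_ / _); ring.
Qed.

(** On the half-size cube, of volume [e ^+ n], [molli] is at least [bump_half ^+ n]. *)
Lemma mass_ge : (bump_half ^+ n) * e ^+ n <= mass.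
Proof.
have e20 : 0 < e / 2 by rewrite divr_gt0.
set D : set X := ball (0 : V) (e / 2).
have mB : measurable D by exact: leb_ball.
have bh0 : 0 <= (@bump_half R) ^+ n by rewrite exprn_ge0// ltW// bump_half_gt0.
have mm : measurable_fun [set: X] (fun y : X => (molli e 0 y)%:E).
  by apply/measurable_EFinP; exact: meas_molli.
rewrite -lee_fin /mass /Rintegral fineK; last by apply: integrable_fin_num => //; exact: intg_molli.
apply: (@le_trans _ _ (\int[mu]_(y in D) (molli e 0 y)%:E)%E); last first.
  by apply: ge0_subset_integral => // y _; rewrite lee_fin molli_ge0.
apply: (@le_trans _ _ (\int[mu]_(y in D) (bump_half ^+ n)%:E)%E).
  rewrite integral_cst// lebesgue_ball// -EFinM lee_fin.
  by rewrite (_ : e / 2 *+ 2 = e)// -mulr_natr divfK.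
apply: ge0_le_integral => //.
- by apply: measurable_funTS.
- by move=> y yB; rewrite lee_fin molli_half.
Qed.

Lemma mass_gt0 : 0 < mass.
Proof. by apply: lt_le_trans mass_ge; rewrite mulr_gt0// exprn_gt0// bump_half_gt0. Qed.

Definition mollified v x : R := mass^-1 * \int[mu]_y (v y * molli e x y).

Lemma mollified_approx v x : intg v -> `|mollified v x - v x| <= mass^-1 * osc v x e.
Proof.
move=> iv; have m0 := mass_gt0.
rewrite (_ : mollified v x - v x = mass^-1 * (\int[mu]_y (v y * molli e x y) - v x * \int[mu]_y molli e x y)).
  rewrite normrM ger0_norm ?invr_ge0 ?(ltW m0)// ler_wpM2l ?invr_ge0 ?(ltW m0)//.
  rewrite -[osc _ _ _]mul1r; apply: average_bound => //.
  - exact: meas_molli.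
  - exact: norm_molli.
  - by move=> y; exact: molli0.
by rewrite massE mulrBr /mollified mulrCA mulVf ?mulr1// gt_eqF.
Qed.

Lemma mollified_lipschitz v : intg v -> forall x y,
  `|mollified v x - mollified v y| <= mass^-1 * (K8 * \int[mu]_y `|v y|) * `|x - y|.
Proof.
move=> iv x y; have m0 := mass_gt0.
have ivm z : intg (fun y => v y * molli e z y) by exact: (intgM_bounded iv (meas_molli z) (norm_molli z)).
rewrite /mollified -mulrBr normrM ger0_norm ?invr_ge0 ?(ltW m0)// -mulrA ler_wpM2l ?invr_ge0 ?(ltW m0)//.
rewrite -(RintegralB measurableT (ivm x) (ivm y)).
apply: le_trans (le_normr_Rintegral measurableT (intgB (ivm x) (ivm y))) _.
rewrite mulrAC -(RintegralZl _ measurableT (intg_norm iv)).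
apply: (le_Rintegral measurableT (intg_norm (intgB (ivm x) (ivm y))) (intgZ _ (intg_norm iv))) => z _.
rewrite -mulrBr normrM mulrC ler_wpM2r//.
by rewrite molliC (molliC _ y); exact: molli_lipschitz.
Qed.

Lemma is_derive_along (f : V -> R) (h x : V) (s d : R) :
  is_derive (s *: h + x) h f d -> is_derive s 1 (fun t => f (t *: h + x)) d.
Proof.
move=> [df <-].
have E : (fun t : R => t^-1 *: (((fun t : R => f (t *: h + x)) \o shift s) (t *: 1) - f (s *: h + x))) =
  (fun t : R => t^-1 *: ((f \o shift (s *: h + x)) (t *: h) - f (s *: h + x))).
  by apply/funext => t /=; rewrite [t *: 1]mulr1 scalerDl addrA.
by apply: DeriveDef; rewrite /derivable /derive E.
Qed.

Lemma norm_delta j : `|delta j| <= 1.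
Proof.
by apply: norm_le_coord => // i; rewrite mxE eqxx/= normr_nat lern1 leq_b1.
Qed.

Lemma norm_dmolli j x y : `|dmolli e j x y| <= K8.
Proof.
have D := is_derive_molli e j x y.
rewrite -(@derive_val _ _ _ _ _ _ _ D).
apply: le_trans (derive_lipschitz_bound (fun a b => molli_lipschitz x a b e0) (@ex_derive _ _ _ _ _ _ _ D)) _.
by rewrite ler_piMr// norm_delta.
Qed.

Lemma partial_molli j x : partial j (molli e x) = dmolli e j x.
Proof. by apply/funext => y; rewrite /partial (@derive_val _ _ _ _ _ _ _ (is_derive_molli e j x y)). Qed.

Lemma meas_dmolli j x : meas (dmolli e j x).
Proof.
rewrite -partial_molli; apply: leb_continuous.
by have [_ /(_ j)[_ []]] := Cn_molli e x 1.
Qed.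

(** Differentiation under the integral along the line through [x], dominated by [K8] times the
    absolute value of [v]. The minus sign is that of the derivative of the kernel in its centre. *)
Lemma is_derive_mollified v x j : intg v ->
  is_derive x (delta j) (mollified v) (- (mass^-1 * \int[mu]_y (v y * dmolli e j x y))).
Proof.
move=> iv.
pose f (t : R) (y : X) := v y * molli e (t *: delta j + x) y.
have df t y : is_derive t (1 : R) (f ^~ y) (- (v y * dmolli e j (t *: delta j + x) y)).
  rewrite -mulrN.
  have D := is_derive_along (is_derive_molli_center e j (t *: delta j + x) y).
  have := is_deriveZ (v y) D.
  exact.
have I0 : (`]-1, 1[%classic : set R) 0 by rewrite /= in_itv/= ltrN10 ltr01.
have intf t : `]-1, 1[%classic t -> intg (f t).
  by move=> _; exact: (intgM_bounded iv (meas_molli _) (norm_molli _)).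
have d1f t y : partial1of2 f t y = - (v y * dmolli e j (t *: delta j + x) y).
  by rewrite partial1of2E (@derive_val _ _ _ _ _ _ _ (df t y)).
have fG t y : `]-1, 1[%classic t -> setT y -> `|partial1of2 f t y| <= K8 * `|v y|.
  by move=> _ _; rewrite d1f normrN normrM mulrC ler_wpM2r// norm_dmolli.
have G0 y : 0 <= K8 * `|v y| by rewrite mulr_ge0.
have df' t y : `]-1, 1[%classic t -> setT y -> derivable (f ^~ y) t 1.
  by move=> _ _; exact: (@ex_derive _ _ _ _ _ _ _ (df t y)).
have := @cvg_differentiation_under_integral R _ X mu f setT measurableT 0 (-1) 1 I0 intf df'
  (fun y => K8 * `|v y|) G0 (intgZ K8 (intg_norm iv)) fG.
rewrite (_ : \int[mu]_y partial1of2 f 0 y = - \int[mu]_y (v y * dmolli e j x y)); last first.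
  rewrite -[RHS]mulN1r -(RintegralZl _ measurableT (intgM_bounded iv (meas_dmolli j x) (norm_dmolli j x))).
  by apply: eq_Rintegral => y _; rewrite d1f scale0r add0r mulN1r.
move=> H.
have key (Q Q' : R -> R) (a l : R) : Q' = (fun h => a * Q h) -> Q @ 0^' --> l -> Q' @ 0^' --> a * l.
  by move=> -> Ql; exact: cvgMr.
have H' : (fun h : R => h^-1 *: ((mollified v \o shift x) (h *: delta j) - mollified v x)) @ 0^' -->
    - (mass^-1 * \int[mu]_y (v y * dmolli e j x y)).
  rewrite -[X in _ --> X](mulrN mass^-1); apply: (key _ _ _ _ _ H).
  apply/funext => t.
  rewrite /= /mollified /f addr0 scale0r add0r /GRing.scale/=; ring.
by apply: DeriveDef; [apply/cvg_ex; eexists; exact: H'|exact: cvg_lim].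
Qed.

Section kernel.
Variables (b : V -> R) (L : R) (x : V).
Hypothesis L0 : 0 <= L.
Hypothesis bL : forall a c, `|b a - b c| <= L * `|a - c|.

(* The commutator of the derivative along [b x] frozen at [x] and the one along
   [b], applied to the mollifier: Lipschitz with a constant independent of [e]. *)
Definition commutator y : R := (b x - b y) * molli e x y.

Lemma commutator0 y : ~ ball x e y -> commutator y = 0.
Proof. by move=> xy; rewrite /commutator molli0// mulr0. Qed.

Lemma commutator_bounded y : `|commutator y| <= L * e.
Proof.
have [xy|xy] := pselect (ball x e y); last by rewrite commutator0// normr0 mulr_ge0// ltW.
rewrite normrM; apply: (@le_trans _ _ (L * e * 1)); last by rewrite mulr1.
apply: ler_pM => //; last exact: norm_molli.
apply: le_trans (bL _ _) _; rewrite ler_wpM2l// ltW//.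
by move: xy; rewrite -ball_normE.
Qed.

(** The variation of the mollifier, with constant [K8] of order [e^-1], is multiplied by
    [b x - b a], which is at most [L * e] when [a] is in the support: the radius cancels. *)
Lemma commutator_lipschitz a c :
  `|commutator a - commutator c| <= L * (8 * n%:R + 1) * `|a - c|.
Proof.
wlog xa : a c / ball x e a.
  move=> H; have [xa|xa] := pselect (ball x e a); first exact: H.
  have [xc|xc] := pselect (ball x e c); first by rewrite distrC (distrC a); exact: H.
  by rewrite !commutator0// subrr normr0 !mulr_ge0// ?addr_ge0// mulr_ge0.
have -> : commutator a - commutator c =
    (b c - b a) * molli e x c + (b x - b a) * (molli e x a - molli e x c).
  by rewrite /commutator; ring.
apply: le_trans (ler_normD _ _) _; rewrite !normrM mulrDr addrC mulrDl mulr1.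
apply: lerD.
  have -> : L * (8 * n%:R) * `|a - c| = (L * e) * (K8 * `|a - c|) by rewrite /K8; field; rewrite gt_eqF.
  apply: ler_pM => //; last exact: molli_lipschitz.
  apply: le_trans (bL _ _) _; rewrite ler_wpM2l// ltW//.
  by move: xa; rewrite -ball_normE.
rewrite distrC -[leRHS]mulr1; apply: ler_pM => //; exact: norm_molli.
Qed.

Lemma is_derive_commutator j y : derivable b y (delta j) ->
  'D_(delta j) commutator y = b x * dmolli e j x y - partial j (fun z => b z * molli e x z) y.
Proof.
move=> db.
have D := is_derive_molli e j x y.
have dm := @ex_derive _ _ _ _ _ _ _ D.
rewrite (_ : commutator = (fun z => b x *: molli e x z) \- (fun z => b z * molli e x z)); last first.
  by apply/funext => z; rewrite /commutator mulrBl.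
rewrite deriveB; [|exact: derivableZ|exact: derivableM].
by rewrite deriveZ// (@derive_val _ _ _ _ _ _ _ D).
Qed.

End kernel.

(** By the weak identity, the derivative of the mollification differs from the mollification of [g]
    by integrals of [v] against derivatives of commutators. [kernel_bound] controls these by the
    oscillation of [v], and [average_bound] compares the mollification of [g] with [g x]. *)
Lemma friedrichs_bound (b : 'I_n -> V -> R) (L : R) v g x :
  0 <= L -> (forall j a c, `|b j a - b j c| <= L * `|a - c|) -> intg v -> intg g ->
  \int[mu]_y (g y * molli e x y) =
    - (\int[mu]_y (v y * \sum_j partial j (fun z => b j z * molli e x z) y)) ->
  `|\sum_j b j x * partial j (mollified v) x - g x| <=
    mass^-1 * (n%:R * (L * (8 * n%:R + 1)) * osc v x (e + e) + osc g x e).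
Proof.
move=> L0 bL iv ig weak; have m0 := mass_gt0.
set K := L * _.
have K0 : 0 <= K by rewrite mulr_ge0// addr_ge0// mulr_ge0.
pose psi j := commutator (b j) x.
have kb j := @kernel_bound R n (psi j) v K (L * e) e (delta j) x K0 e0 (norm_delta j)
  (commutator_lipschitz x L0 (bL j)) (@commutator0 (b j) x) (commutator_bounded x L0 (bL j)) iv.
have ipsi j : intg (fun y => v y * 'D_(delta j) (psi j) y) by have [] := kb j.
have ivd j : intg (fun y => v y * dmolli e j x y).
  exact: (intgM_bounded iv (meas_dmolli j x) (norm_dmolli j x)).
have ibvd j : intg (fun y => b j x * (v y * dmolli e j x y)) by exact: intgZ.
have E y : (forall j, derivable (b j) y (delta j)) ->
    v y * \sum_j partial j (fun z => b j z * molli e x z) y =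
    \sum_j b j x * (v y * dmolli e j x y) - \sum_j v y * 'D_(delta j) (psi j) y.
  move=> db; rewrite mulr_sumr -sumrB; apply: eq_bigr => j _.
  by rewrite /psi is_derive_commutator//; ring.
(* The product rule requires the coefficients [b j] to be derivable, which Lipschitz functions are
   almost everywhere. *)
have aeE : {ae mu, forall y, \sum_j b j x * (v y * dmolli e j x y) - \sum_j v y * 'D_(delta j) (psi j) y
    = v y * \sum_j partial j (fun z => b j z * molli e x z) y}.
  have H : {ae mu, forall y, forall j, derivable (b j) y (delta j)}.
    apply: (@filter_forall _ _ _ _ (ae_filter_ringOfSetsType mu)) => j.
    exact: lipschitz_ae_derivable_dir (bL j).
  by apply: ae_imply H => y /E.
have iR : intg (fun y => \sum_j b j x * (v y * dmolli e j x y) - \sum_j v y * 'D_(delta j) (psi j) y).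
  by apply: intgB; exact: intg_sum.
rewrite -(ae_eq_Rintegral (intg_meas iR) (leb_ae_measurable (intg_meas iR) aeE) aeE) in weak.
rewrite RintegralB// in weak; [|exact: intg_sum|exact: intg_sum].
rewrite !Rintegral_sum// in weak.
have -> : \sum_j b j x * partial j (mollified v) x - g x = mass^-1 *
    ((\int[mu]_y (g y * molli e x y) - g x * \int[mu]_y molli e x y)
     - \sum_j \int[mu]_y (v y * 'D_(delta j) (psi j) y)).
  rewrite weak massE.
  rewrite (_ : \sum_j b j x * partial j _ x = - mass^-1 * \sum_j \int[mu]_y (b j x * (v y * dmolli e j x y))).
    by field; rewrite gt_eqF.
  rewrite mulr_sumr; apply: eq_bigr => j _.
  rewrite /partial (@derive_val _ _ _ _ _ _ _ (is_derive_mollified x j iv)).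
  by rewrite (RintegralZl _ measurableT (ivd j)); ring.
rewrite normrM ger0_norm ?invr_ge0 ?(ltW m0)// ler_wpM2l ?invr_ge0 ?(ltW m0)//.
apply: le_trans (ler_normB _ _) _; rewrite addrC; apply: lerD; last first.
  rewrite -[osc _ _ _]mul1r; apply: average_bound => //.
  - exact: meas_molli.
  - exact: norm_molli.
  - by move=> y; exact: molli0.
apply: le_trans (ler_norm_sum _ _ _) _.
apply: (@le_trans _ _ (\sum_(j < n) K * osc v x (e + e))).
  by apply: ler_sum => j _; have [] := kb j.
by rewrite sumr_const card_ord -mulrA mulr_natl.
Qed.

End fixed_radius.
End friedrichs.

(* Unlike [ge0_le_integral], this does not ask for the measurability of [f]
   and [g]. *)
Lemma ge0_mono_integral d (X : measurableType d) (R : realType) (mu : {measure set X -> \bar R})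
    (D : set X) (f g : X -> \bar R) :
  (forall x, D x -> 0 <= f x)%E -> (forall x, D x -> f x <= g x)%E ->
  (\int[mu]_(x in D) f x <= \int[mu]_(x in D) g x)%E.
Proof.
move=> f0 fg.
have g0 x : D x -> (0 <= g x)%E by move=> Dx; exact: le_trans (f0 x Dx) (fg x Dx).
rewrite !ge0_integralE//.
apply: le_ereal_sup => _ [h hf <-]; exists h => // x.
apply: le_trans (hf x) _; rewrite !patchE; case: ifPn => // /set_mem; exact: fg.
Qed.

(** * Lipschitz constants and extensions *)

Section lipschitz_bound.
Context {R : realType} {V W : normedModType R}.

(** The predicate [lipschitz] speaks of all sufficiently large constants; this extracts a single
    nonnegative one. *)
Lemma lipschitzP (A : set V) (f : V -> W) : [lipschitz f x | x in A] <->
  exists2 L : R, 0 <= L & forall a c, A a -> A c -> `|f a - f c| <= L * `|a - c|.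
Proof.
split=> [lf|[L L0 fL]].
  have H : \forall M \near +oo, 0 <= M /\ forall z, (A `*` A) z -> `|f z.1 - f z.2| <= M * `|z.1 - z.2|.
    by near=> M; split; near: M => //; exact: nbhs_pinfty_ge.
  have [M [M0 MB]] := filter_ex H; exists M => // a c Aa Ac.
  exact: (MB (a, c)).
suff : \forall M \near +oo, forall z, (A `*` A) z -> `|f z.1 - f z.2| <= M * `|z.1 - z.2| by [].
near=> M; move=> [a c] [/= Aa Ac]; apply: le_trans (fL _ _ Aa Ac) _.
by rewrite ler_wpM2r//; near: M; exact: nbhs_pinfty_ge.
Unshelve. all: by end_near. Qed.

End lipschitz_bound.

Section extension.
Context {R : realType} {V : normedModType R}.

(* McShane's extension. *)
Lemma lipschitz_extension (A : set V) (f : V -> R) (L : R) :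
  0 <= L -> (forall a c, A a -> A c -> `|f a - f c| <= L * `|a - c|) ->
  exists2 F : V -> R, (forall a c, `|F a - F c| <= L * `|a - c|) & forall a, A a -> F a = f a.
Proof.
move=> L0 fL; have [->|/set0P[a0 Aa0]] := eqVneq A set0.
  by exists (cst 0) => // a c; rewrite subrr normr0 mulr_ge0.
pose S x := [set f a + L * `|x - a| | a in A].
have lbS x a : A a -> lbound (S x) (f a - L * `|x - a|).
  move=> Aa _ [c Ac <-]; have /ler_normlP[_] := fL _ _ Aa Ac.
  have : L * `|a - c| <= L * `|x - a| + L * `|x - c|.
    by rewrite -mulrDr ler_wpM2l// (distrC x a); exact: ler_distD.
  lra.
have hS x : has_inf (S x).
  by split; [exists (f a0 + L * `|x - a0|), a0|eexists; exact: lbS Aa0].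
have H x y : inf (S x) <= inf (S y) + L * `|x - y|.
  rewrite -lerBlDr; apply: lb_le_inf; first by have [] := hS y.
  move=> _ [a Aa <-]; rewrite lerBlDr.
  apply: (@le_trans _ _ (f a + L * `|x - a|)); first by apply: ge_inf; [have [] := hS x|exists a].
  have : L * `|x - a| <= L * `|x - y| + L * `|y - a|.
    by rewrite -mulrDr ler_wpM2l//; exact: ler_distD.
  lra.
exists (fun x => inf (S x)).
  move=> a c; rewrite ler_norml; have := H a c; have := H c a; rewrite (distrC c a); lra.
move=> a Aa; apply/eqP; rewrite eq_le; apply/andP; split.
  by apply: ge_inf; [have [] := hS a|exists a => //; rewrite subrr normr0 mulr0 addr0].
apply: lb_le_inf; first by have [] := hS a.
by have := lbS a a Aa; rewrite subrr normr0 mulr0 subr0; apply.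
Qed.

End extension.

Section near_diagonal.
Context d (X : measurableType d) (R : realType)
  (mu : {sigma_finite_measure set X -> \bar R}).
Variables (E : set (X * X)) (v : X -> R).
Hypothesis mE : measurable E.
Hypothesis mv : measurable_fun setT v.

Lemma measurable_near_diag_integral :
  measurable_fun setT (fun x => \int[mu]_y (\1_E (x, y) * `|v y - v x|)%:E)%E.
Proof.
have mf : measurable_fun [set: X * X] (fun z : X * X => (\1_E z * `|v z.2 - v z.1|)%:E).
  apply/measurable_EFinP; apply: measurable_funM; first exact: measurable_indic.
  apply: measurableT_comp => //; apply: measurable_funB; exact: measurableT_comp.
have f0 z : (0 <= (\1_E z * `|v z.2 - v z.1|)%:E)%E by rewrite lee_fin mulr_ge0.
exact: (measurable_fun_fubini_tonelli_F (m2 := mu) _ mf f0).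
Qed.

End near_diagonal.

Section oscillation.
Context {R : realType} {n : nat}.
Local Notation V := 'rV[R]_n.
Local Notation X := (leb_rV R n).
Local Notation mu := (lebesgue R n).
Local Notation intg f := (mu.-integrable [set: X] (EFin \o (f : X -> R))).
Local Notation meas f := (measurable_fun [set: X] (f : X -> R)).
Implicit Types (v g w : V -> R) (x y : V).

Lemma meas_osc v e : 0 < e -> intg v -> meas (fun x => osc v x e).
Proof.
move=> e0 iv; apply/measurable_EFinP.
have H := @measurable_near_diag_integral _ X R lebesgue_sf _ v (measurable_near_diag e0) (intg_meas iv).
rewrite (_ : EFin \o _ =
  fun x : X => (\int[mu]_y (\1_[set z : X * X | ball (z.1 : V) e (z.2 : V)] (x, y) * `|v y - v x|)%:E)%E); first exact: H.
apply/funext => x; rewrite [LHS](oscE x e iv) integral_mkcond; apply: eq_integral => y _.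
rewrite patchE indicE.
have -> : ((x, y) \in [set z : X * X | ball (z.1 : V) e (z.2 : V)]) = ((y : V) \in (ball (x : V) e : set V)).
  by apply/idP/idP => /set_mem Q; exact/mem_set.
by case: ifP => _; rewrite ?mul1r ?mul0r.
Qed.

Lemma osc_small v (K : set V) (d : R) : intg v -> bounded_set K -> measurable (K : set X) ->
  0 < d -> exists2 e0, 0 < e0 & forall e, 0 < e -> e < e0 ->
    (\int[mu]_(x in K) (osc v x e)%:E <= (d * e ^+ n)%:E)%E.
Proof.
move=> iv bK mK d0; have [e0 e00 H] := L1_modulus iv bK mK d0; exists e0 => // e ee0 ee.
have := H e; rewrite (_ : (\int[mu]_(x in K) (osc v x e)%:E)%E =
  (\int[mu]_(x in K) \int[mu]_(y in ball (x : V) e) `|v y - v x|%:E)%E); last first.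
  by apply: eq_integral => x _; exact: oscE.
exact.
Qed.

End oscillation.

(** * From the weak A-gradient to approximation by mollifications *)

Section weak_gradient.
Context {R : realType} {n : nat}.
Local Notation V := 'rV[R]_n.
Local Notation X := (leb_rV R n).
Local Notation mu := (lebesgue R n).
Local Notation intg f := (mu.-integrable [set: X] (EFin \o (f : X -> R))).
Implicit Types (v g w : V -> R) (x y : V).

(** The absolute value of [v] is at most [1 + v ^+ 2], and constants are integrable on [U]. The
    extension by 0 makes mollification meaningful on the whole space. *)
Lemma L2_intg (U : set V) v : measurable (U : set X) -> (mu U < +oo)%E -> L2 U v ->
  intg (v \_ U).
Proof.
move=> mU Uoo [mv iv2].
rewrite (_ : EFin \o _ = (EFin \o v) \_ (U : set X)); last by rewrite restrict_EFin.
apply/(integrable_mkcond _ mU).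
have i1 : mu.-integrable (U : set X) (fun x => (1 : R)%:E + (v x ^+ 2)%:E)%E.
  apply: integrableD => //.
  by apply: measurable_bounded_integrable => //; exact: bounded_cst.
apply: le_integrable i1 => //; first exact/measurable_EFinP.
move=> x _ /=; rewrite lee_fin [leRHS]ger0_norm ?addr_ge0 ?sqr_ge0//.
have := sqr_ge0 (`|v x| - 1); have := normr_ge0 (v x); have := real_normK (num_real (v x)).
rewrite sqrrB mulr1 expr1n => <-; lra.
Qed.

Lemma test_function_molli (U : set V) e x : 0 < e ->
  (forall y, `|x - y| <= e -> U y) -> test_function U (molli e x).
Proof.
move=> e0 eU.
have cl : closure [set y | molli e x y != 0] `<=` [set y : V | `|x - y| <= e].
  have cA : closed [set y : V | `|x - y| <= e].
    apply: (@closed_comp _ _ (fun y : V => `|x - y|) [set z | z <= e]); last exact: closed_le.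
    have cn : continuous (fun y : V => `|x - y|); last by move=> y _; exact: cn.
    apply: (@lipschitz_bound_continuous _ _ _ _ 1) => a c; rewrite mul1r; apply: le_trans (ler_dist_dist _ _) _.
    by rewrite opprB addrC addrA subrK distrC.
  rewrite closureE; apply: smallest_sub => // y /=; apply: contraNP => /negP; rewrite -ltNge => xy.
  apply/eqP; apply: molli0 => //; rewrite -ball_normE /=; apply/negP; rewrite -leNgt; exact: ltW.
split.
- by move=> k; exact: Cn_molli.
- apply: bounded_closed_compact; last exact: closed_closure.
  exists (`|x| + e); split; first exact: num_real.
  move=> M xM y /cl /= xy; apply: le_trans (ltW xM).
  rewrite -(subrK x y) addrC; apply: le_trans (ler_normD _ _) _.
  by rewrite lerD2l distrC.
- by move=> y /cl; exact: eU.
Qed.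

(** The entries of [B] can be replaced by functions [b] that agree with them on [Omega] only:
    partial derivatives are local and [Omega] is open. *)
Lemma weak_identity (Omega U : set V) (B : V -> 'M[R]_n) v (g : V -> 'cV[R]_n) (b : 'I_n -> 'I_n -> V -> R) i phi :
  open Omega -> U `<=` Omega -> (forall j x, Omega x -> b i j x = B x i j) ->
  weak_nablaA B U v g -> test_function U phi ->
  \int[mu]_y (((fun x => g x i 0) \_ U) y * phi y) =
  - (\int[mu]_y ((v \_ U) y * \sum_j partial j (fun z => b i j z * phi z) y)).
Proof.
move=> oO UO bB weak tphi; have := weak i phi tphi.
rewrite [X in X = _]integral_mkcond [X in (- X)%E]integral_mkcond => H.
have {}H := congr1 fine H; rewrite fineN in H.
rewrite /Rintegral; move: H; congr (fine _ = - fine _); apply: eq_integral => y _; rewrite !patchE.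
  by case: ifPn => // _; rewrite mul0r.
case: ifPn => [/set_mem Uy|_]; last by rewrite mul0r.
congr (_ * _)%:E; apply: eq_bigr => j _; apply: near_eq_derive.
have : nbhs y Omega by apply: open_nbhs_nbhs; split => //; exact: UO.
by apply: filterS => z Oz; rewrite bB.
Qed.

End weak_gradient.

Lemma integral_lincomb_le d (X : measurableType d) (R : realType) (mu : {measure set X -> \bar R})
    (K : set X) n (h : 'I_n -> X -> R) (f1 f2 : X -> R) (a A c1 c2 c : R) :
  measurable K -> 0 <= a -> 0 <= A ->
  (forall i, measurable_fun setT (h i)) -> measurable_fun setT f1 -> measurable_fun setT f2 ->
  (forall i x, 0 <= h i x) -> (forall x, 0 <= f1 x) -> (forall x, 0 <= f2 x) ->
  (forall i, \int[mu]_(x in K) (h i x)%:E <= c%:E)%E ->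
  (\int[mu]_(x in K) (f1 x)%:E <= c1%:E)%E ->
  (\int[mu]_(x in K) (f2 x)%:E <= c2%:E)%E ->
  (\int[mu]_(x in K) (a * (A * f1 x + (\sum_i h i x + f2 x)))%:E <= (a * (A * c1 + (n%:R * c + c2)))%:E)%E.
Proof.
move=> mK a0 A0 mh mf1 mf2 h0 f10 f20 hc fc1 fc2.
have mE (f : X -> R) : measurable_fun setT f -> measurable_fun K (EFin \o f).
  by move=> mf; apply: measurable_funTS; exact/measurable_EFinP.
have ms : measurable_fun setT (fun x => \sum_i h i x) by exact: measurable_sum.
have s0 x : 0 <= \sum_i h i x by exact: sumr_ge0.
under eq_integral do rewrite EFinM.
have m2 : measurable_fun setT (fun x => \sum_i h i x + f2 x) by exact: measurable_funD.
have m1 : measurable_fun setT (fun x => A * f1 x) by exact: measurable_funM.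
rewrite ge0_integralZl//; last 2 first.
- by apply: (mE); exact: measurable_funD.
- by move=> x _; rewrite lee_fin !addr_ge0// mulr_ge0.
rewrite EFinM lee_wpmul2l ?lee_fin//.
under eq_integral do rewrite EFinD.
rewrite (@ge0_integralD _ _ _ mu K mK (fun x => (A * f1 x)%:E) (fun x => (\sum_i h i x + f2 x)%:E)) //=; last 4 first.
- by move=> x _; rewrite lee_fin mulr_ge0.
- exact: (mE _ m1).
- by move=> x _; rewrite lee_fin addr_ge0.
- exact: (mE _ m2).
rewrite EFinD; apply: leeD.
  under eq_integral do rewrite EFinM.
  rewrite ge0_integralZl//; [|exact: (mE _ mf1)|by move=> x _; rewrite lee_fin].
  by rewrite EFinM lee_wpmul2l.
under eq_integral do rewrite EFinD.
rewrite (@ge0_integralD _ _ _ mu K mK (fun x => (\sum_i h i x)%:E) (fun x => (f2 x)%:E)) //=; last 4 first.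
- by move=> x _; rewrite lee_fin.
- exact: (mE _ ms).
- by move=> x _; rewrite lee_fin.
- exact: (mE _ mf2).
rewrite EFinD; apply: leeD => //.
under eq_integral do rewrite -sumEFin.
rewrite ge0_integral_sum//; [|by move=> i; exact: (mE _ (mh i))|by move=> i x _; rewrite lee_fin].
apply: (@le_trans _ _ (\sum_(i < n) c%:E)%E); first exact: lee_sum.
by rewrite sumEFin sumr_const card_ord mulr_natl.
Qed.

Lemma measurable_lincomb d (X : measurableType d) (R : realType)
    n (h : 'I_n -> X -> R) (f1 f2 : X -> R) (a A : R) :
  (forall i, measurable_fun setT (h i)) -> measurable_fun setT f1 -> measurable_fun setT f2 ->
  measurable_fun setT (fun x => a * (A * f1 x + (\sum_i h i x + f2 x))).
Proof.
move=> mh mf1 mf2; apply: measurable_funM => //; apply: measurable_funD.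
  exact: measurable_funM.
by apply: measurable_funD => //; exact: measurable_sum.
Qed.

Section approximation.
Context {R : realType} {n : nat}.
Local Notation V := 'rV[R]_n.
Local Notation X := (leb_rV R n).
Local Notation mu := (lebesgue R n).
Local Notation intg f := (mu.-integrable [set: X] (EFin \o (f : X -> R))).
Local Notation meas f := (measurable_fun [set: X] (f : X -> R)).
Local Notation delta j := (delta_mx 0 j : V).
Implicit Types (v w : V -> R) (x y : V).

Lemma lipschitz_entries (Omega : set V) (B : V -> 'M[R]_n) : [lipschitz B x | x in Omega] ->
  exists2 L : R, 0 <= L & forall i j x y, Omega x -> Omega y ->
    `|B x i j - B y i j| <= L * `|x - y|.
Proof.
move=> lB; have [L L0 LB] := (lipschitzP Omega B).1 lB; exists L => // i j x y Ox Oy; apply: le_trans (LB x y Ox Oy).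
rewrite [leRHS]/Num.norm/= mx_normrE; apply/bigmax_geP; right; exists (i, j) => //=.
by rewrite !mxE.
Qed.

(* The function [err] dominates both errors pointwise, so that the
   measurability of the partial derivatives of [phi] is never needed. *)
Lemma W12A_approximation (Omega U K : set V) (B : V -> 'M[R]_n) v (g : V -> 'cV[R]_n) (eta d : R) :
  open Omega -> bounded_set Omega -> [lipschitz B x | x in Omega] ->
  measurable (U : set X) -> U `<=` Omega -> W12A B U v g ->
  measurable (K : set X) -> 0 < eta -> (forall x y, K x -> `|x - y| < eta -> U y) -> 0 < d ->
  exists (phi err : V -> R) (L : R),
  [/\ forall x y, `|phi x - phi y| <= L * `|x - y|,
      forall x j, derivable phi x (delta j),
      [/\ meas err, forall x, 0 <= err x & (\int[mu]_(x in K) (err x)%:E <= d%:E)%E],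
      forall x, K x -> `|phi x - v x| <= err x &
      forall x i, K x -> `|\sum_j B x i j * partial j phi x - g x i 0| <= err x].
Proof.
move=> oO bO lB mU UO [L2v L2g wk] mK eta0 KU d0.
have KUs : K `<=` U by move=> x Kx; apply: (KU x) => //; rewrite subrr normr0.
have bU : bounded_set U.
  by have [M [Mr H]] := bO; exists M; split => // k Mk x /UO; exact: H.
have bK : bounded_set K.
  by have [M [Mr H]] := bU; exists M; split => // k Mk x /KUs; exact: H.
have Uoo : (mu U < +oo)%E by exact: lebesgue_bounded.
have [L L0 LB] := lipschitz_entries lB.
(* The Friedrichs bound asks for globally Lipschitz coefficients, so each entry of [B] is extended
   from [Omega]. *)
have /choice[b bP] : forall i, exists bi : 'I_n -> V -> R,
    forall j, (forall a c, `|bi j a - bi j c| <= L * `|a - c|) /\ (forall a, Omega a -> bi j a = B a i j).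
  move=> i; have /choice[bi biP] : forall j, exists bj : V -> R,
      (forall a c, `|bj a - bj c| <= L * `|a - c|) /\ (forall a, Omega a -> bj a = B a i j).
    move=> j; have [F FL FB] := lipschitz_extension L0 (LB i j).
    by exists F.
  by exists bi.
pose v0 : V -> R := v \_ U; pose g0 i : V -> R := (fun x => g x i 0) \_ U.
have iv : intg v0 by exact: L2_intg.
have ig i : intg (g0 i) by exact: L2_intg.
pose A : R := n%:R * (L * (8 * n%:R + 1)).
have A0 : 0 <= A by rewrite !mulr_ge0// addr_ge0// mulr_ge0.
pose cn : R := bump_half ^+ n.
have cn0 : 0 < cn by rewrite exprn_gt0// bump_half_gt0.
(* [k] adds up the parts of [err]: [A * 2 ^+ n] for the oscillation of [v0] at the doubled radius,
   [n] for the components of the gradient, 1 for [v0] at radius [e]. *)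
pose k : R := A * 2 ^+ n + (n%:R + 1).
have k0 : 0 < k by rewrite ltr_wpDl ?mulr_ge0 ?exprn_ge0// ltr_wpDl.
pose d' := d * cn / k.
have d'0 : 0 < d' by rewrite divr_gt0// mulr_gt0.
have [ev ev0 Hv] := osc_small iv bK mK d'0.
have /choice[eg egP] : forall i, exists e0, 0 < e0 /\ forall e, 0 < e -> e < e0 ->
    (\int[mu]_(x in K) (osc (g0 i) x e)%:E <= (d' * e ^+ n)%:E)%E.
  by move=> i; have [e0 ? ?] := osc_small (ig i) bK mK d'0; exists e0.
(* [e < eta] makes the mollifiers centred in [K] test functions on [U]; the other conditions make
   the oscillations small, that of [v0] also at the doubled radius. *)
have [e [e0 eeta eev eeg]] : exists e : R, [/\ 0 < e, e < eta, e + e < ev & forall i, e < eg i].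
  have H : \forall e \near 0^'+, [/\ 0 < e, e < eta, e < ev / 2 & forall i, e < eg i].
    have Hg : \forall e \near (0 : R)^'+, forall i, e < eg i.
      by apply: filter_forall => i; apply: nbhs_right_lt; have [] := egP i.
    near=> e; split; near: e => //; [exact: nbhs_right_gt|exact: nbhs_right_lt|].
    by apply: nbhs_right_lt; rewrite divr_gt0.
  have [e [? ? e2 ?]] := filter_ex H; exists e; split => //; lra.
have m0 : 0 < mass (R := R) (n := n) e := mass_gt0 e0.
(* [cn * e ^+ n] bounds the mass from below. Summing all oscillations gives one function that
   dominates the error on [v] and on every component of the gradient. *)
pose err x := (cn * e ^+ n)^-1 * (A * osc v0 x (e + e) + (\sum_i osc (g0 i) x e + osc v0 x e)).
have c1 : 0 < cn * e ^+ n by apply: mulr_gt0 => //; apply: exprn_gt0.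
have mle : (mass (R := R) (n := n) e)^-1 <= (cn * e ^+ n)^-1.
  have mg : cn * e ^+ n <= mass (R := R) (n := n) e := mass_ge e0.
  by rewrite lef_pV2.
have c0 : 0 <= (cn * e ^+ n)^-1 by rewrite invr_ge0 ltW.
have Ao0 x : 0 <= A * osc v0 x (e + e) by rewrite mulr_ge0// osc_ge0.
have so0 x : 0 <= \sum_i osc (g0 i) x e by apply: sumr_ge0 => i _; exact: osc_ge0.
have ee0 : 0 < e + e by rewrite addr_gt0.
exists (mollified e v0), err.
exists ((mass (R := R) (n := n) e)^-1 * (n%:R * 8 / e * \int[mu]_y `|v0 y|)); split.
- exact: mollified_lipschitz.
- by move=> x j; exact: (@ex_derive _ _ _ _ _ _ _ (is_derive_mollified e0 x j iv)).
- split.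
  + exact: (measurable_lincomb _ _ (fun i => meas_osc e0 (ig i)) (meas_osc ee0 iv) (meas_osc e0 iv)).
  + by move=> x; rewrite mulr_ge0// !addr_ge0// osc_ge0.
  + have -> : d = (cn * e ^+ n)^-1 * (A * (d' * (e + e) ^+ n) + (n%:R * (d' * e ^+ n) + d' * e ^+ n)).
      have -> : (e + e) ^+ n = 2 ^+ n * e ^+ n by rewrite -exprMn mulr_natl.
      have -> : A * (d' * (2 ^+ n * e ^+ n)) + (n%:R * (d' * e ^+ n) + d' * e ^+ n) = k * d' * e ^+ n.
        by rewrite /k; ring.
      rewrite /d'; field; rewrite !gt_eqF//; exact: exprn_gt0.
    apply: (integral_lincomb_le mK c0 A0).
    * by move=> i; exact: meas_osc.
    * exact: meas_osc.
    * exact: meas_osc.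
    * by move=> i x; exact: osc_ge0.
    * by move=> x; exact: osc_ge0.
    * by move=> x; exact: osc_ge0.
    * by move=> i; have [_] := egP i; apply.
    * exact: Hv.
    * by apply: (Hv e e0); lra.
- move=> x Kx; have := mollified_approx e0 x iv.
  rewrite {2}/v0 patchE mem_set//; last exact: KUs.
  move/le_trans; apply; apply: ler_pM => //; first by rewrite invr_ge0 ltW.
    exact: osc_ge0.
  by rewrite addrA lerDr addr_ge0.
- move=> x i Kx.
  have tm : test_function U (molli e x).
    apply: test_function_molli => // y xy; apply: (KU x) => //; exact: le_lt_trans xy eeta.
  have bB j y : Omega y -> b i j y = B y i j by have [_] := bP i j; apply.
  have wi := weak_identity oO UO bB wk tm.
  have bL j a c : `|b i j a - b i j c| <= L * `|a - c| by have [+ _] := bP i j; apply.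
  have := friedrichs_bound e0 L0 bL iv (ig i) wi.
  have -> : g0 i x = g x i 0 by rewrite /g0 patchE mem_set//; exact: KUs.
  rewrite (eq_bigr (fun j => B x i j * partial j (mollified e v0) x)); last first.
    by move=> j _; rewrite bB//; exact/UO/KUs.
  move/le_trans; apply; apply: ler_pM => //; first by rewrite invr_ge0 ltW.
    by rewrite addr_ge0 ?osc_ge0// mulr_ge0// osc_ge0.
  rewrite lerD2l; apply: (@le_trans _ _ (\sum_i osc (g0 i) x e)); last by rewrite lerDl osc_ge0.
  by rewrite (bigD1 i)//= lerDl; apply: sumr_ge0 => j _; exact: osc_ge0.
Unshelve. all: by end_near. Qed.

End approximation.

(** * Control balls *)

Section curves.
Context {R : realType} {m : nat}.
Local Notation V := 'rV[R]_m.+2.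
Local Notation F0 := (ord0 : 'I_m.+2).
Local Notation mx := (ord_max : 'I_m.+2).
Variable F : R -> R.
Implicit Types (x y a b u xi : V) (gamma : R -> V).

Lemma qform_M_F x xi : qform (@M_F R F m.+1 x) xi =
  \sum_(j | j != mx) xi 0 j ^+ 2 + geom F (x 0 F0) ^+ 2 * xi 0 mx ^+ 2.
Proof.
rewrite /qform /dotv (bigD1 mx)//= addrC; congr (_ + _).
  apply: eq_bigr => j jm; rewrite /M_F mul_mx_diag !mxE (negPf jm); ring.
rewrite /M_F mul_mx_diag !mxE eqxx; ring.
Qed.

Definition subunit x u := forall xi, dotv u xi ^+ 2 <= qform (@M_F R F m.+1 x) xi.

(** Cauchy-Schwarz, from the nonnegative sum of the squares of [s * u 0 j - xi 0 j]. As [u] has no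
    last component, only the identity block of the matrix matters. *)
Lemma subunit_horizontal x u : u 0 mx = 0 -> \sum_j u 0 j ^+ 2 <= 1 -> subunit x u.
Proof.
move=> u0 u1 xi; rewrite qform_M_F.
set s := dotv u xi.
have E (f : 'I_m.+2 -> R) : f mx = 0 -> \sum_j f j = \sum_(j | j != mx) f j.
  by move=> f0; rewrite (bigD1 mx)//= f0 add0r.
have : 0 <= \sum_(j | j != mx) (s * u 0 j - xi 0 j) ^+ 2 by apply: sumr_ge0 => j _; exact: sqr_ge0.
rewrite (eq_bigr (fun j => s ^+ 2 * u 0 j ^+ 2 - (2 * s) * (u 0 j * xi 0 j) + xi 0 j ^+ 2)); last by move=> j _; ring.
rewrite big_split/= sumrB -!mulr_sumr -(E (fun j => u 0 j ^+ 2)) ?u0 ?expr0n//.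
rewrite -(E (fun j => u 0 j * xi 0 j)) ?u0 ?mul0r// -/(dotv u xi) -/s.
have : 0 <= geom F (x 0 F0) ^+ 2 * xi 0 mx ^+ 2 by rewrite mulr_ge0// sqr_ge0.
have : s ^+ 2 * (\sum_j u 0 j ^+ 2) <= s ^+ 2 by rewrite ler_piMr// sqr_ge0.
rewrite (_ : 2 * s * s = 2 * s ^+ 2); last ring.
lra.
Qed.

Lemma subunit_vertical x (c : R) : `|c| <= geom F (x 0 F0) -> subunit x (c *: delta_mx 0 mx).
Proof.
move=> cf xi; rewrite qform_M_F.
have -> : dotv (c *: delta_mx 0 mx) xi = c * xi 0 mx.
  rewrite /dotv (bigD1 mx)//= big1 ?addr0 => [|j jm]; rewrite !mxE ?eqxx ?(negPf jm) ?mulr1//.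
  by rewrite andbF mulr0 mul0r.
rewrite exprMn ler_wpDl//; first by apply: sumr_ge0 => j _; exact: sqr_ge0.
rewrite ler_wpM2r ?sqr_ge0// -(real_normK (num_real c)) lerXn2r ?nnegrE//.
by rewrite (le_trans (normr_ge0 c)).
Qed.

Lemma append_segment (T S : R) gamma u : 0 <= T -> 0 < S -> subunit_curve F T gamma ->
  (forall t, 0 <= t <= S -> subunit (gamma T + t *: u) u) ->
  exists gamma', [/\ subunit_curve F (T + S) gamma', gamma' 0 = gamma 0 &
    gamma' (T + S) = gamma T + S *: u].
Proof.
move=> T0 S0 [lg aeg] su.
pose gamma' t := if t <= T then gamma t else gamma T + (t - T) *: u.
have gl t : t <= T -> gamma' t = gamma t by rewrite /gamma' => ->.
have gr t : T <= t -> gamma' t = gamma T + (t - T) *: u.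
  rewrite /gamma'; case: (ltgtP t T) => // -> _.
  by rewrite subrr scale0r addr0.
exists gamma'; split; last 2 first.
- by rewrite gl.
- by rewrite gr ?lerDl ?ltW// addrAC subrr add0r.
split.
  have /lipschitzP[L L0 gL] := lg.
  pose M := L + `|u|; have M0 : 0 <= M by rewrite addr_ge0.
  have uM : `|u| <= M by rewrite lerDr.
  have gM' (a b : R) : 0 <= a <= T -> 0 <= b <= T -> `|gamma a - gamma b| <= M * `|a - b|.
    move=> aT bT; apply: le_trans (gL a b _ _) _; rewrite /= ?in_itv//.
    by rewrite ler_wpM2r// lerDl.
  apply/lipschitzP; exists M => // s t /=.
  rewrite !in_itv/=.
  wlog st : s t / s <= t.
    move=> H s1 t1; have [st|/ltW ts] := leP s t; first exact: H.
    by rewrite distrC (distrC s); exact: H.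
  move=> /andP[s0 sTS] /andP[t0 tTS].
  have [tT|/ltW Tt] := leP t T.
    by rewrite !gl ?(le_trans st)// gM' ?s0 ?t0//= (le_trans st).
  have [sT|/ltW Ts] := leP s T.
    rewrite gl// gr// opprD addrA; apply: le_trans (ler_normB _ _) _.
    have := gM' s T; rewrite s0 sT T0 lexx => /(_ isT isT) H.
    have H2 : `|(t - T) *: u| <= M * (t - T).
      by rewrite normrZ ger0_norm ?subr_ge0// mulrC ler_wpM2r// subr_ge0.
    apply: le_trans (lerD H H2) _; rewrite -mulrDr ler_wpM2l//.
    rewrite !ler0_norm ?subr_le0//; lra.
  have -> : gamma' s - gamma' t = (s - t) *: u.
    by rewrite !gr// opprD addrACA subrr add0r -scalerBl; congr (_ *: _); ring.
  by rewrite normrZ mulrC ler_wpM2r.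
(* Derivability may fail at the junction [T], which is a null set. *)
have aeT : {ae lebesgue_measure, forall t : R, t != T}.
  exists [set T]; split => //; first exact: lebesgue_measure_set1.
  by move=> t /= /negP; rewrite negbK => /eqP.
have key : forall t, (t \in `[0, T] -> derivable gamma t 1 /\ subunit (gamma t) (derive1 gamma t)) /\ t != T ->
    t \in `[0, (T + S)] -> derivable gamma' t 1 /\ subunit (gamma' t) (derive1 gamma' t).
  move=> t [H tT]; rewrite in_itv/= => /andP[t0 tTS]; rewrite derive1E.
  have [lt|lt|eqt] := ltgtP t T; last by rewrite eqt eqxx in tT.
    have [|dg gxi] := H; first by rewrite in_itv/= t0 ltW.
    have E : \forall s \near t, gamma s = gamma' s.
      by near=> s; rewrite gl// ltW//; near: s; exact: lt_nbhsl.
    split; first exact: near_eq_derivable dg.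
    by rewrite -(near_eq_derive _ E) -derive1E gl// ltW.
  have D : is_derive t 1 (fun s : R => gamma T + (s - T) *: u) u.
    have H' : (fun h : R => h^-1 *: (((fun s : R => gamma T + (s - T) *: u) \o shift t) (h *: 1) -
        (gamma T + (t - T) *: u))) @ 0^' --> u.
      apply: (@cvg_trans _ (cst u @ (0 : R)^')); last exact: cvg_cst.
      apply: near_eq_cvg; near=> h => /=.
      have h0 : h != 0 by near: h; exact: nbhs_dnbhs_neq.
      rewrite opprD addrACA subrr add0r -scalerBl scalerA [h *: 1]mulr1.
      by rewrite (_ : _ * _ = 1) ?scale1r//; field.
    by apply: DeriveDef; [apply/cvg_ex; eexists; exact: H'|exact: cvg_lim].
  have E : \forall s \near t, gamma T + (s - T) *: u = gamma' s.
    by near=> s; rewrite gr// ltW//; near: s; exact: lt_nbhsr.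
  have D' := near_eq_is_derive E D.
  split; first exact: (@ex_derive _ _ _ _ _ _ _ D').
  rewrite (@derive_val _ _ _ _ _ _ _ D') gr ?(ltW lt)//.
  by apply: su; rewrite subr_ge0 (ltW lt)/= lerBlDl.
have H : {ae lebesgue_measure, forall t, (t \in `[0, T] -> derivable gamma t 1 /\ subunit (gamma t) (derive1 gamma t)) /\ t != T}.
  exact: (@filterI _ _ (ae_filter_ringOfSetsType lebesgue_measure) _ _ aeg aeT).
exact: (@filterS _ _ (ae_filter_ringOfSetsType lebesgue_measure) _ _ key H).
Unshelve. all: by end_near. Qed.

Definition joined (T : R) x y := exists gamma, [/\ subunit_curve F T gamma, gamma 0 = x & gamma T = y].

Lemma cballP x r y : cball F x r y <-> exists2 T : R, 0 < T < r & joined T x y.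
Proof.
split=> [/ereal_inf_lt[_ [T [T0 jT] <-]]|[T /andP[T0 Tr] jT]].
  by rewrite lte_fin => Tr; exists T => //; rewrite T0.
rewrite /cball /=; apply: le_lt_trans (_ : (T%:E < r%:E)%E); last by rewrite lte_fin.
by apply: ereal_inf_lbound; exists T.
Qed.

(** Straight motion with the last coordinate fixed. The factor [m.+2] pays for the sup norm: each
    coordinate of the velocity is at most [m.+2%:R^-1], so that the squares sum to at most 1. *)
Lemma joined_horizontal (T S : R) x a b : 0 <= T -> joined T x a -> a 0 mx = b 0 mx ->
  m.+2%:R * `|b - a| < S -> joined (T + S) x b.
Proof.
move=> T0 [g [cg g0 gT]] ab hS.
have S0 : 0 < S by apply: le_lt_trans hS; rewrite mulr_ge0.
pose u := S^-1 *: (b - a).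
have u0 : u 0 mx = 0 by rewrite !mxE ab subrr mulr0.
have u1 : \sum_j u 0 j ^+ 2 <= 1.
  apply: (@le_trans _ _ (\sum_(j < m.+2) m.+2%:R^-1)); last first.
    by rewrite sumr_const card_ord -[_ *+ _]mulr_natl divff.
  have iN : m.+2%:R^-1 ^+ 2 <= (m.+2%:R^-1 : R).
    by rewrite expr2 ler_piMr// invf_le1// ler1n.
  apply: ler_sum => j _; apply: le_trans iN.
  rewrite -(real_normK (num_real (u 0 j))) lerXn2r ?nnegrE//.
  have -> : u 0 j = S^-1 * (b - a) 0 j by rewrite /u [LHS]mxE.
  have := coord_le_norm (b - a) j; rewrite normrM (gtr0_norm (_ : 0 < S^-1)) ?invr_gt0//.
  move=> H; rewrite mulrC ler_pdivrMr// mulrC -(ler_pM2r (_ : 0 < m.+2%:R))// divfK//.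
  by rewrite mulrC (le_trans _ (ltW hS))// ler_wpM2l.
have [g' [cg' g'0 g'T]] := append_segment T0 S0 cg (fun t _ => subunit_horizontal (g T + t *: u) u0 u1).
exists g'; split => //; first by rewrite g'0.
by rewrite g'T gT /u scalerA divff ?gt_eqF// scale1r addrC subrK.
Qed.

(** Motion along the last coordinate leaves the first one unchanged, so the admissible speed is the
    constant [geom F (a 0 F0)], positive when that coordinate is nonzero. *)
Lemma joined_vertical (T S c : R) x a : 0 <= T -> joined T x a -> a 0 F0 != 0 ->
  `|c| < S * geom F (a 0 F0) -> joined (T + S) x (a + c *: delta_mx 0 mx).
Proof.
move=> T0 [g [cg g0 gT]] a0 cS.
have f0 : 0 < geom F (a 0 F0) by rewrite /geom (negPf a0) expR_gt0.
have S0 : 0 < S by rewrite -(pmulr_lgt0 _ f0); exact: le_lt_trans cS.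
pose u : V := (c / S) *: delta_mx 0 mx.
have su t : 0 <= t <= S -> subunit (g T + t *: u) u.
  move=> _; apply: subunit_vertical; rewrite !mxE gT mulr0n mulr0 mulr0 addr0.
  by rewrite normrM normfV (gtr0_norm S0) ler_pdivrMr// mulrC ltW.
have [g' [cg' g'0 g'T]] := append_segment T0 S0 cg su.
exists g'; split => //; first by rewrite g'0.
by rewrite g'T gT /u scalerA mulrC divfK// gt_eqF.
Qed.

(* Away from 0, [f] is only known to be positive, so vertical moves are made on
   a fixed line [x_1 = q] with [q <> 0] close to [y_1]. *)
Lemma near_joined y (eps : R) : 0 < eps -> exists2 eta : R, 0 < eta &
  forall a b, `|a - y| < eta -> `|b - y| < eta -> forall x T, 0 <= T -> joined T x a ->
    exists2 T', T <= T' < T + eps & joined T' x b.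
Proof.
move=> e0; pose N : R := m.+2%:R; have N0 : 0 < N by [].
have N1 : 1 <= N by rewrite ler1n.
(* The three legs below take time at most [8 * (N * s)], that is [eps / 2]. *)
pose s := eps / (16 * N).
have s0 : 0 < s by rewrite divr_gt0// mulr_gt0.
(* [q] is pushed away from 0 on the side of the first coordinate of [y], so it cannot vanish. *)
pose q := if 0 <= y 0 F0 then y 0 F0 + s else y 0 F0 - s.
have q0 : q != 0.
  rewrite /q; case: (leP 0 (y 0 F0)) => H; first by rewrite gt_eqF// ltr_wpDl.
  by rewrite lt_eqF//; lra.
have qy : `|q - y 0 F0| <= s.
  by rewrite /q; case: ifP => _; rewrite ler_norml; apply/andP; split; lra.
pose f0 := geom F q; have f00 : 0 < f0 by rewrite /f0 /geom (negPf q0) expR_gt0.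
pose eta := Num.min s (s * f0).
have eta0 : 0 < eta by rewrite lt_min s0 mulr_gt0.
exists eta => // a b ay by_ x T T0 ja.
have etas : eta <= s by rewrite ge_min lexx.
have etaf : eta <= s * f0 by rewrite ge_min lexx orbT.
have coord (c : V) j : `|c - y| < eta -> `|c 0 j - y 0 j| < eta.
  by move=> cy; have := coord_le_norm (c - y) j; rewrite !mxE => /le_lt_trans; apply.
(* Three legs: horizontally to the hyperplane where the first coordinate is [q], vertically inside
   it, then horizontally to [b]. *)
pose a1 : V := \row_j (if j == F0 then q else a 0 j).
have F0mx : (F0 == mx) = false by [].
have d1 : `|a1 - a| <= 2 * s.
  apply: norm_le_coord; first by rewrite mulr_ge0// ltW.
  move=> j; rewrite !mxE; case: eqP => [->|_]; last by rewrite subrr normr0 mulr_ge0// ltW.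
  by have := coord a F0 ay; move: qy; rewrite ler_norml ltr_norml ler_norml => /andP[? ?] /andP[? ?]; apply/andP; split; lra.
have j1 : joined (T + 3 * (N * s)) x a1.
  apply: joined_horizontal ja _ _ => //; first by rewrite mxE eq_sym F0mx.
  apply: (@le_lt_trans _ _ (N * (2 * s))); first by rewrite ler_wpM2l// ltW.
  by have := mulr_gt0 N0 s0; lra.
have Ns0 : 0 < N * s by rewrite mulr_gt0.
have a10 : a1 0 F0 = q by rewrite mxE eqxx.
have cab : `|b 0 mx - a 0 mx| < (2 * s) * geom F (a1 0 F0).
  rewrite a10 -/f0; have := coord a mx ay; have := coord b mx by_.
  by rewrite !ltr_norml => /andP[? ?] /andP[? ?]; apply/andP; split; lra.
have T10 : 0 <= T + 3 * (N * s) by lra.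
have := joined_vertical T10 j1 _ cab; rewrite a10 => /(_ q0) j2.
have T20 : 0 <= T + 3 * (N * s) + 2 * s by lra.
pose a2 := a1 + (b 0 mx - a 0 mx) *: delta_mx 0 mx.
have a2E j : a2 0 j = if j == F0 then q else if j == mx then b 0 j else a 0 j.
  rewrite !mxE eqxx/=; case: (eqVneq j F0) => [->|_]; first by rewrite F0mx mulr0 addr0.
  by case: (eqVneq j mx) => [->|_]; rewrite ?mulr1 ?mulr0 ?addr0// addrC subrK.
have d2 : `|b - a2| <= 2 * s.
  apply: norm_le_coord; first by rewrite mulr_ge0// ltW.
  move=> j; have -> : (b - a2) 0 j = b 0 j - a2 0 j by rewrite [LHS]mxE [in LHS](mxE _ _ _ j).
  rewrite a2E; case: eqP => [->|_].
    by have := coord b F0 by_; move: qy; rewrite ler_norml ltr_norml ler_norml => /andP[? ?] /andP[? ?]; apply/andP; split; lra.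
  case: eqP => [->|_]; first by rewrite subrr normr0 mulr_ge0// ltW.
  have := coord a j ay; have := coord b j by_; rewrite !ltr_norml ler_norml => /andP[? ?] /andP[? ?]; apply/andP; split; lra.
have j3 : joined (T + 3 * (N * s) + 2 * s + 3 * (N * s)) x b.
  apply: joined_horizontal j2 _ _ => //; first by rewrite a2E eq_sym F0mx eqxx.
  apply: (@le_lt_trans _ _ (N * (2 * s))); first by rewrite ler_wpM2l// ltW.
  by lra.
exists (T + 3 * (N * s) + 2 * s + 3 * (N * s)) => //.
have Ns : N * s = eps / 16 by rewrite /s; field; rewrite gt_eqF.
have ss : s <= N * s by rewrite ler_peMl// ltW.
apply/andP; split; first by lra.
move: ss; rewrite Ns => ss; move: T0 e0 s0 ss {j3 j2 T20 T10 cab d2 d1 j1}; lra.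
Qed.

Lemma open_cball x r : open (cball F x r).
Proof.
rewrite openE => y /cballP[T /andP[T0 Tr] jT].
have [eta eta0 H] := @near_joined y (r - T) (ltac:(by rewrite subr_gt0)).
apply/nbhs_ballP; exists eta => // z; rewrite -ball_normE /= => yz.
have [||T' /andP[TT' T'r] jT'] := H y z _ _ x T (ltW T0) jT; [by rewrite subrr normr0|by rewrite distrC|].
by apply/cballP; exists T' => //; apply/andP; split; lra.
Qed.

(** A point of the closure is reached from a nearby point of the smaller ball in extra time less
    than [r - r']. *)
Lemma cball_closure x r r' : r' < r -> closure (cball F x r') `<=` cball F x r.
Proof.
move=> rr y cy.
have [eta eta0 H] := @near_joined y (r - r') (ltac:(by rewrite subr_gt0)).
have [a [/cballP[T /andP[T0 Tr] jT]]] := cy _ (nbhsx_ballx y eta eta0).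
rewrite -ball_normE /= => ya.
have [||T' /andP[TT' T'r] jT'] := H a y _ _ x T (ltW T0) jT; [by rewrite distrC|by rewrite subrr normr0|].
by apply/cballP; exists T' => //; apply/andP; split; lra.
Qed.

Lemma cball_le x r r' : r' <= r -> cball F x r' `<=` cball F x r.
Proof.
move=> rr y /cballP[T /andP[T0 Tr] jT]; apply/cballP; exists T => //.
by rewrite T0 (lt_le_trans Tr).
Qed.

(** The closure of the smaller ball is compact, being closed and bounded, and lies in the open
    larger ball; compactness makes the distance to the outside uniform. *)
Lemma cball_separated x r r' : bounded_set (cball F x r) -> r' < r ->
  exists2 eta : R, 0 < eta & forall y z, cball F x r' y -> `|y - z| < eta -> cball F x r z.
Proof.
move=> bB rr.
have cK : compact (closure (cball F x r')).
  apply: bounded_closed_compact; last exact: closed_closure.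
  have [M [Mr MB]] := bB; exists M; split => // k Mk y cy; apply: MB => //.
  exact: cball_closure cy.
have [] := (@compact_near_coveringP _ _).1 cK R (0 : R)^'+ (fun e y => forall z, `|y - z| < e -> cball F x r z) _.
  move=> y cy.
  have : nbhs y (cball F x r).
    by apply: open_nbhs_nbhs; split; [exact: open_cball|exact: cball_closure cy].
  move=> /nbhs_ballP[e /= e0 eB]; have e20 : 0 < e / 2 by rewrite divr_gt0.
  exists (ball y (e / 2), [set t : R | 0 < t < e / 2]) => /=.
    split; first exact: nbhsx_ballx.
    near=> t; apply/andP; split; near: t; [exact: nbhs_right_gt|exact: nbhs_right_lt].
  move=> -[a t]; rewrite -ball_normE /= => -[ya /andP[t0 te]] z az.
  apply: eB; rewrite -ball_normE /=.
  by have := ler_distD a y z; lra.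
move=> eta /= eta0 H; exists (eta / 2); first by rewrite divr_gt0.
move=> y z yB; apply: (H (eta / 2)) => /=.
- by rewrite sub0r normrN gtr0_norm ?divr_gt0//; lra.
- by rewrite divr_gt0.
- exact: subset_closure.
Unshelve. all: by end_near. Qed.

Lemma measurable_cball x r : measurable (cball F x r : set (leb_rV R m.+2)).
Proof. by apply: leb_open; exact: open_cball. Qed.

End curves.

(** * The competitor *)

Section clamp.
Context {R : realType}.
Implicit Types (t h : R).

Definition posq t : R := if 0 <= t then t ^+ 2 else 0.
Definition dposq t : R := if 0 <= t then 2 * t else 0.

Lemma is_derive_posq t : is_derive t (1 : R) posq (dposq t).
Proof.
have H h : `|posq (h + t) - posq t - h * dposq t| <= h ^+ 2.
  rewrite /posq /dposq; case: (leP 0 (h + t)) => ht; case: (leP 0 t) => t0; rewrite ler_norml; apply/andP; split; nra.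
have C : (fun h : R => h^-1 *: ((posq \o shift t) (h *: (1 : R)) - posq t)) @ 0^' --> dposq t.
  apply/cvgrPdist_le => e e0; near=> h.
  have h0 : h != 0 by near: h; exact: nbhs_dnbhs_neq.
  have he : `|h| <= e by near: h; apply: dnbhs0_le.
  apply: le_trans he; rewrite /= [h *: 1]mulr1 distrC.
  rewrite (_ : _ - _ = h^-1 * (posq (h + t) - posq t - h * dposq t)); last by rewrite /GRing.scale/=; field.
  rewrite normrM normfV mulrC ler_pdivrMr ?normr_gt0//; apply: le_trans (H h) _.
  by rewrite -normrM -expr2 ger0_norm// sqr_ge0.
by apply: DeriveDef; [apply/cvg_ex; eexists; exact: C|exact: cvg_lim].
Unshelve. all: by end_near. Qed.

(** The step from 0 to 1, of class C^1: its derivative [dclamp] is the tent on [1/4, 3/4] with peak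
    4 at 1/2, of area 1. *)
Definition clamp t : R := 8 * posq (t - 4^-1) - 16 * posq (t - 2^-1) + 8 * posq (t - 3 / 4).
Definition dclamp t : R := 8 * dposq (t - 4^-1) - 16 * dposq (t - 2^-1) + 8 * dposq (t - 3 / 4).

Lemma is_derive_clamp t : is_derive t (1 : R) clamp (dclamp t).
Proof.
have D (c a : R) : is_derive t (1 : R) (fun s => a * posq (s - c)) (a * dposq (t - c)).
  have := @is_derive_affine R posq 1 (- c) t.
  rewrite !mul1r => /(_ (@ex_derive _ _ _ _ _ _ _ (is_derive_posq _))).
  rewrite derive1E (@derive_val _ _ _ _ _ _ _ (is_derive_posq _)).
  rewrite (_ : (fun t0 => posq (1 * t0 + - c)) = (fun s => posq (s - c))); last by apply/funext => s; rewrite mul1r.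
  by move=> Q; have := is_deriveZ a Q.
exact: (is_deriveD (is_deriveB (D 4^-1 8) (D 2^-1 16)) (D (3 / 4) 8)).
Qed.

Lemma clamp_le0 t : t <= 4^-1 -> clamp t = 0.
Proof.
by move=> t4; rewrite /clamp /posq; do 3 (case: ifP => ?); nra.
Qed.

Lemma clamp_ge1 t : 3 / 4 <= t -> clamp t = 1.
Proof.
by move=> t4; rewrite /clamp /posq !ifT; [field|lra|lra|lra].
Qed.

Lemma clamp_ge0 t : 0 <= clamp t.
Proof. by rewrite /clamp /posq; do 3 (case: ifP => ?); nra. Qed.

Lemma clamp_le1 t : clamp t <= 1.
Proof. by rewrite /clamp /posq; do 3 (case: ifP => ?); nra. Qed.

Lemma dclamp0 t : t <= 4^-1 \/ 3 / 4 <= t -> dclamp t = 0.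
Proof. by move=> [H|H]; rewrite /dclamp /dposq; do 3 (case: ifP => ?); lra. Qed.

Lemma dclamp_bounds t : 0 <= dclamp t <= 4.
Proof. by rewrite /dclamp /dposq; apply/andP; split; do 3 (case: ifP => ?); lra. Qed.

Lemma clamp_lipschitz s t : `|clamp s - clamp t| <= 4 * `|s - t|.
Proof.
apply: (bounded_derive_lipschitz is_derive_clamp) => x.
by have /andP[d0 d4] := dclamp_bounds x; rewrite ger0_norm.
Qed.

End clamp.

Section enorm.
Context {R : realType} {n : nat}.
Implicit Types (a b : 'cV[R]_n).

Lemma enorm_ge0 a : 0 <= enorm a. Proof. exact: sqrtr_ge0. Qed.

Lemma sqr_enorm a : enorm a ^+ 2 = \sum_i a i 0 ^+ 2.
Proof. by rewrite sqr_sqrtr// sumr_ge0// => i _; exact: sqr_ge0. Qed.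

Lemma enorm_le a (c : R) : 0 <= c -> \sum_i a i 0 ^+ 2 <= c ^+ 2 -> enorm a <= c.
Proof. by move=> c0; rewrite -sqr_enorm ler_pXn2r ?nnegrE ?enorm_ge0. Qed.

Lemma cauchy_schwarz a b : \sum_i a i 0 * b i 0 <= enorm a * enorm b.
Proof.
set A := enorm a; set B := enorm b; set S := \sum_i _.
have A0 : 0 <= A by exact: enorm_ge0.
have B0 : 0 <= B by exact: enorm_ge0.
have H : A * B * S <= A * B * (A * B).
  have : 0 <= \sum_i (B * a i 0 - A * b i 0) ^+ 2 by apply: sumr_ge0 => i _; exact: sqr_ge0.
  rewrite (eq_bigr (fun i => B ^+ 2 * a i 0 ^+ 2 - (2 * A * B) * (a i 0 * b i 0) + A ^+ 2 * b i 0 ^+ 2)); last by move=> i _; ring.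
  rewrite big_split/= sumrB -!mulr_sumr -!sqr_enorm -/A -/B -/S.
  rewrite (_ : B ^+ 2 * A ^+ 2 - 2 * A * B * S + A ^+ 2 * B ^+ 2 = 2 * (A * B * (A * B) - A * B * S)); last ring.
  by rewrite pmulr_rge0// subr_ge0.
have [AB|] := ltP 0 (A * B); first by rewrite -(ler_pM2l AB).
have Z (c : 'cV[R]_n) : enorm c = 0 -> forall i, c i 0 = 0.
  move=> c0; have := sqr_enorm c; rewrite c0 expr0n/= => /esym H' i.
  have /(_ i isT)/eqP := psumr_eq0P (fun i _ => sqr_ge0 (c i 0)) H'.
  by rewrite sqrf_eq0 => /eqP.
move=> AB; have /eqP : A * B = 0 by apply/eqP; rewrite eq_le AB mulr_ge0.
rewrite mulf_eq0 => /orP[/eqP/Z a0|/eqP/Z b0].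
  by rewrite /S big1 ?mulr_ge0// => i _; rewrite a0 mul0r.
by rewrite /S big1 ?mulr_ge0// => i _; rewrite b0 mulr0.
Qed.

Lemma enormD a b : enorm (a + b) <= enorm a + enorm b.
Proof.
apply: enorm_le; first by rewrite addr_ge0 ?enorm_ge0.
rewrite (eq_bigr (fun i => a i 0 ^+ 2 + b i 0 ^+ 2 + 2 * (a i 0 * b i 0))); last by move=> i _; rewrite !mxE; ring.
rewrite 2!big_split/= -mulr_sumr -!sqr_enorm sqrrD.
have := cauchy_schwarz a b; rewrite -mulr_natl; lra.
Qed.

Lemma enormZ (c : R) a : enorm (c *: a) = `|c| * enorm a.
Proof.
rewrite /enorm (eq_bigr (fun i => c ^+ 2 * a i 0 ^+ 2)); last by move=> i _; rewrite mxE exprMn.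
by rewrite -mulr_sumr sqrtrM ?sqr_ge0// sqrtr_sqr.
Qed.

Lemma enorm0 : enorm (0 : 'cV[R]_n) = 0.
Proof. by rewrite -[X in enorm X](scale0r (0 : 'cV[R]_n)) enormZ normr0 mul0r. Qed.

Lemma enorm_le_const a (c : R) : 0 <= c -> (forall i, `|a i 0| <= c) -> enorm a <= n%:R * c.
Proof.
move=> c0 ac; apply: enorm_le; first by rewrite mulr_ge0.
apply: (@le_trans _ _ (\sum_(i < n) c ^+ 2)).
  by apply: ler_sum => i _; rewrite -(real_normK (num_real (a i 0))) lerXn2r ?nnegrE.
rewrite sumr_const card_ord -[_ *+ _]mulr_natl exprMn ler_wpM2r ?sqr_ge0//.
by rewrite -natrX ler_nat; case: (n) => // k; rewrite -{1}(expn1 k.+1) leq_pexp2l.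
Qed.

End enorm.

Section chain.
Context {R : realType} {n : nat}.
Local Notation V := 'rV[R]_n.
Implicit Types (x y z h : V).

(** Only a directional derivative of [f] is assumed, so the one-dimensional chain rule is applied to
    the restriction of [f] to a line. *)
Lemma is_derive_chain (f : V -> R) (G : R -> R) (d g : R) x h :
  is_derive x h f d -> is_derive (f x) (1 : R) G g -> is_derive x h (G \o f) (g * d).
Proof.
move=> fd Gg; pose k (t : R) := f (t *: h + x).
have kd : is_derive (0 : R) (1 : R) k d.
  by apply: is_derive_along; rewrite scale0r add0r.
have k0 : k 0 = f x by rewrite /k scale0r add0r.
have Gg' : is_derive (k 0) (1 : R) G g by rewrite k0.
have Dk := @ex_derive _ _ _ _ _ _ _ kd; have DG := @ex_derive _ _ _ _ _ _ _ Gg'.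
have D : derivable (G \o k) 0 1 by apply/derivable1_diffP/differentiable_comp; exact/derivable1_diffP.
have := derive1_comp Dk DG; rewrite !derive1E (@derive_val _ _ _ _ _ _ _ kd) (@derive_val _ _ _ _ _ _ _ Gg') => <-.
have E : (fun t : R => t^-1 *: (((G \o k) \o shift 0) (t *: 1) - (G \o k) 0)) =
  (fun t : R => t^-1 *: (((G \o f) \o shift x) (t *: h) - (G \o f) x)).
  by apply/funext => t /=; rewrite k0 addr0 [t *: 1]mulr1.
by apply: DeriveDef; rewrite /derivable /derive -E.
Qed.

Variables (e : R) (z : V).
Hypothesis e0 : 0 < e.

Let c : R := bump_half ^+ n.
Let c0 : 0 < c. Proof. by rewrite exprn_gt0// bump_half_gt0. Qed.

(** It is 0 on the half-size cube, where [molli e z] is at least [bump_half ^+ n], and 1 outside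
    [ball z e]; its gradient is of order [e^-1]. *)
Definition cutoff y : R := 1 - clamp (molli e z y / bump_half ^+ n).

Lemma cutoff_ge0 y : 0 <= cutoff y. Proof. by rewrite subr_ge0 clamp_le1. Qed.

Lemma cutoff_le1 y : cutoff y <= 1. Proof. by rewrite gerBl clamp_ge0. Qed.

Lemma cutoff0 y : bump_half ^+ n <= molli e z y -> cutoff y = 0.
Proof.
move=> H; rewrite /cutoff clamp_ge1 ?subrr// ler_pdivlMr//.
by apply: le_trans H; rewrite ler_piMl//; [exact: ltW|lra].
Qed.

Lemma cutoff1 y : ~ ball z e y -> cutoff y = 1.
Proof. by move=> zy; rewrite /cutoff molli0// mul0r clamp_le0 ?subr0. Qed.

Definition dcutoff j y : R := - (dclamp (molli e z y / bump_half ^+ n) * (dmolli e j z y / bump_half ^+ n)).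

Lemma is_derive_cutoff j y : is_derive y (delta_mx 0 j) cutoff (dcutoff j y).
Proof.
have D1 := is_derive_molli e j z y.
have D2 : is_derive y (delta_mx 0 j) (fun y => molli e z y / bump_half ^+ n) (dmolli e j z y / bump_half ^+ n).
  rewrite (_ : (fun y => _) = (fun y => c^-1 *: molli e z y)); last by apply/funext => a; rewrite mulrC.
  by rewrite mulrC; exact: is_deriveZ.
have D3 := is_derive_chain D2 (is_derive_clamp _).
have := is_deriveB (is_derive_cst (1 : R) y (delta_mx 0 j)) D3.
rewrite sub0r; exact.
Qed.

Lemma dcutoff_le j y : `|dcutoff j y| <= 4 * (n%:R * 8 / e / bump_half ^+ n).
Proof.
rewrite normrN normrM; have /andP[d0 d4] := dclamp_bounds (molli e z y / bump_half ^+ n).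
rewrite ger0_norm//; apply: ler_pM => //.
rewrite normrM normfV (gtr0_norm c0) ler_wpM2r ?invr_ge0 ?(ltW c0)//; exact: norm_dmolli.
Qed.

Lemma dcutoff0 j y : ~ ball z e y -> dcutoff j y = 0.
Proof.
by move=> zy; rewrite /dcutoff molli0// mul0r dclamp0 ?mul0r ?oppr0//; left.
Qed.

Lemma cutoff_lipschitz x y : `|cutoff x - cutoff y| <= 4 * (n%:R * 8 / e / bump_half ^+ n) * `|x - y|.
Proof.
have -> : cutoff x - cutoff y = clamp (molli e z y / c) - clamp (molli e z x / c) by rewrite /cutoff; ring.
apply: le_trans (clamp_lipschitz _ _) _.
have ci0 : 0 < c^-1 by rewrite invr_gt0.
have -> : molli e z y / c - molli e z x / c = c^-1 * (molli e z y - molli e z x) by ring.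
have -> : 4 * (n%:R * 8 / e / c) * `|x - y| = 4 * (c^-1 * (n%:R * 8 / e * `|y - x|)) by rewrite distrC; ring.
by rewrite normrM (gtr0_norm ci0) ler_pM2l// ler_pM2l//; exact: molli_lipschitz.
Qed.

End chain.

Lemma indic1 (T : Type) (R : pzRingType) (A : set T) (y : T) : A y -> \1_A y = 1 :> R.
Proof. by move=> Ay; rewrite indicE mem_set. Qed.

Lemma indic0 (T : Type) (R : pzRingType) (A : set T) (y : T) : ~ A y -> \1_A y = 0 :> R.
Proof. by move=> Ay; rewrite indicE memNset. Qed.

Section pointwise.
Context {R : realType} {n : nat}.
Local Notation V := 'rV[R]_n.
Local Notation delta j := (delta_mx 0 j : V).
Variables (B : V -> 'M[R]_n) (phi err v : V -> R) (g : V -> 'cV[R]_n) (e : R) (z : V) (M t : R).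
Hypothesis e0 : 0 < e.
Hypothesis t0 : 0 < t.

(* The factor [cutoff e z] makes the competitor vanish near [z]: this enlarges
   its zero set, which compensates for the errors made on the set [calA], whose
   measure may be exactly half of that of the ball. *)
Definition competitor y : R := cutoff e z y * clamp (phi y).

Lemma competitor_lipschitz (L : R) : 0 <= L -> (forall x y, `|phi x - phi y| <= L * `|x - y|) ->
  exists2 K : R, 0 <= K & forall x y, `|competitor x - competitor y| <= K * `|x - y|.
Proof.
move=> L0 phiL; pose K1 : R := 4 * (n%:R * 8 / e / bump_half ^+ n).
have K10 : 0 <= K1.
  by rewrite mulr_ge0// divr_ge0 ?exprn_ge0 ?(ltW bump_half_gt0)// divr_ge0 ?mulr_ge0// ltW.
exists (K1 + 4 * L) => [|x y]; first by rewrite addr_ge0// mulr_ge0.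
have -> : competitor x - competitor y =
    (cutoff e z x - cutoff e z y) * clamp (phi x) + cutoff e z y * (clamp (phi x) - clamp (phi y)).
  by rewrite /competitor; ring.
apply: le_trans (ler_normD _ _) _; rewrite [leRHS]mulrDl !normrM; apply: lerD.
  rewrite -[leRHS]mulr1; apply: ler_pM => //; first exact: cutoff_lipschitz.
  by rewrite ger0_norm ?clamp_ge0 ?clamp_le1.
rewrite -[leRHS]mul1r; apply: ler_pM => //; first by rewrite ger0_norm ?cutoff_ge0 ?cutoff_le1.
apply: le_trans (clamp_lipschitz _ _) _; rewrite -mulrA ler_pM2l//.
Qed.

Lemma competitor_bounds y : 0 <= competitor y.
Proof. by rewrite mulr_ge0 ?cutoff_ge0 ?clamp_ge0. Qed.

Hypothesis dphi : forall x j, derivable phi x (delta j).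

Lemma partial_competitor j y : partial j competitor y =
  cutoff e z y * dclamp (phi y) * partial j phi y + clamp (phi y) * dcutoff e z j y.
Proof.
have D1 := is_derive_cutoff e z j y.
have D2 : is_derive y (delta j) phi (partial j phi y) by apply: DeriveDef.
have D3 := is_derive_chain D2 (is_derive_clamp _).
have D := is_deriveM D1 D3.
rewrite /partial (_ : competitor = cutoff e z * (clamp \o phi)); last by apply/funext.
by rewrite (@derive_val _ _ _ _ _ _ _ D) /GRing.scale/= mulrA.
Qed.

Lemma nablaA_competitor y : nablaA B competitor y =
  (cutoff e z y * dclamp (phi y)) *: nablaA B phi y +
  clamp (phi y) *: (B y *m \col_j dcutoff e z j y).
Proof.
rewrite /nablaA !scalemxAr -mulmxDr; congr (_ *m _).
by apply/colP => j; rewrite !mxE partial_competitor.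
Qed.

Variable y : V.
Hypothesis M0 : 0 <= M.
Hypothesis BM : forall i j, `|B y i j| <= M.
Hypothesis err0 : 0 <= err y.
Hypothesis phierr : `|phi y - v y| <= err y.
Hypothesis gerr : forall i, `|\sum_j B y i j * partial j phi y - g y i 0| <= err y.

Lemma enorm_nablaA_cutoff : enorm (B y *m \col_j dcutoff e z j y) <=
  n%:R * (n%:R * (M * (4 * (n%:R * 8 / e / bump_half ^+ n)))) * \1_(ball z e) y.
Proof.
set k := 4 * _.
have k0 : 0 <= k.
  by rewrite mulr_ge0// divr_ge0 ?exprn_ge0 ?(ltW bump_half_gt0)// divr_ge0 ?mulr_ge0// ltW.
have [zy|zy] := pselect (ball z e y); last first.
  rewrite indic0// mulr0 (_ : \col_j _ = 0) ?mulmx0; first by rewrite enorm0.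
  by apply/colP => j; rewrite !mxE dcutoff0.
rewrite indic1// mulr1; apply: enorm_le_const; first by do 2 (apply: mulr_ge0 => //).
move=> i; rewrite mxE; apply: le_trans (ler_norm_sum _ _ _) _.
apply: (@le_trans _ _ (\sum_(j < n) M * k)); last by rewrite sumr_const card_ord mulr_natl.
apply: ler_sum => j _; rewrite mxE normrM; apply: ler_pM => //; exact: dcutoff_le.
Qed.

(** The error counts twice: with factor [4 * n] through the gradient of [phi], since [dclamp] is at
    most 4, and with factor [8 / t] where [phi] is between 1/4 and 3/4 although [v] is not in (0,
    1). The last term is the gradient of the cutoff. *)
Lemma enorm_nablaA_competitor (D : set V) : (0 < v y < 1 -> D y) -> 0 <= v y ->
  enorm (nablaA B competitor y) <= 2 * t * enorm (g y) ^+ 2 + 2 / t * \1_D y +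
    (8 / t + 4 * n%:R) * err y +
    n%:R * (n%:R * (M * (4 * (n%:R * 8 / e / bump_half ^+ n)))) * \1_(ball z e) y.
Proof.
move=> Dy v0.
rewrite nablaA_competitor; apply: le_trans (enormD _ _) _; rewrite !enormZ; apply: lerD; last first.
  apply: le_trans enorm_nablaA_cutoff.
  by rewrite ler_piMl ?enorm_ge0// ger0_norm ?clamp_ge0 ?clamp_le1.
have /andP[d0 d4] := dclamp_bounds (phi y).
have D1 : 0 <= (\1_D y : R) by rewrite indicE.
have ti : 0 < t^-1 by rewrite invr_gt0.
set G := enorm (g y); have G0 : 0 <= G by exact: enorm_ge0.
have Hphi : enorm (nablaA B phi y) <= G + n%:R * err y.
  rewrite (_ : nablaA B phi y = g y + (nablaA B phi y - g y)); last by rewrite addrC subrK.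
  apply: le_trans (enormD _ _) _; rewrite lerD2l; apply: enorm_le_const => // i.
  have -> : (nablaA B phi y - g y) i 0 = \sum_j B y i j * partial j phi y - g y i 0; last exact: gerr.
  by rewrite !mxE; congr (_ - _); apply: eq_bigr => j _; rewrite mxE.
have ne0 : 0 <= n%:R * err y by rewrite mulr_ge0.
rewrite normrM !ger0_norm ?cutoff_ge0//.
apply: (@le_trans _ _ (dclamp (phi y) * (G + n%:R * err y))).
  apply: (@le_trans _ _ (dclamp (phi y) * enorm (nablaA B phi y))); last by rewrite ler_wpM2l.
  by rewrite -mulrA ler_piMl ?cutoff_le1// mulr_ge0// enorm_ge0.
(* Expansion of [2 / t * (t * G - 1) ^+ 2], which is nonnegative; the 4 is the maximal slope of
   [clamp]. *)
have tG : 4 * G <= 2 * t * G ^+ 2 + 2 / t.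
  have : 0 <= 2 / t * (t * G - 1) ^+ 2 by rewrite mulr_ge0 ?sqr_ge0// mulr_ge0// ltW.
  rewrite (_ : 2 / t * (t * G - 1) ^+ 2 = 2 * t * G ^+ 2 + 2 / t - 4 * G); first by lra.
  by field; rewrite gt_eqF.
have H4 : dclamp (phi y) * (n%:R * err y) <= 4 * (n%:R * err y) by rewrite ler_wpM2r.
have HG : dclamp (phi y) * G <= 4 * G by rewrite ler_wpM2r.
have tGG : 0 <= 2 * t * G ^+ 2 by rewrite mulr_ge0 ?sqr_ge0// mulr_ge0// ltW.
have te : 0 <= 2 / t * err y by rewrite !mulr_ge0// ltW.
have [inn|/negP] := pselect (4^-1 < phi y < 3 / 4); last first.
  rewrite negb_and -!leNgt => /orP out.
  rewrite (dclamp0 out) mul0r; have : 0 <= 2 / t * \1_D y by rewrite !mulr_ge0// ltW.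
  lra.
(* Outside [D], [v y] is 0 or at least 1, hence at distance at least 1/4 from [phi y]. *)
have D4 : 1 <= \1_D y + 4 * err y.
  have [yD|yD] := pselect (D y); first by rewrite indicE mem_set// lerDl mulr_ge0.
  have : ~ (0 < v y < 1) by move/Dy.
  move/negP; rewrite negb_and -!leNgt => H; move: phierr inn D1.
  rewrite ler_norml => /andP[? ?] /andP[? ?] ?; case/orP: H => ?; lra.
have : 2 / t * 1 <= 2 / t * (\1_D y + 4 * err y) by rewrite ler_wpM2l// mulr_ge0// ltW.
rewrite !mulrDr mulr1 (_ : 2 / t * (4 * err y) = 8 / t * err y); last ring.
lra.
Qed.

(** Where [v] is at least 1 and the cutoff is 1, either [phi] is at least 3/4 and the competitor is
    1, or the error exceeds 1/4. *)
Lemma indic_le_competitor (C : set V) : (C y -> 1 <= v y) ->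
  \1_C y <= competitor y + 4 * err y + \1_(ball z e) y.
Proof.
move=> Cy; have c0 := competitor_bounds y.
have B0 : 0 <= (\1_(ball z e) y : R) by rewrite indicE.
have [yC|nC] := pselect (C y); last by rewrite indic0// !addr_ge0// mulr_ge0.
have v1 := Cy yC.
rewrite [leLHS]indic1//.
have [zy|zy] := pselect (ball z e y); first by rewrite [\1_(ball z e) y]indic1// lerDr addr_ge0// mulr_ge0.
rewrite [\1_(ball z e) y]indic0// addr0.
have [p|p] := leP (3 / 4) (phi y).
  by rewrite /competitor cutoff1// clamp_ge1// mulr1 lerDl mulr_ge0.
by move: phierr; rewrite ler_norml => /andP[? ?]; lra.
Qed.

(** [A] and [C] are disjoint, so their measures add up: besides [A], up to an error, the zero set
    contains [C], which lies in the cube where the cutoff vanishes. On [A], the error exceeds 1/4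
    wherever [phi] does. *)
Lemma indic_le_vanishing (A C : set V) : (A y -> v y <= 0) -> (C y -> ball z (e / 2) y) -> (A y -> C y -> False) ->
  0 <= v y ->
  \1_A y + \1_C y <= \1_[set y | phi y <= 4^-1 \/ bump_half ^+ n <= molli e z y] y + 4 * err y.
Proof.
move=> Ay Cy AC v0; set E := [set _ | _].
have e4 : 0 <= 4 * err y by rewrite mulr_ge0.
have E0 : 0 <= (\1_E y : R) by rewrite indicE.
have [yC|yC] := pselect (C y).
  rewrite indic0 ?indic1 ?add0r; [|by right; apply: molli_half => //; exact: Cy|done|by move=> yA; exact: AC].
  by rewrite lerDl.
rewrite [\1_C y]indic0// addr0.
have [yA|yA] := pselect (A y); last by rewrite indic0// addr_ge0.
rewrite [leLHS]indic1//; have [p|p] := leP (phi y) (4^-1); first by rewrite indic1 ?lerDl//; left.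
by move: phierr; have := Ay yA; rewrite ler_norml => ? /andP[? ?]; lra.
Qed.

Lemma competitor_vanish x : phi x <= 4^-1 \/ bump_half ^+ n <= molli e z x -> competitor x = 0.
Proof. by move=> [/clamp_le0 H|H]; rewrite /competitor ?H ?mulr0// cutoff0 ?mul0r. Qed.

End pointwise.

(** * The estimate *)

Section integral_bounds.
Context d (X : measurableType d) (R : realType) (mu : {measure set X -> \bar R}).
Variable K : set X.
Hypothesis mK : measurable K.

Let mE (f : X -> R) : measurable_fun K f -> measurable_fun K (fun x => (f x)%:E).
Proof. by move=> mf; apply/measurable_EFinP. Qed.

Let m1 (A : set X) : measurable A -> measurable_fun K (\1_A : X -> R).
Proof. by move=> mA; apply: measurable_indic. Qed.

Let i1 (A : set X) : measurable A -> (\int[mu]_(x in K) (\1_A x)%:E)%E = mu (A `&` K).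
Proof. by move=> mA; rewrite integral_indic. Qed.

Lemma integral_EFinD (f g : X -> R) : measurable_fun K f -> measurable_fun K g ->
  (forall x, K x -> 0 <= f x) -> (forall x, K x -> 0 <= g x) ->
  (\int[mu]_(x in K) (f x + g x)%:E = \int[mu]_(x in K) (f x)%:E + \int[mu]_(x in K) (g x)%:E)%E.
Proof.
move=> mf mg f0 g0; under eq_integral do rewrite EFinD.
have f0' x : K x -> (0 <= (f x)%:E)%E by move=> Kx; rewrite lee_fin f0.
have g0' x : K x -> (0 <= (g x)%:E)%E by move=> Kx; rewrite lee_fin g0.
exact: (ge0_integralD mu mK f0' (mE mf) g0' (mE mg)).
Qed.

Lemma integral_EFinZ (k : R) (f : X -> R) : measurable_fun K f -> 0 <= k ->
  (forall x, K x -> 0 <= f x) ->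
  (\int[mu]_(x in K) (k * f x)%:E = k%:E * \int[mu]_(x in K) (f x)%:E)%E.
Proof.
move=> mf k0 f0; under eq_integral do rewrite EFinM.
have f0' x : K x -> (0 <= (f x)%:E)%E by move=> Kx; rewrite lee_fin f0.
by rewrite (ge0_integralZl mu mK (mE mf) f0').
Qed.

Lemma integral_upper_bound (f err : X -> R) (D Q : set X) (a b k p : R) :
  measurable_fun K f -> measurable_fun K err -> measurable D -> measurable Q ->
  (forall x, K x -> 0 <= f x) -> (forall x, K x -> 0 <= err x) ->
  0 <= a -> 0 <= b -> 0 <= k -> 0 <= p ->
  (\int[mu]_(x in K) (a * f x + b * \1_D x + k * err x + p * \1_Q x)%:E <=
   a%:E * \int[mu]_(x in K) (f x)%:E + b%:E * mu D + k%:E * \int[mu]_(x in K) (err x)%:E + p%:E * mu Q)%E.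
Proof.
move=> mf merr mD mQ f0 err0 a0 b0 k0 p0.
have ind0 (A : set X) x : 0 <= (\1_A x : R) by rewrite indicE.
have maf : measurable_fun K (fun x => a * f x) by exact: measurable_funM.
have mbD : measurable_fun K (fun x => b * \1_D x) by apply: measurable_funM => //; exact: m1.
have mke : measurable_fun K (fun x => k * err x) by exact: measurable_funM.
have mpQ : measurable_fun K (fun x => p * \1_Q x) by apply: measurable_funM => //; exact: m1.
have af0 x : K x -> 0 <= a * f x by move=> Kx; rewrite mulr_ge0// f0.
have bD0 x : K x -> 0 <= b * \1_D x by move=> Kx; rewrite mulr_ge0.
have ke0 x : K x -> 0 <= k * err x by move=> Kx; rewrite mulr_ge0// err0.
have pQ0 x : K x -> 0 <= p * \1_Q x by move=> Kx; rewrite mulr_ge0.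
have s0 x : K x -> 0 <= a * f x + b * \1_D x by move=> Kx; rewrite addr_ge0 ?af0 ?bD0.
have ms : measurable_fun K (fun x => a * f x + b * \1_D x) by exact: measurable_funD.
have t0 x : K x -> 0 <= a * f x + b * \1_D x + k * err x by move=> Kx; rewrite addr_ge0 ?s0 ?ke0.
have mt : measurable_fun K (fun x => a * f x + b * \1_D x + k * err x) by exact: measurable_funD.
rewrite (integral_EFinD mt mpQ t0 pQ0) (integral_EFinD ms mke s0 ke0) (integral_EFinD maf mbD af0 bD0).
rewrite (integral_EFinZ mf a0 f0) (integral_EFinZ merr k0 err0).
rewrite (integral_EFinZ (m1 mD) b0)//; rewrite (integral_EFinZ (m1 mQ) p0)//.
have le1 (A : set X) : measurable A -> (\int[mu]_(x in K) (\1_A x)%:E <= mu A)%E.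
  by move=> mA; rewrite i1//; apply: le_measure; rewrite ?inE//; exact: measurableI.
by apply: leeD; [apply: leeD => //; apply: leeD => //|]; rewrite lee_wpmul2l ?lee_fin ?le1.
Qed.

Lemma measure_le_integral (u err : X -> R) (C Q : set X) (k : R) : 0 <= k ->
  measurable_fun K u -> measurable_fun K err -> measurable C -> measurable Q ->
  (forall x, K x -> 0 <= u x) -> (forall x, K x -> 0 <= err x) ->
  (forall x, K x -> \1_C x <= u x + k * err x + \1_Q x) ->
  (mu (C `&` K) <= \int[mu]_(x in K) (u x)%:E + k%:E * \int[mu]_(x in K) (err x)%:E + mu Q)%E.
Proof.
move=> k0 mu_ merr mC mQ u0 err0 H.
rewrite -i1//; apply: (@le_trans _ _ (\int[mu]_(x in K) (u x + k * err x + \1_Q x)%:E)%E).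
  apply: ge0_mono_integral => x Kx; first by rewrite lee_fin indicE.
  by rewrite lee_fin H.
have ind0 (A : set X) x : K x -> 0 <= (\1_A x : R) by rewrite indicE.
have mke : measurable_fun K (fun x => k * err x) by exact: measurable_funM.
have ke0 x : K x -> 0 <= k * err x by move=> Kx; rewrite mulr_ge0// err0.
have s0 x : K x -> 0 <= u x + k * err x by move=> Kx; rewrite addr_ge0 ?u0 ?ke0.
have ms : measurable_fun K (fun x => u x + k * err x) by exact: measurable_funD.
rewrite (integral_EFinD ms (m1 mQ) s0 (ind0 Q)) (integral_EFinD mu_ mke u0 ke0) (integral_EFinZ merr k0 err0).
apply: leeD => //; rewrite i1//; apply: le_measure; rewrite ?inE//; exact: measurableI.
Qed.

Lemma measure_add_le_integral (err : X -> R) (A C E : set X) (k : R) : 0 <= k ->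
  measurable_fun K err -> measurable A -> measurable C -> measurable E ->
  (forall x, K x -> 0 <= err x) ->
  (forall x, K x -> \1_A x + \1_C x <= \1_E x + k * err x) ->
  (mu (A `&` K) + mu (C `&` K) <= mu (E `&` K) + k%:E * \int[mu]_(x in K) (err x)%:E)%E.
Proof.
move=> k0 merr mA mC mE' err0 H.
have ind0 (S : set X) x : K x -> 0 <= (\1_S x : R) by rewrite indicE.
rewrite -!i1// -(integral_EFinZ merr k0 err0) -(integral_EFinD (m1 mA) (m1 mC) (ind0 A) (ind0 C)).
have mke : measurable_fun K (fun x => k * err x) by exact: measurable_funM.
have ke0 x : K x -> 0 <= k * err x by move=> Kx; rewrite mulr_ge0// err0.
rewrite -(integral_EFinD (m1 mE') mke (ind0 E) ke0).
apply: ge0_mono_integral => x Kx; first by rewrite lee_fin addr_ge0// indicE.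
by rewrite lee_fin H.
Qed.

End integral_bounds.

(** * Choice of the cube, of the inner radius and of the scale *)

Section small_sets.
Context {R : realType} {n : nat}.
Local Notation V := 'rV[R]_n.
Local Notation X := (leb_rV R n).
Local Notation mu := (lebesgue R n).

(** The cubes of radius [s] centred at the integer multiples of [s] cover the space; if all of them
    met [C] in null sets, [C] would be null. *)
Lemma charged_ball (C : set V) (s : R) : measurable (C : set X) -> (0 < mu C)%E -> 0 < s ->
  exists z : V, (0 < mu (C `&` ball z s))%E.
Proof.
move=> mC C0 s0; apply: contrapT => /forallNP H.
have Z z : mu (C `&` ball z s) = 0%E.
  by apply/eqP; rewrite eq_le measure_ge0 andbT leNgt; exact/negP.
pose G (k : nat) : set X := if @unpickle 'rV[int]_n k is Some w then
   C `&` ball ((\row_i (s * (w 0 i)%:~R)) : V) s else set0.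
have mG k : measurable (G k).
  by rewrite /G; case: unpickle => // w; apply: measurableI => //; exact: leb_ball.
have GZ k : mu (G k) = 0%E by rewrite /G; case: unpickle => [w|]; [exact: Z|exact: measure0].
have CG : C `<=` \bigcup_k G k.
  move=> x Cx; exists (pickle (\row_i Num.floor (x 0 i / s) : 'rV[int]_n)) => //.
  rewrite /G pickleK; split => //; apply/lt_ball_rV => // i; rewrite !mxE.
  have /andP[f1 f2] := floor_itv (x 0 i / s).
  rewrite ler_pdivlMr// in f1; rewrite ltr_pdivrMr// in f2.
  rewrite intrD mulrDl mul1r in f2; rewrite mulrC.
  by rewrite ltr_norml; apply/andP; split; lra.
have := @measure_sigma_subadditive _ _ _ mu C G mG mC CG.
rewrite eseries0 ?leNgt ?C0// => k _ _; exact: GZ.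
Qed.

End small_sets.

Section inner_approximation.
Context {R : realType} {m : nat}.
Local Notation V := 'rV[R]_m.+2.
Local Notation X := (leb_rV R m.+2).
Local Notation mu := (lebesgue R m.+2).
Variable F : R -> R.

(** A point of the ball is reached in time strictly below [r], so the balls of radius [rk k] exhaust
    it, and continuity from above of a finite measure concludes. *)
Lemma cball_inner (x : V) (r d : R) : 0 < r -> (mu (cball F x r) < +oo)%E -> 0 < d ->
  exists2 r', 0 < r' < r & (mu (cball F x r `\` cball F x r') <= d%:E)%E.
Proof.
move=> r0 Boo d0.
(* The shift to [k.+2] keeps [rk 0] positive. *)
pose rk (k : nat) := r - r / k.+2%:R.
have rk0 k : 0 < rk k < r.
  have k2 : (1 : R) < k.+2%:R by rewrite ltr1n.
  apply/andP; split; last by rewrite gtrBl divr_gt0// (lt_trans ltr01).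
  by rewrite subr_gt0 ltr_pdivrMr ?(lt_trans ltr01)// ltr_pMr.
pose G (k : nat) : set X := cball F x r `\` cball F x (rk k).
have mG k : measurable (G k) by apply: measurableD; exact: measurable_cball.
have rk_mono i j : (i <= j)%N -> rk i <= rk j.
  by move=> ij; rewrite lerD2l lerN2 ler_pM2l// lef_pV2 ?posrE// ler_nat.
have G0 : \bigcap_k G k = set0.
  apply/seteqP; split => // y Gy.
  have [/cballP[T /andP[T0 Tr] jT] _] := Gy 0%N Logic.I.
  have rT : 0 < (r - T) / r by rewrite divr_gt0// subr_gt0.
  have [k _ kP] := near_infty_natSinv_lt (PosNum rT).
  have [_] := Gy k Logic.I; apply; apply/cballP; exists T => //; rewrite T0/=.
  have := kP k (leqnn k) => /= Hk.
  have H1 : r / k.+2%:R <= r * k.+1%:R^-1 by rewrite ler_pM2l// lef_pV2 ?posrE// ler_nat.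
  have H2 : r * k.+1%:R^-1 < r - T by rewrite -ltr_pdivlMl// mulrC.
  by rewrite ltrBrDr addrC -ltrBrDr; exact: le_lt_trans H1 H2.
have mI : measurable (\bigcap_k G k) by rewrite G0; exact: measurable0.
have G0oo : (mu (G 0%N) < +oo)%E.
  apply: le_lt_trans Boo; apply: le_measure; rewrite ?inE//; first exact: measurable_cball.
  by move=> y [].
have nG : nonincreasing_seq G.
  move=> i j ij; apply/subsetPset => y [By nB]; split => // /cball_le H.
  by apply: nB; apply: H; exact: rk_mono.
have := nonincreasing_cvg_mu G0oo mG mI nG.
rewrite G0 measure0 => /fine_cvgP[fG cG].
have H : \forall k \near \oo, mu (G k) \is a fin_num /\ fine (mu (G k)) < d.
  near=> k; split; near: k => //.
  have /cvgr0_norm_lt/(_ _ d0) := cG; apply: filterS => k /=; apply: le_lt_trans; exact: ler_norm.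
have [k [fk kd]] := filter_ex H.
exists (rk k) => //.
by rewrite -[leLHS]fineK ?lee_fin ?(ltW kd).
Unshelve. all: by end_near. Qed.

End inner_approximation.

Section abstract_measure.
Context d (X : measurableType d) (R : realType) (mu : {measure set X -> \bar R}).

Lemma measurable_sum_sqr n (h : 'I_n -> X -> R) (D : set X) :
  (forall i, measurable_fun D (h i)) -> measurable_fun D (fun x => \sum_i h i x ^+ 2).
Proof. by move=> mh; apply: measurable_sum => i; exact: measurable_funX. Qed.

Lemma fine_measure_split (A B B' : set X) (k : R) : measurable A -> measurable B -> measurable B' ->
  A `<=` B -> (mu B < +oo)%E -> (mu (B `\` B') <= k%:E)%E ->
  fine (mu A) <= fine (mu (A `&` B')) + k.
Proof.
move=> mA mB mB' AB Boo H.
have fin (S : set X) : measurable S -> S `<=` B -> mu S \is a fin_num.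
  move=> mS SB; rewrite ge0_fin_numE//; apply: le_lt_trans Boo; apply: le_measure; rewrite ?inE//.
have fA : mu A \is a fin_num by exact: fin.
have fI : mu (A `&` B') \is a fin_num by apply: fin; [exact: measurableI|move=> x [/AB]].
rewrite -lee_fin EFinD !fineK//.
rewrite (measureDI mu mA mB') addeC; apply: leeD => //; apply: le_trans H.
by apply: le_measure; rewrite ?inE; [exact: measurableD|exact: measurableD|move=> x [/AB Bx nx]].
Qed.

Lemma subset_integral_EFin (A B : set X) (f : X -> R) : measurable A -> measurable B -> A `<=` B ->
  measurable_fun setT f -> (forall x, 0 <= f x) ->
  (\int[mu]_(x in A) (f x)%:E <= \int[mu]_(x in B) (f x)%:E)%E.
Proof.
move=> mA mB AB mf f0; apply: ge0_subset_integral => //.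
  by apply: measurable_funTS; exact/measurable_EFinP.
by move=> x _; rewrite lee_fin.
Qed.

End abstract_measure.

Lemma entries_bounded (R : realType) n (Omega : set 'rV[R]_n) (B : 'rV[R]_n -> 'M[R]_n) :
  bounded_set Omega -> [lipschitz B x | x in Omega] ->
  exists2 M : R, 0 <= M & forall y i j, Omega y -> `|B y i j| <= M.
Proof.
move=> [Mb [_ bO]] lB; have [L L0 LB] := lipschitz_entries lB.
have [->|/set0P[x0 Ox0]] := eqVneq Omega set0; first by exists 0.
pose K := `|Mb| + 1; have K0 : 0 <= K by rewrite addr_ge0.
have OK y : Omega y -> `|y| <= K by apply: bO; rewrite (le_lt_trans (ler_norm Mb))// ltrDl.
exists (\sum_i \sum_j `|B x0 i j| + L * (K + K)).
  by rewrite addr_ge0 ?mulr_ge0 ?addr_ge0//; apply: sumr_ge0 => i _; exact: sumr_ge0.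
move=> y i j Oy; rewrite -(subrK (B x0 i j) (B y i j)) addrC.
apply: le_trans (ler_normD _ _) _; apply: lerD.
  rewrite (bigD1 i)//= (bigD1 j)//= -addrA lerDl addr_ge0//; first exact: sumr_ge0.
  by apply: sumr_ge0 => k _; exact: sumr_ge0.
apply: le_trans (LB i j y x0 Oy Ox0) _; rewrite ler_wpM2l//.
by apply: le_trans (ler_normB _ _) _; apply: lerD; exact: OK.
Qed.

(** The exponent [n.+2] leaves a positive power of [e] after the division by [e]. The factor [b / e]
    stands for the gradient of the cutoff, the power of [e *+ 2] for the volume of the cube. *)
Lemma small_radius (R : realType) n (a b k : R) : 0 <= a -> 0 <= b -> 0 < k ->
  exists2 e : R, 0 < e & a * (b / e * (e *+ 2) ^+ n.+2) + (e *+ 2) ^+ n.+2 <= k.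
Proof.
move=> a0 b0 k0; pose W := (a * b + 1) * 2 ^+ n.+2.
have W0 : 0 < W by rewrite mulr_gt0 ?exprn_gt0// ltr_wpDl// mulr_ge0.
pose e := Num.min 1 (k / W).
have e0 : 0 < e by rewrite lt_min ltr01 divr_gt0.
have e1 : e <= 1 by rewrite ge_min lexx.
have ek : e <= k / W by rewrite ge_min lexx orbT.
exists e => //.
have en : 0 <= e ^+ n <= 1 by rewrite exprn_ge0 ?exprn_ile1 ?(ltW e0).
have -> : (e *+ 2) ^+ n.+2 = 2 ^+ n.+2 * (e * (e * e ^+ n)).
  by rewrite -[e *+ 2]mulr_natl exprMn; congr (_ * _); rewrite -!exprS.
move: ek en; rewrite ler_pdivlMr//.
rewrite /W; have : 0 < 2 ^+ n.+2 :> R by rewrite exprn_gt0.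
move: (2 ^+ n.+2) (e ^+ n) => p q p0 ek /andP[q0 q1].
have -> : a * (b / e * (p * (e * (e * q)))) + p * (e * (e * q)) = (e * ((a * b + e) * p)) * q.
  by field; rewrite gt_eqF.
apply: (@le_trans _ _ ((e * ((a * b + 1) * p)) * 1)); last by rewrite mulr1.
have ab : 0 <= a * b by rewrite mulr_ge0.
apply: ler_pM => //.
  by rewrite !mulr_ge0// ?(ltW e0) ?(ltW p0)// addr_ge0// ltW.
by rewrite ler_pM2l// ler_pM2r// lerD2l.
Qed.

(** * The bound on the superlevel set for a fixed weight [t] *)

Section superlevel.
Context {R : realType} {m : nat}.
Local Notation V := 'rV[R]_m.+2.
Local Notation X := (leb_rV R m.+2).
Local Notation mu := (lebesgue R m.+2).
Local Notation N := (m.+2%:R : R).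
Variables (F : R -> R) (Omega : set V) (B : V -> 'M[R]_m.+2) (C : R).
Hypothesis bO : bounded_domain Omega.
Hypothesis lB : [lipschitz B x | x in Omega].
Hypothesis sobolev : prop_vanishing_sobolev F Omega B C.
Variables (x : V) (r C0 : R) (w : V -> R) (gradw : V -> 'cV[R]_m.+2).
Hypothesis r0 : 0 < r.
Hypothesis UO : cball F x (2 * r) `<=` Omega.
Hypothesis Ww : W12A B (cball F x (2 * r)) (fun y => Num.max (w y) 0) gradw.
Hypothesis gradC0 : (\int[mu]_(y in cball F x (2 * r)) (enorm (gradw y) ^+ 2)%:E <= C0%:E)%E.

Let U := cball F x (2 * r).
Let v y := Num.max (w y) 0.
Let calA := [set y | cball F x r y /\ w y <= 0].
Let calC := [set z | cball F x r z /\ 1 <= w z].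
Let calD := [set y | cball F x (2 * r) y /\ 0 < w y < 1].
Hypothesis halfA : 2^-1 * vol (cball F x r) <= vol calA.

Let mU : measurable (U : set X). Proof. exact: measurable_cball. Qed.
Let bU : bounded_set U.
Proof. by have [_ _ _ [M [Mr MO]]] := bO; exists M; split => // k Mk y /UO; exact: MO. Qed.
Let Uoo : (mu U < +oo)%E. Proof. exact: lebesgue_bounded. Qed.
Let BU : cball F x r `<=` U. Proof. by apply: cball_le; rewrite ler_peMl ?ler1n// ltW. Qed.
Let mB : measurable (cball F x r : set X). Proof. exact: measurable_cball. Qed.

Let finU (S : set V) : measurable (S : set X) -> S `<=` U -> mu S \is a fin_num.
Proof.
move=> mS SU; rewrite ge0_fin_numE//; apply: le_lt_trans Uoo; apply: le_measure; rewrite ?inE//.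
Qed.

Let mv : measurable_fun (U : set X) (v : X -> R). Proof. by have [[]] := Ww. Qed.

Lemma measurable_calA : measurable (calA : set X).
Proof.
rewrite (_ : calA = (U `&` v @^-1` `]-oo, 0]%classic) `&` cball F x r).
  by apply: measurableI => //; apply: mv => //; exact: measurable_itv.
apply/seteqP; split=> y /=; rewrite in_itv/= /v ge_max lexx andbT.
  by move=> [By wy]; split => //; split => //; exact: BU.
by move=> [[_ wy] By].
Qed.

Let mcalA := measurable_calA.

Let mcalC : measurable (calC : set X).
Proof.
rewrite (_ : calC = (U `&` v @^-1` `[1, +oo[%classic) `&` cball F x r).
  by apply: measurableI => //; apply: mv => //; exact: measurable_itv.
apply/seteqP; split=> y /=; rewrite in_itv/= /v le_max andbT ler10 orbF.
  by move=> [By wy]; split => //; split => //; exact: BU.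
by move=> [[_ wy] By].
Qed.

Let mcalD : measurable (calD : set X).
Proof.
rewrite (_ : calD = U `&` v @^-1` `]0, 1[%classic).
  by apply: mv => //; exact: measurable_itv.
by apply/seteqP; split=> y /=; rewrite in_itv/= /v lt_max gt_max ltxx ltr01 orbF andbT.
Qed.

(** The Sobolev inequality for the competitor on the ball of radius [r']. The tolerance [k] absorbs
    the approximations, one third each for the inner ball, the mollification and the cutoff. [C] has
    no prescribed sign, hence its absolute value. *)
Lemma superlevel_volume_le (t k : R) : 0 < t -> 0 < k ->
  vol calC <= `|C| * r * (2 * t * C0 + 2 / t * vol calD) + k.
Proof.
move=> t0 k0.
have C00 : 0 <= C0.
  by rewrite -lee_fin; apply: le_trans gradC0; apply: integral_ge0 => y _; rewrite lee_fin sqr_ge0.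
have vol0 (S : set V) : 0 <= vol S by rewrite fine_ge0.
have t20 : 0 <= 2 * t by rewrite mulr_ge0// ltW.
have it0 : 0 <= 2 / t by rewrite divr_ge0// ltW.
have Cr0 : 0 <= `|C| * r by rewrite mulr_ge0// ltW.
have main0 : 0 <= `|C| * r * (2 * t * C0 + 2 / t * vol calD).
  by rewrite mulr_ge0// addr_ge0// mulr_ge0.
(* If [calC] is null there is nothing to prove; otherwise some small cube meets it in positive
   measure. *)
have [volC0|volC0] := leP (vol calC) 0; first by rewrite (le_trans volC0)// addr_ge0// ltW.
have CU : calC `<=` U by move=> y [/BU].
have AU : calA `<=` U by move=> y [/BU].
have DU : calD `<=` U by move=> y [].
have fC := finU mcalC CU; have fD := finU mcalD DU.
have muC0 : (0 < mu calC)%E by rewrite -(fineK fC) lte_fin.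
have [oO _ _ bdO] := bO.
have [M M0 MB] := entries_bounded bdO lB.
pose cn : R := bump_half ^+ m.+2; have cn0 : 0 < cn by rewrite exprn_gt0// bump_half_gt0.
pose K0 := N * (N * (M * (4 * (N * 8 / cn)))).
have K00 : 0 <= K0.
  rewrite /K0; do 4 (apply: mulr_ge0 => //); apply: divr_ge0; [exact: mulr_ge0|exact: ltW].
have k30 : 0 < k / 3 by rewrite divr_gt0.
(* [K0] does not involve [e], so the scale depends on the tolerance and not on the position of the
   cube. *)
have [e e0 ePk] := small_radius m Cr0 K00 k30.
pose P := N * (N * (M * (4 * (N * 8 / e / cn)))).
have PE : P = K0 / e by rewrite /P /K0; ring.
have P0 : 0 <= P by rewrite PE divr_ge0// ltW.
have e20 : 0 < e / 2 by rewrite divr_gt0.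
have [z zC] := charged_ball mcalC muC0 e20.
set C' := calC `&` ball z (e / 2) in zC.
have mC' : measurable (C' : set X) by apply: measurableI => //; exact: leb_ball.
have C'U : C' `<=` U by move=> y [/CU].
have fC' := finU mC' C'U.
have nu0 : 0 < vol C' by rewrite fine_gt0// zC ltey_eq fC'.
(* One quarter of the measure of [C'] is allowed for each of the two losses near the boundary, from
   [calA] and from [C']. *)
have d10 : 0 < Num.min (k / 3) (vol C' / 4) by rewrite lt_min k30 divr_gt0.
have Boo : (mu (cball F x r) < +oo)%E by rewrite -ge0_fin_numE// finU.
have [r' /andP[r'0 r'r] innerB] := cball_inner r0 Boo d10.
set d1 := Num.min _ _ in d10 innerB.
have d1k : d1 <= k / 3 by rewrite ge_min lexx.
have d1nu : d1 <= vol C' / 4 by rewrite ge_min lexx orbT.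
pose h := 8 / t + 4 * N; have h0 : 0 <= h by rewrite addr_ge0 ?divr_ge0 ?mulr_ge0// ltW.
(* [h] is the coefficient of the error in the gradient bound and 4 the one in [indic_le_competitor];
   the 1/8 makes [4 * dl] at most half of the measure of [C']. *)
pose dl := Num.min (k / 3 / (`|C| * r * h + 4)) (vol C' / 8).
have ch0 : 0 < `|C| * r * h + 4 by rewrite ltr_wpDl// mulr_ge0.
have dl0 : 0 < dl by rewrite lt_min !divr_gt0.
have dlk : dl * (`|C| * r * h + 4) <= k / 3 by rewrite -ler_pdivlMr// ge_min lexx.
have dlnu : dl <= vol C' / 8 by rewrite ge_min lexx orbT.
pose K := cball F x (2 * r'); pose B' := cball F x r'.
have mK : measurable (K : set X) by exact: measurable_cball.
have mB' : measurable (B' : set X) by exact: measurable_cball.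
have r2 : 2 * r' < 2 * r by rewrite ltr_pM2l.
have KU : K `<=` U by apply: cball_le; exact: ltW.
have B'K : B' `<=` K by apply: cball_le; rewrite ler_peMl ?ler1n// ltW.
have B'B : B' `<=` cball F x r by apply: cball_le; exact: ltW.
have [eta eta0 KUeta] := cball_separated bU r2.
have [phi [err [L [phiL dphi [merr err0 interr] phierr gerr]]]] :=
  W12A_approximation oO bdO lB mU UO Ww mK eta0 KUeta dl0.
have BM y : K y -> forall i j, `|B y i j| <= M by move=> Ky i j; apply: MB; exact/UO/KU.
have v0 y : 0 <= v y by rewrite le_max lexx orbT.
have Dv y : K y -> 0 < v y < 1 -> calD y.
  by move=> Ky; rewrite /v lt_max gt_max ltxx ltr01 orbF andbT => wy; split => //; exact: KU.
have phiL' a c : `|phi a - phi c| <= `|L| * `|a - c|.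
  by apply: le_trans (phiL a c) _; rewrite ler_wpM2r// ler_norm.
pose u := competitor phi e z.
have [Ku Ku0 uL] := competitor_lipschitz z e0 (normr_ge0 L) phiL'.
have u0 y : 0 <= u y := competitor_bounds phi e z y.
pose E0 := [set y | phi y <= 4^-1 \/ bump_half ^+ m.+2 <= molli e z y] : set V.
have cphi : continuous phi := lipschitz_bound_continuous phiL.
have cmol : continuous (@molli R m.+2 e z) by exact: molli_continuous.
have mE0 : measurable (E0 : set X).
  apply: measurableU.
    have := @leb_continuous R m.+2 phi cphi measurableT _ (measurable_itv `]-oo, 4^-1]%R).
    by rewrite setTI; congr measurable; apply/seteqP; split => y /=; rewrite in_itv.
  have := @leb_continuous R m.+2 _ cmol measurableT _ (measurable_itv `[bump_half ^+ m.+2, +oo[%R).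
  by rewrite setTI; congr measurable; apply/seteqP; split => y /=; rewrite in_itv/= andbT.
have cu : continuous u := lipschitz_bound_continuous uL.
have muu : measurable_fun (B' : set X) (u : X -> R).
  exact: (measurable_funS measurableT (@subsetT _ _) (leb_continuous cu)).
have merrB' : measurable_fun (B' : set X) (err : X -> R).
  exact: (measurable_funS measurableT (@subsetT _ _) merr).
have merrK : measurable_fun (K : set X) (err : X -> R).
  exact: (measurable_funS measurableT (@subsetT _ _) merr).
have mQ : measurable (ball z e : set X) by exact: leb_ball.
have interrB' : (\int[mu]_(y in B') (err y)%:E <= dl%:E)%E.
  exact: le_trans (subset_integral_EFin mu mB' mK B'K merr err0) interr.
have B'U : B' `<=` U := subset_trans B'K KU.
have fI (S : set V) : measurable (S : set X) -> mu (S `&` B') \is a fin_num.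
  by move=> mS; apply: finU; [exact: measurableI|move=> y [_ /B'U]].
have splitA : vol calA <= vol (calA `&` B') + d1.
  by apply: (fine_measure_split mcalA mB mB' _ Boo innerB) => y [].
have splitC' : vol C' <= vol (C' `&` B') + d1.
  by apply: (fine_measure_split mC' mB mB' _ Boo innerB) => y [[]].
have splitC : vol calC <= vol (calC `&` B') + d1.
  by apply: (fine_measure_split mcalC mB mB' _ Boo innerB) => y [].
have volB'B : vol B' <= vol (cball F x r).
  apply: fine_le; [exact: finU|exact: finU|].
  by apply: le_measure => //; apply/mem_set.
pose E := (E0 `&` B' : set V).
(* The zero set has at least the measure of [calA] plus that of [C'], minus [2 * d1 + 4 * dl]. This
   loss is at most the measure of [C'], so the measure of [calA], hence half of that of [B'],
   remains. *)
have volE : 2^-1 * vol B' <= vol E.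
  have H1 : vol (calA `&` B') + vol (C' `&` B') <= vol E + 4 * dl.
    have H := @measure_add_le_integral _ X R mu B' mB' err calA C' E0 4 (ler0n _ _) merrB' mcalA mC' mE0.
    rewrite -lee_fin !EFinD !fineK ?fI//; apply: le_trans (H _ _) _.
    - by move=> y _.
    - move=> y yB; apply: (@indic_le_vanishing _ _ phi err v e z e0 y (err0 y) (phierr y (B'K y yB))) => //.
      + by move=> [_ wy]; rewrite /v ge_max wy lexx.
      + by move=> [].
      + by move=> [_ wA] [[_ wC] _]; have := le_trans wC wA; rewrite ler10.
    - by rewrite leeD2l// EFinM lee_wpmul2l.
  move: halfA splitA splitC' volB'B H1 d1nu dlnu.
  move: (vol calA) (vol (calA `&` B')) (vol (C' `&` B')) (vol C') (vol B') (vol E) (vol (cball F x r)).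
  move=> a1 a2 a3 a4 a5 a6 a7; lra.
have sob := sobolev r'0 (subset_trans KU UO).
have lipu : [lipschitz u y | y in cball F x (2 * r')].
  by apply/lipschitzP; exists Ku => // a c _ _; exact: uL.
have mE : measurable (E : set X) by exact: measurableI.
have {}sob := sob u E lipu mE (@subIsetr _ _ _) (fun y Ey => competitor_vanish (proj1 Ey)) volE.
have upper : (\int[mu]_(y in K) (enorm (nablaA B u y))%:E <=
    (2 * t * C0 + 2 / t * vol calD + h * dl + P * (e *+ 2) ^+ m.+2)%:E)%E.
  pose f y := enorm (gradw y) ^+ 2.
  have mfU : measurable_fun (U : set X) (f : X -> R).
    rewrite (_ : f = fun y => \sum_i (gradw y i 0) ^+ 2); last by apply/funext => y; rewrite /f sqr_enorm.
    apply: (@measurable_sum_sqr _ X R _ (fun i y => gradw y i 0)) => i.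
    by have [_ L2g _] := Ww; have [] := L2g i.
  have mf : measurable_fun (K : set X) (f : X -> R) by exact: (measurable_funS mU KU mfU).
  have ub := @integral_upper_bound _ X R mu K mK f err calD (ball z e) (2 * t) (2 / t) h P
    mf merrK mcalD mQ (fun y _ => sqr_ge0 _) (fun y _ => err0 y) t20 it0 h0 P0.
  apply: (le_trans (le_trans _ ub)).
    apply: ge0_mono_integral => y Ky; first by rewrite lee_fin enorm_ge0.
    rewrite lee_fin; apply: (@enorm_nablaA_competitor _ _ B phi err v gradw e z M t e0 t0 dphi y M0 (BM y Ky)) => //.
    - exact: phierr.
    - by move=> i; exact: gerr.
    - exact: Dv.
  rewrite !EFinD; apply: leeD; [apply: leeD; [apply: leeD|]|].
  - rewrite (EFinM (2 * t) C0) lee_wpmul2l ?lee_fin//; apply: le_trans gradC0.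
    apply: ge0_subset_integral => //.
      exact/measurable_EFinP.
    by move=> y _; rewrite lee_fin sqr_ge0.
  - by rewrite (EFinM (2 / t)) fineK.
  - by rewrite (EFinM h) lee_wpmul2l ?lee_fin.
  - by rewrite (EFinM P) lebesgue_ball.
have intu : (\int[mu]_(y in B') (u y)%:E <=
    (`|C| * r * (2 * t * C0 + 2 / t * vol calD + h * dl + P * (e *+ 2) ^+ m.+2))%:E)%E.
  have -> : (\int[mu]_(y in B') (u y)%:E = \int[mu]_(y in B') `|u y|%:E)%E.
    by apply: eq_integral => y _; rewrite ger0_norm.
  apply: le_trans sob _; rewrite (EFinM (`|C| * r)); apply: (@le_trans _ _ ((`|C| * r)%:E * \int[mu]_(y in K) (enorm (nablaA B u y))%:E)%E).
    rewrite lee_wpmul2r//; first by apply: integral_ge0 => y _; rewrite lee_fin enorm_ge0.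
    rewrite lee_fin; apply: (@le_trans _ _ (`|C| * r')); first by rewrite ler_wpM2r ?(ltW r'0)// ler_norm.
    by rewrite ler_wpM2l// ltW.
  by rewrite lee_wpmul2l ?lee_fin.
have lower : vol (calC `&` B') <= `|C| * r * (2 * t * C0 + 2 / t * vol calD + h * dl + P * (e *+ 2) ^+ m.+2)
    + 4 * dl + (e *+ 2) ^+ m.+2.
  have H := @measure_le_integral _ X R mu B' mB' u err calC (ball z e) 4 (ler0n _ _) muu merrB' mcalC mQ
    (fun y _ => u0 y) (fun y _ => err0 y).
  rewrite -lee_fin fineK ?fI//; apply: le_trans (H _) _.
    move=> y yB; apply: (@indic_le_competitor _ _ phi err v e z e0 y (err0 y) (phierr y (B'K y yB))).
    by move=> [_ wy]; rewrite /v le_max wy.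
  rewrite !EFinD; apply: leeD; [apply: leeD => //|].
    by rewrite (EFinM 4 dl) lee_wpmul2l ?lee_fin.
  by rewrite lebesgue_ball.
rewrite -PE in ePk.
move: splitC lower ePk dlk d1k; set q := (e *+ 2) ^+ m.+2; set cr := `|C| * r in Cr0 ch0 main0 *; set G := 2 * t * C0 + _.
clearbody h P q cr.
rewrite (_ : cr * (G + h * dl + P * q) = cr * G + dl * (cr * h) + cr * (P * q)); last ring.
rewrite (_ : dl * (cr * h + 4) = dl * (cr * h) + 4 * dl); last ring.
lra.
Qed.

End superlevel.

(** After multiplication by [t], the hypothesis says that a quadratic polynomial in [t] is
    nonnegative for [t > 0]; it is evaluated at its vertex [a / (4 * (b * X))]. If [b * X = 0], a
    large [t] is contradictory unless [a = 0]. *)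
Lemma optimize_am_gm (R : realFieldType) (a b X Y : R) : 0 <= a -> 0 <= b -> 0 <= X -> 0 <= Y ->
  (forall t, 0 < t -> a <= b * (2 * t * X + 2 / t * Y)) -> a ^+ 2 <= 16 * b ^+ 2 * (X * Y).
Proof.
move=> a0 b0 X0 Y0 H.
have [->|an0] := eqVneq a 0; first by rewrite expr0n/= !mulr_ge0// sqr_ge0.
have {an0}a0 : 0 < a by rewrite lt_def an0.
have Ht t : 0 < t -> a * t <= 2 * (b * X) * t ^+ 2 + 2 * (b * Y).
  move=> t0; have := H t t0; rewrite -(ler_pM2r t0) => /le_trans; apply.
  by rewrite le_eqVlt; apply/orP; left; apply/eqP; field; rewrite gt_eqF.
have bX0 : 0 <= b * X by rewrite mulr_ge0.
have bY0 : 0 <= b * Y by rewrite mulr_ge0.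
have [bX|bX] := eqVneq (b * X) 0.
  have t0 : 0 < (2 * (b * Y) + 1) / a by rewrite divr_gt0// ltr_wpDl// mulr_ge0.
  by have := Ht _ t0; rewrite bX mulr0 mul0r add0r mulrC divfK ?gt_eqF//; lra.
have {bX0}bX0 : 0 < b * X by rewrite lt_def bX.
have /andP[bn Xn] : (b != 0) && (X != 0) by rewrite -negb_or -mulf_eq0.
have t0 : 0 < a / (4 * (b * X)) by rewrite divr_gt0// mulr_gt0.
have p8 : 0 < 8 * (b * X) by rewrite mulr_gt0.
have := Ht _ t0; rewrite -(ler_pM2r p8).
have -> : a * (a / (4 * (b * X))) * (8 * (b * X)) = 2 * a ^+ 2 by field; rewrite bn Xn.
have -> : (2 * (b * X) * (a / (4 * (b * X))) ^+ 2 + 2 * (b * Y)) * (8 * (b * X)) =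
  a ^+ 2 + 16 * b ^+ 2 * (X * Y) by field; rewrite bn Xn.
lra.
Qed.

Theorem lemma15 (R : realType) (C : R) :
  exists2 C1 : R, 0 < C1 &
  forall (n : nat) (Omega : set 'rV[R]_n.+2) (F : R -> R)
    (B : 'rV[R]_n.+2 -> 'M[R]_n.+2),
    bounded_domain Omega ->
    structure_conditions F ->
    [lipschitz B x | x in Omega] ->
    comparable_on Omega (fun x => (B x)^T *m B x) (@M_F R F n.+1) ->
    prop_vanishing_sobolev F Omega B C ->
  forall (x : 'rV[R]_n.+2) (r C0 : R) (w : 'rV[R]_n.+2 -> R)
    (gradw : 'rV[R]_n.+2 -> 'cV[R]_n.+2),
    0 < r ->
    cball F x (2 * r) `<=` Omega ->
    W12A B (cball F x (2 * r)) (fun y => Num.max (w y) 0) gradw ->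
    (\int[lebesgue R n.+2]_(y in cball F x (2 * r))
       (enorm (gradw y) ^+ 2)%:E <= C0%:E)%E ->
    let calA := [set y | cball F x r y /\ w y <= 0] in
    let calC := [set z | cball F x r z /\ 1 <= w z] in
    let calD := [set y | cball F x (2 * r) y /\ 0 < w y < 1] in
    2^-1 * vol (cball F x r) <= vol calA ->
    C1 * ((vol calA * vol calC) / (r * vol (cball F x r))) ^+ 2
      <= C0 * vol calD.
Proof.
(* The added 1 keeps the constant invertible when [C = 0]. *)
have K0 : 0 < 16 * C ^+ 2 + 1 by rewrite ltr_wpDl// mulr_ge0// sqr_ge0.
exists (16 * C ^+ 2 + 1)^-1; first by rewrite invr_gt0.
move=> n Omega F B bO _ lB _ sob x r C0 w gradw r0 UO Ww gC0 calA calC calD halfA.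
have C00 : 0 <= C0.
  by rewrite -lee_fin; apply: le_trans gC0; apply: integral_ge0 => y _; rewrite lee_fin sqr_ge0.
have vol0 (S : set 'rV[R]_n.+2) : 0 <= vol S by rewrite fine_ge0.
have key : vol calC ^+ 2 <= 16 * (`|C| * r) ^+ 2 * (C0 * vol calD).
  apply: optimize_am_gm => //; first by rewrite mulr_ge0// ltW.
  (* The tolerance [k] is removed while [t] is fixed; only then is [t] optimised. *)
  move=> t t0; apply/ler_addgt0Pr => k k0.
  exact: (superlevel_volume_le bO lB sob r0 UO Ww gC0 halfA t0 k0).
have AB : vol calA <= vol (cball F x r).
  have [_ _ _ bdO] := bO.
  have mB : measurable (cball F x r : set (leb_rV R n.+2)) by exact: measurable_cball.
  have BU : cball F x r `<=` cball F x (2 * r) by apply: cball_le; rewrite ler_peMl ?ler1n// ltW.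
  have bB : bounded_set (cball F x r).
    by have [M [Mr MO]] := bdO; exists M; split => // k Mk y /BU/UO; exact: MO.
  have mA : measurable (calA : set (leb_rV R n.+2)) by exact: (measurable_calA r0 Ww).
  have Boo := lebesgue_bounded bB mB.
  have AsB : (lebesgue R n.+2 calA <= lebesgue R n.+2 (cball F x r))%E.
    by apply: le_measure; [exact/mem_set|exact/mem_set|move=> y []].
  by apply: fine_le => //; rewrite ge0_fin_numE//; apply: le_lt_trans Boo.
set X := C0 * vol calD in key *; have X0 : 0 <= X by rewrite mulr_ge0.
(* The inverse of 0 is 0, so the left-hand side vanishes in this case. *)
have [vB|vB] := eqVneq (vol (cball F x r)) 0.
  by rewrite vB mulr0 invr0 mulr0 expr0n/= mulr0.
have {}vB : 0 < vol (cball F x r) by rewrite lt_def vB vol0.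
rewrite mulrC ler_pdivrMr//.
(* The proportion of the ball filled by [calA] is at most 1 and is dropped. *)
apply: (@le_trans _ _ ((vol calC / r) ^+ 2)).
  rewrite lerXn2r ?nnegrE ?divr_ge0 ?mulr_ge0 ?(ltW r0)//.
  have -> : vol calA * vol calC / (r * vol (cball F x r)) =
      vol calA / vol (cball F x r) * (vol calC / r) by field; rewrite !gt_eqF.
  by rewrite ler_piMl ?divr_ge0 ?(ltW r0)// ler_pdivrMr// mul1r.
rewrite expr_div_n ler_pdivrMr ?exprn_gt0//; apply: le_trans key _.
rewrite exprMn real_normK ?num_real// mulrAC mulrA ler_wpM2r ?sqr_ge0//.
lra.
Qed.
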